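(* Let $1\le p<\infty$ and let $g$ be holomorphic on $\mathbb{B}_n$. The following statements are equivalent: (a) $V_g$ is compact on $A^p_\psi(\mathbb{B}_n)$; (b) $|\mathcal{R}g(z)|^p(1-|z|^2)^{2p}\,dv(z)$ is a vanishing Carleson measure for $A^p_\psi(\mathbb{B}_n)$; (c) $|\mathcal{R}g(z)|(1-|z|^2)^2\to0$ as $|z|\to1^-$.
   Context: $\mathbb{B}_n$ is the open unit ball of $\mathbb{C}^n$, $v$ is Lebesgue measure, $\psi(z)=\frac{1}{1-|z|^2}$. $A^p_\psi(\mathbb{B}_n)$ is the space of holomorphic $f$ on $\mathbb{B}_n$ with $\int|f|^pe^{-\psi}dv<\infty$. A positive Borel measure $\mu$ is a vanishing Carleson measure for $A^p_\psi(\mathbb{B}_n)$ if $\int|f_j|^pe^{-\psi}d\mu\to0$ whenever $\{f_j\}$ is a bounded sequence in $A^p_\psi(\mathbb{B}_n)$ converging to $0$ uniformly on compact subsets. $\mathcal{R}g(z)=\sum_{j=1}^nz_j\frac{\partial g}{\partial z_j}(z)$ and $V_gf(z)=\int_0^1f(tz)\mathcal{R}g(tz)\frac{dt}{t}$. *)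

(* Defs.v *)
From HB Require Import structures.
From mathcomp Require Import all_boot all_order all_algebra.
From mathcomp Require Import complex.
From mathcomp Require Import all_classical all_reals all_analysis.
Import Order.TTheory GRing.Theory Num.Theory.
Import numFieldNormedType.Exports.

Set Implicit Arguments.
Unset Strict Implicit.
Unset Printing Implicit Defensive.

Local Open Scope ring_scope.
Local Open Scope classical_set_scope.

Section BergmanDefs.
Context {R : realType}.

(* Points of C^n are row vectors 'rV[R[i]]_n; values of functions live in
   R[i]^o, i.e. C viewed as a normed C-module (so that [differentiable]
   is complex (Frechet) differentiability). *)
Local Notation C := (R[i]).
Local Notation Cn n := ('rV[C]_n).
Local Notation fn n := (Cn n -> C^o).

(* C^n seen as a normed C-module (max-norm; only its topology matters) *)
Definition CnN n : normedModType C := Cn n.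

Definition cabs (c : C) : R := Normc.normc c.

Definition normz n (z : Cn n) : R := Num.sqrt (\sum_(j < n) cabs (z 0 j) ^+ 2).

Definition Bn n : set (Cn n) := [set z | normz z < 1].

Definition psi n (z : Cn n) : R := (1 - normz z ^+ 2)^-1.

Definition holo n (f : fn n) : Prop :=
  forall z : Cn n, Bn z -> differentiable f (z : CnN n).

(* Lebesgue integral over C = R^2 of a nonnegative function
   (iterated, by Tonelli) *)
Definition cint (h : C -> \bar R) : \bar R :=
  (\int[lebesgue_measure]_x \int[lebesgue_measure]_y h (Complex x y))%E.

(* Lebesgue integral (dv) over C^n = R^(2n) of a nonnegative function,
   computed as an iterated integral over the coordinates (Tonelli). *)
Fixpoint vint (n : nat) : (Cn n -> \bar R) -> \bar R :=
  match n return (Cn n -> \bar R) -> \bar R with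
  | 0 => fun f => f 0
  | m.+1 => fun f =>
      cint (fun c => vint (fun z : Cn m => f (row_mx (const_mx c : 'rV[C]_1) z)))
  end.

Definition wint (p : R) n (w : Cn n -> R) (f : fn n) : \bar R :=
  vint (fun z => if normz z < 1 then
                   ((cabs (f z)) `^ p * expR (- psi z) * w z)%:E
                 else 0%E).

Definition Apint (p : R) n (f : fn n) : \bar R := wint p (fun _ => 1) f.

Definition inA (p : R) n (f : fn n) : Prop := holo f /\ (Apint p f < +oo)%E.

Definition Abounded (p : R) n (f : nat -> fn n) : Prop :=
  (forall j, inA p (f j)) /\ exists M : R, forall j, (Apint p (f j) <= M%:E)%E.

Definition ucc0 n (f : nat -> fn n) : Prop :=
  forall K : set (CnN n), compact K -> K `<=` @Bn n ->
  forall eps : R, 0 < eps ->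
  \forall j \near \oo, forall z, K z -> cabs (f j z) < eps.

Definition vanishing_carleson (p : R) n (w : Cn n -> R) : Prop :=
  forall f : nat -> fn n, Abounded p f -> ucc0 f ->
  ((fun j => wint p w (f j)) @ \oo --> 0%E)%E.

Definition Rder n (g : fn n) (z : Cn n) : C :=
  \sum_(j < n) z 0 j * ('D_(delta_mx 0 j) g z : C).

Definition Vop n (g : fn n) (f : fn n) : fn n := fun z =>
  let h := fun t : R => (f ((t%:C)%C *: z) * Rder g ((t%:C)%C *: z) / (t%:C)%C : C) in
  Complex (Rintegral lebesgue_measure `[0, 1]%classic (fun t => complex.Re (h t)))
          (Rintegral lebesgue_measure `[0, 1]%classic (fun t => complex.Im (h t))).

Definition compact_op (p : R) n (T : fn n -> fn n) : Prop :=
  forall f : nat -> fn n, Abounded p f ->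
  (forall j, inA p (T (f j))) /\
  exists phi : nat -> nat, {homo phi : a b / (a < b)%N} /\
  exists h : fn n, inA p h /\
  ((fun j => Apint p (fun z => (T (f (phi j)) z - h z)%R)) @ \oo --> 0%E)%E.

End BergmanDefs.

(* Main.v *)
Require Import Defs.
From HB Require Import structures.
From mathcomp Require Import all_boot all_order all_algebra.
From mathcomp Require Import complex.
From mathcomp Require Import all_classical all_reals all_analysis.
From mathcomp Require Import measurable_realfun.
From mathcomp Require Import ring lra.
Import Order.TTheory GRing.Theory Num.Theory.
Import numFieldNormedType.Exports.
(** (c) => (b): split the integral at |z| = r.  (b) => (a): on a ray, a Hardy
    inequality with weight (1-|tz|^2)^-2 exp(-b(psi(z)-psi(tz))), whose integral
    over 1/2 <= t <= 1 is bounded, gives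
      ||V_g f||^p <= K (sup_(|z|<=1/2) |f|^p + int |f|^p |Rg|^p (1-|z|^2)^(2p) exp(-psi)),
    and bounded sequences of A^p_psi have locally uniformly convergent subsequences.
    (a) => (c): let N(a) be the norm of evaluation at a.  Since N = O(exp(K psi)),
    every ray has levels psi = y, arbitrarily far out, from which N grows at most by
    a fixed factor up to psi = y + 1.  If |Rg|(1-|z|^2)^2 does not tend to 0, the
    maximum principle on the complex line through a bad point yields a bad point a
    on such a level.  Near-extremal functions for a, times powers of <z,a>/|a|, are
    bounded and tend to 0 locally uniformly, while Cauchy's estimate for
    V_g f(l a), |l-1| < (1-|a|^2)^2/3, gives |Rg(a)|(1-|a|^2)^2 <= C ||V_g f||. *)


Set Implicit Arguments.
Unset Strict Implicit.
Unset Printing Implicit Defensive.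

Local Open Scope ring_scope.
Local Open Scope classical_set_scope.

Arguments cabs {R} c : simpl never.

(** No explicit kernel enters (a) => (c): of a test function only its norm and its value at a are
    known. Cauchy's estimate at a then needs N <= C N(a) on a disc of radius about (1-|a|^2)^2, the
    region where psi rises by at most 1. N has no regularity of its own there; this forces the
    special levels, and as a bad point need not lie on one, the maximum principle moves it there.
    The power of <z,a>/|a| is about psi(a)/2: since |a|^2 = 1 - 1/psi(a), it keeps a fixed fraction
    at a. In the Hardy inequality b = 1/(2p). With D = psi(z) - psi(tz), the exponent p-1 turns
    exp(-b D) into at most exp(D/2). What remains of exp(-psi(z)) is exp(-psi(z)/2) exp(-psi(tz)/2),
    a function of z times a function of tz. After Tonelli and w = tz, the integral in t of
    exp(-psi(w/t)/2) gives back the two powers of 1-|w|^2 lost to the kernel. Holomorphy of limits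
    and of integrals in a parameter comes from quadratic Taylor bounds that involve finitely many
    values of the function, and contours are squares. As dv is an iterated integral, changes of
    variables reduce to affine ones on the real line. *)

Section ComplexModulus.
Variable R : realType.
Local Notation C := (R[i]).
Implicit Types z w : C.

Lemma cabs_ge0 z : 0 <= cabs z.
Proof. by case: z => a b; exact: sqrtr_ge0. Qed.

Lemma cabs0 : cabs (0 : C) = 0. Proof. exact: Normc.normc0. Qed.

Lemma cabs1 : cabs (1 : C) = 1. Proof. exact: Normc.normc1. Qed.

Lemma cabsM z w : cabs (z * w) = cabs z * cabs w.
Proof. exact: Normc.normcM. Qed.

Lemma cabsV z : cabs z^-1 = (cabs z)^-1.
Proof. exact: Normc.normcV. Qed.

Lemma cabsN z : cabs (- z) = cabs z.
Proof. exact: normcN. Qed.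

Lemma cabsB z w : cabs (z - w) = cabs (w - z).
Proof. by rewrite -cabsN opprB. Qed.

Lemma cabsD z w : cabs (z + w) <= cabs z + cabs w.
Proof. exact: le_normcD. Qed.

Lemma cabsX z k : cabs (z ^+ k) = cabs z ^+ k.
Proof. by elim: k => [|k IH]; rewrite ?cabs1// !exprS cabsM IH. Qed.

Lemma cabs_eq0 z : (cabs z == 0) = (z == 0).
Proof.
apply/eqP/eqP => [|->]; [exact: Normc.eq0_normc|exact: cabs0].
Qed.

Lemma cabs_gt0 z : (0 < cabs z) = (z != 0).
Proof. by rewrite lt_neqAle cabs_ge0 andbT eq_sym cabs_eq0. Qed.

Lemma sqr_cabs z : cabs z ^+ 2 = complex.Re z ^+ 2 + complex.Im z ^+ 2.
Proof. by case: z => a b /=; rewrite /cabs/= sqr_sqrtr// addr_ge0// sqr_ge0. Qed.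

Lemma ler_Re_cabs z : `|complex.Re z| <= cabs z.
Proof.
rewrite -(@ler_pXn2r _ 2)// ?nnegrE ?cabs_ge0//.
by rewrite sqr_cabs real_normK ?num_real// lerDl sqr_ge0.
Qed.

Lemma ler_Im_cabs z : `|complex.Im z| <= cabs z.
Proof.
rewrite -(@ler_pXn2r _ 2)// ?nnegrE ?cabs_ge0//.
by rewrite sqr_cabs real_normK ?num_real// lerDr sqr_ge0.
Qed.

Lemma cabsE_real (x : R) : cabs (x%:C)%C = `|x|.
Proof. by rewrite /cabs/= expr0n/= addr0 sqrtr_sqr. Qed.

Lemma cabs_imag (y : R) : cabs (Complex 0 y) = `|y|.
Proof. by rewrite /cabs/= expr0n/= add0r sqrtr_sqr. Qed.

Lemma cabs_le_ReIm z : cabs z <= `|complex.Re z| + `|complex.Im z|.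
Proof.
rewrite {1}(complexE z); apply: le_trans (cabsD _ _) _.
by rewrite cabsM cabs_imag normr1 mul1r !cabsE_real.
Qed.

Lemma norm_cabs z : `|z| = ((cabs z)%:C)%C.
Proof. by case: z. Qed.

Lemma cabs_dist z w : `|cabs z - cabs w| <= cabs (z - w).
Proof.
rewrite ler_norml; apply/andP; split.
  rewrite lerNl opprB lerBlDr cabsB.
  by apply: le_trans (cabsD _ _); rewrite subrK.
by rewrite lerBlDr; apply: le_trans (cabsD _ _); rewrite subrK.
Qed.

Lemma cabs_ge_sub z w : cabs z - cabs w <= cabs (z + w).
Proof. by rewrite lerBlDr -(cabsN w); apply: le_trans (cabsD _ _); rewrite addrK. Qed.

Lemma cabs_sum (I : finType) (F : I -> C) : cabs (\sum_i F i) <= \sum_i cabs (F i).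
Proof.
elim/big_ind2 : _ => [|x1 x2 y1 y2 h1 h2|//]; first by rewrite cabs0.
exact: le_trans (cabsD _ _) (lerD h1 h2).
Qed.

Lemma Re_mulE z w : complex.Re (z * w) =
  complex.Re z * complex.Re w - complex.Im z * complex.Im w.
Proof. by case: z => a b; case: w. Qed.

Lemma Im_mulE z w : complex.Im (z * w) =
  complex.Re z * complex.Im w + complex.Im z * complex.Re w.
Proof. by case: z => a b; case: w. Qed.

Lemma ReD z w : complex.Re (z + w) = complex.Re z + complex.Re w.
Proof. by case: z; case: w. Qed.

Lemma ImD z w : complex.Im (z + w) = complex.Im z + complex.Im w.
Proof. by case: z; case: w. Qed.

Lemma ReN z : complex.Re (- z) = - complex.Re z.
Proof. by case: z. Qed.

Lemma ImN z : complex.Im (- z) = - complex.Im z.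
Proof. by case: z. Qed.

Lemma complex_eqP z w : complex.Re z = complex.Re w -> complex.Im z = complex.Im w -> z = w.
Proof. by case: z => a b; case: w => c d /= -> ->. Qed.

End ComplexModulus.

(** * Real and complex integrals over segments *)

Section SegmentIntegrals.
Variable R : realType.
Local Notation C := (R[i]).
Local Notation mu := (@lebesgue_measure R).

Definition contI (f : R -> R) (a b : R) := {within `[a, b], continuous f}.

Lemma contIP (f : R -> R) a b :
  (forall x, a <= x <= b -> forall e, 0 < e -> exists2 d, 0 < d &
     forall y, a <= y <= b -> `|y - x| < d -> `|f y - f x| <= e) -> contI f a b.
Proof.
move=> H; apply/subspace_continuousP => x /=; rewrite in_itv/= => xab.
apply/cvgrPdist_le => e e0; have [d d0 h] := H x xab e e0.
apply/nbhs_ballP; exists d => // y /= xy; rewrite /ball/= in_itv/= => yab.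
by rewrite distrC; apply: h; rewrite // distrC.
Qed.

Lemma contI_integrable (f : R -> R) a b : contI f a b ->
  mu.-integrable `[a, b] (EFin \o f).
Proof. by move=> cf; apply: continuous_compact_integrable => //; exact: segment_compact. Qed.

Definition ri (f : R -> R) a b : R := \int[mu]_(x in `[a, b]) f x.

Lemma eq_ri (f g : R -> R) a b : (forall x, a <= x <= b -> f x = g x) -> ri f a b = ri g a b.
Proof. by move=> fg; apply: eq_Rintegral => x; rewrite inE/= in_itv/=; exact: fg. Qed.

Lemma riD f g a b : contI f a b -> contI g a b ->
  ri (fun x => f x + g x) a b = ri f a b + ri g a b.
Proof. by move=> cf cg; rewrite /ri RintegralD//; exact: contI_integrable. Qed.

Lemma riZ f k a b : contI f a b -> ri (fun x => k * f x) a b = k * ri f a b.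
Proof. by move=> cf; rewrite /ri RintegralZl//; exact: contI_integrable. Qed.

Lemma ri_cst k a b : a <= b -> ri (fun=> k) a b = (b - a) * k.
Proof.
rewrite le_eqVlt => /predU1P[->|ab].
  by rewrite /ri set_itv1 Rintegral_set1 subrr mul0r.
rewrite /ri Rintegral_cst//.
by rewrite /reverse_coercion/= lebesgue_measure_itv/= lte_fin ab/= mulrC.
Qed.

Lemma contI_cst k a b : contI (fun=> k) a b.
Proof. by apply: continuous_subspaceT => x; exact: cvg_cst. Qed.

Lemma le_ri f g a b : contI f a b -> contI g a b ->
  (forall x, a <= x <= b -> f x <= g x) -> ri f a b <= ri g a b.
Proof.
by move=> cf cg fg; apply: le_Rintegral => //; exact: contI_integrable.
Qed.

Lemma contI_norm f a b : contI f a b -> contI (fun x => `|f x|) a b.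
Proof. by move=> cf x; apply: cvg_norm; exact: cf. Qed.

Lemma ler_norm_ri f a b : contI f a b -> `|ri f a b| <= ri (fun x => `|f x|) a b.
Proof. by move=> cf; apply: le_normr_Rintegral => //; exact: contI_integrable. Qed.

Lemma ri_split f a c b : a <= c -> c <= b -> contI f a b ->
  ri f a b = ri f a c + ri f c b.
Proof.
move=> ac cb cf; have i := contI_integrable cf.
have := @Rintegral_itvB _ f (BLeft a) (BRight b) c i.
rewrite !bnd_simp => /(_ ac cb); rewrite Rintegral_itv_obnd_cbnd; last first.
  apply: integrableS i => //; apply: subset_itv; rewrite ?bnd_simp//.
by rewrite /ri => <-; rewrite addrC subrK.
Qed.

(** Continuity in terms of the real-valued modulus [cabs], which keeps all tolerances real; the
    non-strict conclusion lets bounds be added directly. *)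
Definition ccI (F : R -> C) (a b : R) :=
  forall x, a <= x <= b -> forall e, 0 < e -> exists2 d, 0 < d &
     forall y, a <= y <= b -> `|y - x| < d -> cabs (F y - F x) <= e.

Lemma ccI_Re F a b : ccI F a b -> contI (fun x => complex.Re (F x)) a b.
Proof.
move=> cF; apply: contIP => x xab e e0; have [d d0 h] := cF x xab e e0.
exists d => // y yab yx; apply: le_trans (h y yab yx).
by rewrite -ReN -ReD ler_Re_cabs.
Qed.

Lemma ccI_Im F a b : ccI F a b -> contI (fun x => complex.Im (F x)) a b.
Proof.
move=> cF; apply: contIP => x xab e e0; have [d d0 h] := cF x xab e e0.
exists d => // y yab yx; apply: le_trans (h y yab yx).
by rewrite -ImN -ImD ler_Im_cabs.
Qed.

Lemma ccI_cabs F a b : ccI F a b -> contI (fun x => cabs (F x)) a b.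
Proof.
move=> cF; apply: contIP => x xab e e0; have [d d0 h] := cF x xab e e0.
exists d => // y yab yx; apply: le_trans (h y yab yx).
exact: cabs_dist.
Qed.

Lemma ccI_sub F a b c d : a <= c -> d <= b -> ccI F a b -> ccI F c d.
Proof.
move=> ac db cF x /andP[cx xd] e e0.
have [|r r0 h] := cF x _ e e0; first by rewrite (le_trans ac)//= (le_trans xd).
exists r => // y /andP[cy yd]; apply: h.
by rewrite (le_trans ac)//= (le_trans yd).
Qed.

Lemma ccID F G a b : ccI F a b -> ccI G a b -> ccI (fun x => F x + G x) a b.
Proof.
move=> cF cG x xab e e0; have e2 : 0 < e / 2 by rewrite divr_gt0.
have [d d0 h] := cF x xab _ e2; have [r r0 k] := cG x xab _ e2.
exists (Num.min d r); first by rewrite lt_min d0.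
move=> y yab; rewrite lt_min => /andP[y1 y2].
rewrite (_ : _ - _ = (F y - F x) + (G y - G x)); last by ring.
by rewrite (splitr e); apply: le_trans (cabsD _ _) (lerD (h _ yab y1) (k _ yab y2)).
Qed.

Lemma ccI_cst k a b : ccI (fun=> k) a b.
Proof. by move=> x _ e e0; exists 1 => // y _ _; rewrite subrr cabs0 ltW. Qed.

Lemma ccIZ F k a b : ccI F a b -> ccI (fun x => k * F x) a b.
Proof.
move=> cF x xab e e0.
have k0 : 0 < cabs k + 1 by rewrite ltr_wpDl ?cabs_ge0.
have [|d d0 h] := cF x xab (e / (cabs k + 1)); first by rewrite divr_gt0.
exists d => // y yab yx; rewrite -mulrBr cabsM.
apply: le_trans (_ : (cabs k + 1) * (e / (cabs k + 1)) <= _).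
  by apply: ler_pM; rewrite ?cabs_ge0 ?lerDl ?h.
by rewrite mulrC divfK// gt_eqF.
Qed.

(** Integration by components, the form in which [Vop] is given. *)
Definition ci (F : R -> C) a b : C :=
  Complex (ri (fun x => complex.Re (F x)) a b) (ri (fun x => complex.Im (F x)) a b).

Lemma eq_ci (F G : R -> C) a b : (forall x, a <= x <= b -> F x = G x) -> ci F a b = ci G a b.
Proof. by move=> FG; congr Complex; apply: eq_ri => x /FG ->. Qed.

Lemma ciD F G a b : ccI F a b -> ccI G a b ->
  ci (fun x => F x + G x) a b = ci F a b + ci G a b.
Proof.
move=> cF cG; apply: complex_eqP; rewrite ?ReD ?ImD /=.
  by rewrite -riD; [apply: eq_ri => x _; rewrite ReD|exact: ccI_Re|exact: ccI_Re].
by rewrite -riD; [apply: eq_ri => x _; rewrite ImD|exact: ccI_Im|exact: ccI_Im].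
Qed.

Lemma contIZ f k a b : contI f a b -> contI (fun x => k * f x) a b.
Proof. by move=> cf x; apply: cvgM; [exact: cvg_cst|exact: cf]. Qed.

Lemma ciZ F k a b : ccI F a b -> ci (fun x => k * F x) a b = k * ci F a b.
Proof.
move=> cF; have cR := ccI_Re cF; have cM := ccI_Im cF.
apply: complex_eqP; rewrite ?Re_mulE ?Im_mulE /=.
  rewrite -mulNr -!riZ// -riD; [|exact: contIZ|exact: contIZ].
  by apply: eq_ri => x _; rewrite Re_mulE mulNr.
rewrite -!riZ// -riD; [|exact: contIZ|exact: contIZ].
by apply: eq_ri => x _; rewrite Im_mulE.
Qed.

Lemma ci_cst k a b : a <= b -> ci (fun=> k) a b = ((b - a)%:C)%C * k.
Proof.
by move=> ab; apply: complex_eqP; rewrite ?Re_mulE ?Im_mulE/= ri_cst//= mul0r ?addr0 ?subr0.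
Qed.

Lemma ci_split F a c b : a <= c -> c <= b -> ccI F a b -> ci F a b = ci F a c + ci F c b.
Proof.
move=> ac cb cF; apply: complex_eqP; rewrite ?ReD ?ImD/=; apply: ri_split => //.
  exact: ccI_Re.
exact: ccI_Im.
Qed.

(** Real and imaginary parts are bounded separately, whence the factor 2, which recurs in the
    constants below. *)
Lemma cabs_ci_le F a b : ccI F a b -> cabs (ci F a b) <= 2 * ri (fun x => cabs (F x)) a b.
Proof.
move=> cF; apply: le_trans (cabs_le_ReIm _) _; rewrite mulr_natl mulr2n/=.
have cR := ccI_Re cF; have cM := ccI_Im cF.
apply: lerD; (apply: le_trans; first by apply: ler_norm_ri);
  (apply: le_ri; [exact: contI_norm|exact: ccI_cabs|move=> x _]).
  exact: ler_Re_cabs.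
exact: ler_Im_cabs.
Qed.

Lemma cabs_ci_bound F a b M : a <= b -> ccI F a b ->
  (forall x, a <= x <= b -> cabs (F x) <= M) -> cabs (ci F a b) <= 2 * (b - a) * M.
Proof.
move=> ab cF FM; apply: le_trans (cabs_ci_le cF) _; rewrite -mulrA ler_pM2l//.
by rewrite -ri_cst//; apply: le_ri => //; [exact: ccI_cabs|exact: contI_cst].
Qed.

End SegmentIntegrals.

(** * Cauchy estimates in one variable *)

Section Goursat.
Variable R : realType.
Local Notation C := (R[i]).
Implicit Types (u v : C -> C) (z w l k : C).

(** The derivative is an explicit argument, so that a derivative function can be carried along as
    data and estimated. *)
Definition cdiff u z l := forall e : R, 0 < e -> exists2 d : R, 0 < d &
  forall w, cabs (w - z) < d -> cabs (u w - u z - l * (w - z)) <= e * cabs (w - z).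

Definition rect (a b c d : R) : set C :=
  [set z | a <= complex.Re z <= b /\ c <= complex.Im z <= d].

Definition cconton u (S : set C) := forall z, S z -> forall e : R, 0 < e -> exists2 d : R,
  0 < d & forall w, S w -> cabs (w - z) < d -> cabs (u w - u z) <= e.

Lemma cdiff_cont u z l : cdiff u z l -> forall e : R, 0 < e -> exists2 d : R,
  0 < d & forall w, cabs (w - z) < d -> cabs (u w - u z) <= e.
Proof.
move=> du e e0; have [d d0 h] := du _ ltr01.
have k0 : 0 < cabs l + 1 by rewrite ltr_wpDl ?cabs_ge0.
exists (Num.min d (e / (cabs l + 1))).
  by rewrite lt_min d0/= divr_gt0.
move=> w; rewrite lt_min => /andP[w1 w2].
rewrite (_ : _ - _ = (u w - u z - l * (w - z)) + l * (w - z)); last by ring.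
apply: le_trans (cabsD _ _) _; apply: le_trans (lerD (h _ w1) (lexx _)) _.
rewrite cabsM -mulrDl addrC; apply: le_trans (ler_wpM2l (ltW k0) (ltW w2)) _.
by rewrite mulrC divfK ?gt_eqF.
Qed.

Lemma cdiff_cconton u (S : set C) (u' : C -> C) :
  (forall z, S z -> cdiff u z (u' z)) -> cconton u S.
Proof.
move=> du z Sz e e0; have [d d0 h] := cdiff_cont (du z Sz) e0.
by exists d => // w _; exact: h.
Qed.

Lemma cconton_sub u S T : T `<=` S -> cconton u S -> cconton u T.
Proof.
move=> TS cu z Tz e e0; have [d d0 h] := cu z (TS _ Tz) e e0.
by exists d => // w Tw; apply: h; exact: TS.
Qed.

Lemma rect_sub a b c d a' b' c' d' : a <= a' -> b' <= b -> c <= c' -> d' <= d ->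
  rect a' b' c' d' `<=` rect a b c d.
Proof.
move=> aa bb cc dd z [/andP[h1 h2] /andP[h3 h4]]; split; apply/andP; split.
- exact: le_trans aa h1.
- exact: le_trans h2 bb.
- exact: le_trans cc h3.
- exact: le_trans h4 dd.
Qed.

Lemma ccI_hor u a b c d y : cconton u (rect a b c d) -> c <= y <= d ->
  ccI (fun x => u (Complex x y)) a b.
Proof.
move=> cu ycd x xab e e0; have [r r0 h] := cu (Complex x y) (conj xab ycd) e e0.
exists r => // x' x'ab xx; apply: h; first by split.
by rewrite (_ : _ - _ = ((x' - x)%:C)%C) ?cabsE_real//; apply: complex_eqP => //=; rewrite subrr.
Qed.

Lemma ccI_ver u a b c d x : cconton u (rect a b c d) -> a <= x <= b ->
  ccI (fun y => u (Complex x y)) c d.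
Proof.
move=> cu xab y ycd e e0; have [r r0 h] := cu (Complex x y) (conj xab ycd) e e0.
exists r => // y' y'cd yy; apply: h; first by split.
by rewrite (_ : _ - _ = Complex 0 (y' - y)) ?cabs_imag//; apply: complex_eqP => //=; rewrite subrr.
Qed.

(** The integral of u dz counterclockwise around the rectangle; the factor i is dz on the vertical
    sides. *)
Definition bnd u (a b c d : R) : C :=
  ci (fun x => u (Complex x c)) a b - ci (fun x => u (Complex x d)) a b +
  Complex 0 1 * (ci (fun y => u (Complex b y)) c d - ci (fun y => u (Complex a y)) c d).

Arguments bnd : simpl never.

Lemma bnd_splitx u a m b c d : a <= m -> m <= b -> c <= d -> cconton u (rect a b c d) ->
  bnd u a b c d = bnd u a m c d + bnd u m b c d.
Proof.
move=> am mb cd cu; rewrite /bnd.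
have h1 : ccI (fun x => u (Complex x c)) a b by apply: ccI_hor cu _; rewrite lexx.
have h2 : ccI (fun x => u (Complex x d)) a b by apply: ccI_hor cu _; rewrite lexx cd.
by rewrite (ci_split am mb h1) (ci_split am mb h2); ring.
Qed.

Lemma bnd_splity u a b c m d : a <= b -> c <= m -> m <= d -> cconton u (rect a b c d) ->
  bnd u a b c d = bnd u a b c m + bnd u a b m d.
Proof.
move=> ab cm md cu; rewrite /bnd.
have h1 : ccI (fun y => u (Complex a y)) c d by apply: ccI_ver cu _; rewrite lexx.
have h2 : ccI (fun y => u (Complex b y)) c d by apply: ccI_ver cu _; rewrite lexx ab.
by rewrite (ci_split cm md h1) (ci_split cm md h2); ring.
Qed.

Definition contsides u (a b c d : R) :=
  [/\ ccI (fun x => u (Complex x c)) a b, ccI (fun x => u (Complex x d)) a b,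
      ccI (fun y => u (Complex b y)) c d & ccI (fun y => u (Complex a y)) c d].

Lemma contsides_rect u a b c d : a <= b -> c <= d -> cconton u (rect a b c d) ->
  contsides u a b c d.
Proof.
move=> ab cd cu; split.
- by apply: ccI_hor cu _; rewrite lexx.
- by apply: ccI_hor cu _; rewrite lexx cd.
- by apply: ccI_ver cu _; rewrite lexx ab.
- by apply: ccI_ver cu _; rewrite lexx.
Qed.

Lemma contsidesD u v a b c d : contsides u a b c d -> contsides v a b c d ->
  contsides (fun z => u z + v z) a b c d.
Proof. by case=> ? ? ? ? [? ? ? ?]; split; exact: ccID. Qed.

Lemma contsidesZ k u a b c d : contsides u a b c d -> contsides (fun z => k * u z) a b c d.
Proof. by case=> ? ? ? ?; split; exact: ccIZ. Qed.

Lemma bndD u v a b c d : contsides u a b c d -> contsides v a b c d ->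
  bnd (fun z => u z + v z) a b c d = bnd u a b c d + bnd v a b c d.
Proof. by case=> ? ? ? ? [? ? ? ?]; rewrite /bnd !ciD//; ring. Qed.

Lemma bndZ k u a b c d : contsides u a b c d ->
  bnd (fun z => k * u z) a b c d = k * bnd u a b c d.
Proof. by case=> ? ? ? ?; rewrite /bnd !ciZ//; ring. Qed.

Lemma bnd_bound u a b c d M : a <= b -> c <= d -> contsides u a b c d ->
  (forall x, a <= x <= b -> cabs (u (Complex x c)) <= M /\ cabs (u (Complex x d)) <= M) ->
  (forall y, c <= y <= d -> cabs (u (Complex a y)) <= M /\ cabs (u (Complex b y)) <= M) ->
  cabs (bnd u a b c d) <= 4 * ((b - a) + (d - c)) * M.
Proof.
move=> ab cd [h1 h2 h3 h4] uM vM.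
have m1 : cabs (ci (fun x => u (Complex x c)) a b) <= 2 * (b - a) * M.
  by apply: cabs_ci_bound => // x /uM[].
have m2 : cabs (ci (fun x => u (Complex x d)) a b) <= 2 * (b - a) * M.
  by apply: cabs_ci_bound => // x /uM[].
have m3 : cabs (ci (fun y => u (Complex b y)) c d) <= 2 * (d - c) * M.
  by apply: cabs_ci_bound => // x /vM[].
have m4 : cabs (ci (fun y => u (Complex a y)) c d) <= 2 * (d - c) * M.
  by apply: cabs_ci_bound => // x /vM[].
apply: le_trans (cabsD _ _) _; rewrite cabsM cabs_imag normr1 mul1r.
rewrite (_ : 4 * _ * M = (2 * (b - a) * M + 2 * (b - a) * M) +
   (2 * (d - c) * M + 2 * (d - c) * M)); last by ring.
by apply: lerD; (apply: le_trans (cabsD _ _) _); rewrite cabsN; apply: lerD.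
Qed.

Section Sides.
Variables (a b c d : R).
Hypotheses (ab : a <= b) (cd : c <= d).

Lemma bnd_cst k : bnd (fun=> k) a b c d = 0.
Proof. by rewrite /bnd !ci_cst//; ring. Qed.

Lemma cconton_cst k S : cconton (fun=> k) S.
Proof. by move=> z _ e e0; exists 1 => // w _ _; rewrite subrr cabs0 ltW. Qed.

Lemma cconton_id S : cconton id S.
Proof. by move=> z _ e e0; exists e => // w _ /ltW. Qed.

Lemma bnd_id : bnd id a b c d = 0.
Proof.
have E x y : Complex x y = ((x%:C)%C + Complex 0 y : C).
  by apply: complex_eqP => //=; rewrite ?add0r ?addr0.
have E' x y : Complex x y = (Complex 0 y + (x%:C)%C : C) by rewrite E addrC.
have c1 p q : ccI (fun x : R => (x%:C)%C) p q.
  by move=> x _ e e0; exists e => // y _ /ltW; rewrite -rmorphB cabsE_real.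
have c2 p q : ccI (fun y : R => Complex 0 y) p q.
  move=> x _ e e0; exists e => // y _ /ltW.
  by rewrite (_ : _ - _ = Complex 0 (y - x)) ?cabs_imag//; apply: complex_eqP => //=; rewrite subrr.
rewrite /bnd /=.
under [ci _ a b]eq_ci do rewrite E; rewrite ciD//; last exact: ccI_cst.
rewrite [X in _ - X](_ : _ = ci (fun x : R => (x%:C)%C) a b + ci (fun=> Complex 0 d) a b); last first.
  by rewrite -ciD//; [apply: eq_ci => x _; exact: E|exact: ccI_cst].
rewrite [X in _ * (X - _)](_ : _ = ci (fun y : R => Complex 0 y) c d + ci (fun=> (b%:C)%C) c d); last first.
  by rewrite -ciD//; [apply: eq_ci => x _; exact: E'|exact: ccI_cst].
rewrite [X in _ * (_ - X)](_ : _ = ci (fun y : R => Complex 0 y) c d + ci (fun=> (a%:C)%C) c d); last first.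
  by rewrite -ciD//; [apply: eq_ci => x _; exact: E'|exact: ccI_cst].
rewrite !ci_cst//.
apply: complex_eqP; rewrite /ci !(ReD, ImD, Re_mulE, Im_mulE, ReN, ImN)/=; ring.
Qed.

End Sides.

Lemma ccontonD u v S : cconton u S -> cconton v S -> cconton (fun z => u z + v z) S.
Proof.
move=> cu cv z Sz e e0; have e2 : 0 < e / 2 by rewrite divr_gt0.
have [d d0 h] := cu z Sz _ e2; have [r r0 k] := cv z Sz _ e2.
exists (Num.min d r); first by rewrite lt_min d0.
move=> y Sy; rewrite lt_min => /andP[y1 y2].
rewrite (_ : _ - _ = (u y - u z) + (v y - v z)); last by ring.
by rewrite (splitr e); apply: le_trans (cabsD _ _) (lerD (h _ Sy y1) (k _ Sy y2)).
Qed.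

Lemma ccontonZ k u S : cconton u S -> cconton (fun z => k * u z) S.
Proof.
move=> cu z Sz e e0.
have k0 : 0 < cabs k + 1 by rewrite ltr_wpDl ?cabs_ge0.
have [|d d0 h] := cu z Sz (e / (cabs k + 1)); first by rewrite divr_gt0.
exists d => // y yab yx; rewrite -mulrBr cabsM.
apply: le_trans (_ : (cabs k + 1) * (e / (cabs k + 1)) <= _).
  by apply: ler_pM; rewrite ?cabs_ge0 ?lerDl ?h.
by rewrite mulrC divfK// gt_eqF.
Qed.

(** Affine functions integrate to 0 around the rectangle, so u may be replaced by its first-order
    remainder at z. *)
Lemma bnd_affine_bound u z l a b c d e : a <= b -> c <= d -> cconton u (rect a b c d) ->
  (forall w, rect a b c d w -> cabs (u w - u z - l * (w - z)) <= e) ->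
  cabs (bnd u a b c d) <= 4 * ((b - a) + (d - c)) * e.
Proof.
move=> ab cd cu ue.
pose v := fun w => u w + (l * z - u z + - l * w).
have cv1 : cconton (fun w => l * z - u z + - l * w) (rect a b c d).
  by apply: ccontonD; [exact: cconton_cst|apply: ccontonZ; exact: cconton_id].
have cv : cconton v (rect a b c d) by exact: ccontonD.
have su := contsides_rect ab cd cu; have sc k := contsides_rect ab cd (@cconton_cst k _).
have si := contsidesZ (- l) (contsides_rect ab cd (@cconton_id _)).
have -> : bnd u a b c d = bnd v a b c d.
  rewrite [RHS]bndD ?bndD ?bnd_cst ?bndZ ?bnd_id ?mulr0 ?addr0//.
    exact: contsides_rect ab cd (@cconton_id _).
  exact: contsidesD.
have vM w : rect a b c d w -> cabs (v w) <= e.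
  move=> Rw; apply: le_trans (ue w Rw).
  by rewrite le_eqVlt; apply/orP; left; apply/eqP; congr cabs; rewrite /v; ring.
apply: bnd_bound => //; first exact: contsides_rect.
  by move=> x xab; split; apply: vM; split; rewrite //= ?lexx ?cd.
by move=> y ycd; split; apply: vM; split; rewrite //= ?lexx ?ab.
Qed.

(** Left ends increase, right ends decrease, and every left end lies below every right end; X is the
    supremum of the left ends. *)
Lemma nested_halving (x : nat -> R) (w : R) : 0 <= w ->
  (forall n, x n <= x n.+1 /\ x n.+1 + w / 2 ^+ n.+1 <= x n + w / 2 ^+ n) ->
  exists X, forall n, x n <= X <= x n + w / 2 ^+ n.
Proof.
move=> w0 H.
have inc m (k : nat) : x m <= x (m + k)%N.
  elim: k => [|k IH]; first by rewrite addn0.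
  by rewrite addnS; apply: le_trans IH (H _).1.
have dec m (k : nat) : x (m + k)%N + w / 2 ^+ (m + k) <= x m + w / 2 ^+ m.
  elim: k => [|k IH]; first by rewrite addn0.
  by rewrite addnS; apply: le_trans (H _).2 IH.
have wn n : 0 <= w / 2 ^+ n by rewrite divr_ge0// exprn_ge0.
have ub n m : x m <= x n + w / 2 ^+ n.
  case: (leqP n m) => nm.
    rewrite -(subnKC nm); apply: le_trans (dec n (m - n)%N).
    by rewrite lerDl.
  apply: le_trans (_ : x n <= _); last by rewrite lerDl.
  by rewrite -(subnKC (ltnW nm)).
have hs : has_sup (range x).
  by split; [exists (x 0%N), 0%N|exists (x 0%N + w / 2 ^+ 0) => _ [m _ <-]; exact: ub].
exists (sup (range x)) => n; apply/andP; split.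
  by apply: ub_le_sup; [case: hs|exists n].
by apply: ge_sup; [case: hs|move=> _ [m _ <-]; exact: ub].
Qed.

Lemma half_pow_lt (w e : R) : 0 < e -> exists n, w / 2 ^+ n < e.
Proof.
move=> e0; exists (Num.bound (w / e)).
by rewrite ltr_pdivrMr// mulrC -ltr_pdivrMr// upper_nthrootP.
Qed.

Section Bisection.
Variables (u : C -> C) (a b c d eta : R).
Hypotheses (ab : a <= b) (cd : c <= d) (cu : cconton u (rect a b c d)).
Let W := b - a.
Let H := d - c.

(** The invariant of the bisection: q is the lower left corner of a rectangle of generation n that
    retains at least the share 4^-n of the boundary integral. *)
Let P n (q : R * R) := [/\ a <= q.1, q.1 + W / 2 ^+ n <= b, c <= q.2, q.2 + H / 2 ^+ n <= d &
  eta / 4 ^+ n <= cabs (bnd u q.1 (q.1 + W / 2 ^+ n) q.2 (q.2 + H / 2 ^+ n))].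

Let W0 n : 0 <= W / 2 ^+ n.
Proof. by rewrite divr_ge0 ?exprn_ge0 ?subr_ge0. Qed.
Let H0 n : 0 <= H / 2 ^+ n.
Proof. by rewrite divr_ge0 ?exprn_ge0 ?subr_ge0. Qed.

Let halfS (w : R) n : w / 2 ^+ n = w / 2 ^+ n.+1 + w / 2 ^+ n.+1.
Proof. by rewrite exprS; field; rewrite expf_neq0. Qed.

Let step n q : P n q -> exists q', P n.+1 q' /\
  [/\ q.1 <= q'.1, q'.1 + W / 2 ^+ n.+1 <= q.1 + W / 2 ^+ n,
      q.2 <= q'.2 & q'.2 + H / 2 ^+ n.+1 <= q.2 + H / 2 ^+ n].
Proof.
case: q => x y [/= ax xb cy yd le]; have Wn := W0 n.+1; have Hn := H0 n.+1.
move: xb yd le; rewrite (halfS W) (halfS H).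
move: Wn Hn; set w := W / _; set h := H / _ => Wn Hn xb yd le.
have cu' : cconton u (rect x (x + (w + w)) y (y + (h + h))).
  exact/(cconton_sub _ cu)/rect_sub.
have cu1 : cconton u (rect x (x + w) y (y + (h + h))).
  by apply: cconton_sub cu'; apply: rect_sub; rewrite ?lexx //; lra.
have cu2 : cconton u (rect (x + w) (x + (w + w)) y (y + (h + h))).
  by apply: cconton_sub cu'; apply: rect_sub; rewrite ?lexx //; lra.
move: le. rewrite (bnd_splitx (m := x + w)) //; [|lra..].
rewrite (bnd_splity (m := y + h) _ _ _ cu1); [|lra..].
rewrite (bnd_splity (m := y + h) _ _ _ cu2); [|lra..].
pose B1 := bnd u x (x + w) y (y + h); pose B2 := bnd u x (x + w) (y + h) (y + (h + h)).
pose B3 := bnd u (x + w) (x + (w + w)) y (y + h).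
pose B4 := bnd u (x + w) (x + (w + w)) (y + h) (y + (h + h)).
rewrite -/B1 -/B2 -/B3 -/B4 => le.
set t := eta / 4 ^+ n.+1.
have tE : eta / 4 ^+ n = t + t + t + t.
  by rewrite /t exprS invfM; field; rewrite expf_neq0.
have : [\/ t <= cabs B1, t <= cabs B2, t <= cabs B3 | t <= cabs B4].
  case: (lerP t (cabs B1)) => h1; first by constructor 1.
  case: (lerP t (cabs B2)) => h2; first by constructor 2.
  case: (lerP t (cabs B3)) => h3; first by constructor 3.
  case: (lerP t (cabs B4)) => h4; first by constructor 4.
  have := cabsD (B1 + B2) (B3 + B4); have := cabsD B3 B4; have := cabsD B1 B2.
  by move: le; rewrite tE; lra.
have addA (p q : R) : p + q + q = p + (q + q) by rewrite addrA.
rewrite /B1 /B2 /B3 /B4 -!addA {B1 B2 B3 B4 le}.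
case=> tB.
- exists (x, y); rewrite /P/= -/w -/h -/t; split; first by split => //; lra.
  by split => //; lra.
- exists (x, y + h); rewrite /P/= -/w -/h -/t; split; first by split => //; lra.
  by split => //; lra.
- exists (x + w, y); rewrite /P/= -/w -/h -/t; split; first by split => //; lra.
  by split => //; lra.
- exists (x + w, y + h); rewrite /P/= -/w -/h -/t; split; first by split => //; lra.
  by split => //; lra.
Qed.

Lemma rect_bisection : eta <= cabs (bnd u a b c d) ->
  exists z, forall n, exists x y, [/\ a <= x /\ x + W / 2 ^+ n <= b, c <= y /\ y + H / 2 ^+ n <= d,
    rect x (x + W / 2 ^+ n) y (y + H / 2 ^+ n) z &
    eta / 4 ^+ n <= cabs (bnd u x (x + W / 2 ^+ n) y (y + H / 2 ^+ n))].
Proof.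
move=> le.
have /choice[f fP] : forall nq : nat * (R * R), exists q' : R * R, P nq.1 nq.2 ->
   P nq.1.+1 q' /\
  [/\ nq.2.1 <= q'.1, q'.1 + W / 2 ^+ nq.1.+1 <= nq.2.1 + W / 2 ^+ nq.1,
      nq.2.2 <= q'.2 & q'.2 + H / 2 ^+ nq.1.+1 <= nq.2.2 + H / 2 ^+ nq.1].
  case=> n q /=; case: (pselect (P n q)) => [/step[q' h]|h]; first by exists q'.
  by exists (0, 0).
pose s := fix s n := if n is m.+1 then f (m, s m) else (a, c).
have Ps n : P n (s n).
  elim: n => [|n IH]; last by have [] := fP (n, s n) IH.
  by rewrite /P/= !expr0 !divr1 /W /H !subrKC.
have [X hX] : exists X, forall n, (s n).1 <= X <= (s n).1 + W / 2 ^+ n.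
  apply: nested_halving; first by rewrite subr_ge0.
  by move=> n; have [_ []] := fP (n, s n) (Ps n).
have [Y hY] : exists Y, forall n, (s n).2 <= Y <= (s n).2 + H / 2 ^+ n.
  apply: nested_halving; first by rewrite subr_ge0.
  by move=> n; have [_ []] := fP (n, s n) (Ps n).
exists (Complex X Y) => n; exists (s n).1, (s n).2.
by have [h1 h2 h3 h4 h5] := Ps n; split.
Qed.

End Bisection.

(** If the integral had modulus eta > 0, bisection would leave eta/4^n on rectangles shrinking to a
    point z. Differentiability at z bounds the same integrals by 4 e (L/2^n)^2 with L the
    half-perimeter, and e is chosen so that 4 e L^2 < eta. *)
Lemma goursat u (u' : C -> C) a b c d : a <= b -> c <= d ->
  (forall z, rect a b c d z -> cdiff u z (u' z)) -> bnd u a b c d = 0.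
Proof.
move=> ab cd du; have cu := cdiff_cconton du.
apply/eqP; rewrite -cabs_eq0 eq_le cabs_ge0 andbT leNgt; apply/negP => eta0.
have [z hz] := rect_bisection ab cd cu (lexx _).
have Rz : rect a b c d z.
  have [x [y [[ax xb] [cy yd] Rz _]]] := hz 0%N.
  by move: Rz; apply: rect_sub.
move: eta0 hz; set eta := cabs _ => eta0 hz.
set L := (b - a) + (d - c) in hz *.
have L0 : 0 <= L by rewrite addr_ge0 ?subr_ge0.
have L1 : 0 < 4 * (L + 1) ^+ 2 by rewrite mulr_gt0// exprn_gt0// ltr_wpDl.
(* [L + 1] instead of [L] keeps the denominator positive for a degenerate rectangle. *)
set e := eta / 2 / (4 * (L + 1) ^+ 2).
have e0 : 0 < e by rewrite !divr_gt0.
have [r r0 hr] := du z Rz e e0.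
have [n Ln] := half_pow_lt L r0.
have [x [y [[ax xb] [cy yd] Rxy]]] := hz n.
have n2 : 0 < 2 ^- n :> R by rewrite invr_gt0 exprn_gt0.
have wn : 0 <= (b - a) / 2 ^+ n by apply: mulr_ge0; [rewrite subr_ge0|exact: ltW].
have hn : 0 <= (d - c) / 2 ^+ n by apply: mulr_ge0; [rewrite subr_ge0|exact: ltW].
have LE : L / 2 ^+ n = (b - a) / 2 ^+ n + (d - c) / 2 ^+ n by rewrite -mulrDl.
apply/negP; rewrite -ltNge.
set w := (b - a) / _ in wn LE xb Rxy *; set h := (d - c) / _ in hn LE yd Rxy *.
have B : cabs (bnd u x (x + w) y (y + h)) <= 4 * (L / 2 ^+ n) * (e * (L / 2 ^+ n)).
  rewrite LE.
  rewrite (_ : w + h = (x + w - x) + (y + h - y)); last by ring.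
  apply: (@bnd_affine_bound u z (u' z)); [lra|lra| |].
    exact/(cconton_sub _ cu)/rect_sub.
  move=> v [/andP[v1 v2] /andP[v3 v4]]; case: Rxy => /andP[z1 z2] /andP[z3 z4].
  have vz : cabs (v - z) <= L / 2 ^+ n.
    rewrite LE; apply: le_trans (cabs_le_ReIm _) _.
    by rewrite !ReD !ImD !ReN !ImN lerD// ler_norml; apply/andP; split; lra.
  apply: le_trans (hr _ (le_lt_trans vz Ln)) _.
  rewrite (_ : x + w - x + (y + h - y) = L / 2 ^+ n) ?ler_pM2l//.
  by rewrite LE; ring.
apply: le_lt_trans B _.
have -> : eta / 4 ^+ n = eta * (2 ^- n) ^+ 2.
  by congr (_ * _); rewrite exprVn -exprM mulnC exprM; congr (_ ^- _); ring.
have -> : 4 * (L / 2 ^+ n) * (e * (L / 2 ^+ n)) = (4 * L ^+ 2 * e) * (2 ^- n) ^+ 2 by ring.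
rewrite ltr_pM2r ?exprn_gt0//.
apply: le_lt_trans (_ : _ <= 4 * (L + 1) ^+ 2 * e) _.
  apply: ler_wpM2r; first exact: ltW.
  by rewrite ler_pM2l// ler_pXn2r ?nnegrE//; lra.
rewrite /e mulrC divfK ?gt_eqF//; lra.
Qed.

End Goursat.

Section CdiffRules.
Variable R : realType.
Local Notation C := (R[i]).
Implicit Types (u v : C -> C) (z w l k : C).

Lemma cdiff_cst k z : cdiff (fun=> k) z 0.
Proof.
move=> e e0; exists 1 => // w _; rewrite mul0r !subrr cabs0.
by rewrite mulr_ge0 ?cabs_ge0 ?ltW.
Qed.

Lemma cdiff_id z : cdiff id z 1.
Proof.
move=> e e0; exists 1 => // w _; rewrite mul1r subrr cabs0.
by apply: mulr_ge0; rewrite ?cabs_ge0 ?ltW.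
Qed.

Lemma cdiffD u v z l k : cdiff u z l -> cdiff v z k -> cdiff (fun w => u w + v w) z (l + k).
Proof.
move=> du dv e e0; have e2 : 0 < e / 2 by rewrite divr_gt0.
have [d d0 h] := du _ e2; have [r r0 g] := dv _ e2.
exists (Num.min d r); first by rewrite lt_min d0.
move=> w; rewrite lt_min => /andP[w1 w2].
rewrite (_ : _ - _ - _ = (u w - u z - l * (w - z)) + (v w - v z - k * (w - z))); last by ring.
rewrite [e in X in _ <= X]splitr mulrDl.
exact: le_trans (cabsD _ _) (lerD (h _ w1) (g _ w2)).
Qed.

Lemma cdiffZ u z l k : cdiff u z l -> cdiff (fun w => k * u w) z (k * l).
Proof.
move=> du e e0; have k0 : 0 < cabs k + 1 by rewrite ltr_wpDl ?cabs_ge0.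
have [|d d0 h] := du (e / (cabs k + 1)); first by rewrite divr_gt0.
exists d => // w wd.
rewrite (_ : _ - _ - _ = k * (u w - u z - l * (w - z))); last by ring.
rewrite cabsM; apply: le_trans (_ : (cabs k + 1) * (e / (cabs k + 1) * cabs (w - z)) <= _).
  by apply: ler_pM; rewrite ?cabs_ge0 ?lerDl ?h.
by rewrite mulrA [X in X * _]mulrC divfK// gt_eqF.
Qed.

Lemma cdiff_lip u z l : cdiff u z l -> exists2 d : R, 0 < d &
  forall w, cabs (w - z) < d -> cabs (u w - u z) <= (cabs l + 1) * cabs (w - z).
Proof.
move=> /(_ _ ltr01)[d d0 h]; exists d => // w wd.
rewrite (_ : _ - _ = (u w - u z - l * (w - z)) + l * (w - z)); last by ring.
by apply: le_trans (cabsD _ _) _; rewrite mulrDl cabsM addrC lerD2l; exact: h.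
Qed.

Lemma cdiffM u v z l k : cdiff u z l -> cdiff v z k ->
  cdiff (fun w => u w * v w) z (l * v z + u z * k).
Proof.
move=> du dv e e0.
pose A := cabs (v z) + cabs (u z) + (cabs l + 1) * (cabs k + 1) + 1.
have P0 : 0 <= (cabs l + 1) * (cabs k + 1) by rewrite mulr_ge0 ?addr_ge0 ?cabs_ge0.
have A0 : 0 < A by rewrite ltr_wpDl// !addr_ge0 ?cabs_ge0.
have eA : 0 < e / A by rewrite divr_gt0.
have [d1 d10 h1] := du _ eA; have [d2 d20 h2] := dv _ eA.
have [d3 d30 h3] := cdiff_lip du; have [d4 d40 h4] := cdiff_lip dv.
exists (Num.min (Num.min d1 d2) (Num.min (Num.min d3 d4) (e / A))).
  by rewrite !lt_min d10 d20 d30 d40.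
move=> w; rewrite !lt_min => /andP[/andP[w1 w2] /andP[/andP[w3 w4] w5]].
move: (h1 _ w1) (h2 _ w2) (h3 _ w3) (h4 _ w4) => {h1 h2 h3 h4}.
set dw := w - z in w5 *; set t := cabs dw in w5 * => g1 g2 g3 g4.
rewrite (_ : _ - _ - _ = (u w - u z - l * dw) * v z + u z * (v w - v z - k * dw) +
  (u w - u z) * (v w - v z)); last by rewrite /dw; ring.
apply: le_trans (cabsD _ _) _; rewrite cabsM.
apply: le_trans (lerD (cabsD _ _) (lexx _)) _; rewrite !cabsM.
have t0 : 0 <= t by exact: cabs_ge0.
apply: le_trans (_ : e / A * t * cabs (v z) + cabs (u z) * (e / A * t) +
   ((cabs l + 1) * t) * ((cabs k + 1) * (e / A)) <= _).
  apply: lerD; first apply: lerD.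
  - by rewrite ler_wpM2r ?cabs_ge0.
  - by rewrite ler_wpM2l ?cabs_ge0.
  - apply: ler_pM; rewrite ?cabs_ge0//; apply: le_trans g4 _.
    by apply: ler_wpM2l; [rewrite addr_ge0 ?cabs_ge0|exact: ltW].
rewrite (_ : _ + _ = (cabs (v z) + cabs (u z) + (cabs l + 1) * (cabs k + 1)) * (e / A * t)); last by ring.
apply: le_trans (_ : A * (e / A * t) <= _).
  by apply: ler_wpM2r; [rewrite mulr_ge0// ltW|rewrite lerDl].
by rewrite mulrA [A * _]mulrC divfK// gt_eqF.
Qed.

Lemma cdiffV z : z != 0 -> cdiff (fun w => w^-1) z (- z^-1 ^+ 2).
Proof.
move=> z0 e e0; have a0 : 0 < cabs z by rewrite cabs_gt0.
exists (Num.min (cabs z / 2) (e * cabs z ^+ 3 / 2)).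
  by rewrite lt_min !divr_gt0// mulr_gt0// exprn_gt0.
move=> w; rewrite lt_min => /andP[w1 w2].
have wz : cabs z / 2 <= cabs w.
  have := cabs_ge_sub z (w - z); rewrite subrKC; lra.
have w0 : w != 0 by rewrite -cabs_gt0; lra.
rewrite (_ : _ - _ - _ = (w - z) * (w - z) / (w * z ^+ 2)); last by field; rewrite z0.
rewrite cabsM cabsV (cabsM w) cabsX (cabsM (w - z)) -mulrA mulrC; apply: ler_wpM2r; first exact: cabs_ge0.
rewrite ler_pdivrMr; last by apply: mulr_gt0; [lra|rewrite exprn_gt0].
apply/ltW/(lt_le_trans w2).
rewrite (_ : e * cabs z ^+ 3 / 2 = e * cabs z ^+ 2 * (cabs z / 2)); last by ring.
rewrite (_ : e * (cabs w * cabs z ^+ 2) = e * cabs z ^+ 2 * cabs w); last by ring.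
by rewrite ler_pM2l// mulr_gt0// exprn_gt0.
Qed.

Lemma cdiff_shift u a z l : cdiff u (a + z) l -> cdiff (fun w => u (a + w)) z l.
Proof.
move=> du e e0; have [d d0 h] := du e e0; exists d => // w wd.
by have := h (a + w); rewrite [a + w - _](_ : _ = w - z); [exact|ring].
Qed.

End CdiffRules.

(** * Cauchy's formula and Cauchy's estimates on squares *)

Section SquareCauchy.
Variable R : realType.
Local Notation C := (R[i]).
Implicit Types (u v h : C -> C) (z w l k : C).

(** Squares serve as contours in place of circles, so that only integrals over horizontal and
    vertical segments occur. *)
Definition sqr_int u (s : R) : C := bnd u (- s) s (- s) s.
Definition sq (s : R) : set C := rect (- s) s (- s) s.

Lemma sqP s z : sq s z <-> `|complex.Re z| <= s /\ `|complex.Im z| <= s.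
Proof. by rewrite !ler_norml. Qed.

Lemma sq_side (s x y : R) : `|x| = s -> `|y| <= s -> s <= cabs (Complex x y) /\ s <= cabs (Complex y x).
Proof.
move=> <- _; split; first by apply: le_trans (ler_Re_cabs _); rewrite /=.
by apply: le_trans (ler_Im_cabs _); rewrite /=.
Qed.

(** The frame between the two squares is cut into a left and a right strip of full height and two
    blocks above and below the inner square. None of them contains 0, so Goursat's lemma applies to
    each. *)
Lemma sqr_int_indep u (u' : C -> C) (r s : R) : 0 < r -> r <= s ->
  (forall z, sq s z -> z != 0 -> cdiff u z (u' z)) -> sqr_int u s = sqr_int u r.
Proof.
move=> r0 rs du.
have s0 : 0 < s by exact: lt_le_trans rs.
have D (a b c d : R) : - s <= a -> b <= s -> - s <= c -> d <= s ->
    (0 < a \/ b < 0) \/ (0 < c \/ d < 0) -> forall z, rect a b c d z -> cdiff u z (u' z).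
  move=> h1 h2 h3 h4 h5 [x y] [/= /andP[ax xb] /andP[cy yd]]; apply: du.
    by split => /=; apply/andP; split; lra.
  by apply/eqP => -[x0 y0]; case: h5 => -[]; lra.
have G (a b c d : R) : a <= b -> c <= d -> - s <= a -> b <= s -> - s <= c -> d <= s ->
    (0 < a \/ b < 0) \/ (0 < c \/ d < 0) -> bnd u a b c d = 0.
  by move=> ab cd h1 h2 h3 h4 h5; apply: goursat => //; exact: D.
have S (a b c d : R) : a <= b -> c <= d -> - s <= a -> b <= s -> - s <= c -> d <= s ->
    (0 < a \/ b < 0) \/ (0 < c \/ d < 0) -> cconton u (rect a b c d).
  by move=> ab cd h1 h2 h3 h4 h5; apply: cdiff_cconton; exact: D.
have L : bnd u (- s) (- r) (- s) s = 0 by apply: G; lra.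
have RR : bnd u r s (- s) s = 0 by apply: G; lra.
have T : bnd u (- r) r r s = 0 by apply: G; lra.
have B : bnd u (- r) r (- s) (- r) = 0 by apply: G; lra.
have E (y : R) : `|y| = s -> ci (fun x => u (Complex x y)) (- s) s =
    ci (fun x => u (Complex x y)) (- s) (- r) + ci (fun x => u (Complex x y)) (- r) r +
    ci (fun x => u (Complex x y)) r s.
  move=> ys; have c : ccI (fun x => u (Complex x y)) (- s) s.
    have yc : cconton u (rect (- s) s y y).
      by case: (lerP 0 y) ys => y0; rewrite ?(ger0_norm y0) ?(ltr0_norm y0) => ys;
        apply: S; lra.
    by apply: ccI_hor yc _; rewrite lexx.
  rewrite (@ci_split _ _ _ r) //; [|lra..]; congr (_ + _); apply: ci_split; [lra..|].
  by apply: ccI_sub c; lra.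
have V (x : R) : `|x| = r -> ci (fun y => u (Complex x y)) (- s) s =
    ci (fun y => u (Complex x y)) (- s) (- r) + ci (fun y => u (Complex x y)) (- r) r +
    ci (fun y => u (Complex x y)) r s.
  move=> xr; have c : ccI (fun y => u (Complex x y)) (- s) s.
    have yc : cconton u (rect x x (- s) s).
      by case: (lerP 0 x) xr => x0; rewrite ?(ger0_norm x0) ?(ltr0_norm x0) => xr;
        apply: S; lra.
    by apply: ccI_ver yc _; rewrite lexx.
  rewrite (@ci_split _ _ _ r) //; [|lra..]; congr (_ + _); apply: ci_split; [lra..|].
  by apply: ccI_sub c; lra.
apply/eqP; rewrite -subr_eq0; apply/eqP.
transitivity (bnd u (- s) (- r) (- s) s + bnd u r s (- s) s + bnd u (- r) r r s +
   bnd u (- r) r (- s) (- r)); last by rewrite L RR T B !addr0.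
have s1 : `|- s| = s by rewrite normrN gtr0_norm.
have s2 : `|s| = s by rewrite gtr0_norm.
have r1 : `|- r| = r by rewrite normrN gtr0_norm.
have r2 : `|r| = r by rewrite gtr0_norm.
rewrite /sqr_int /bnd (E _ s1) (E _ s2) (V _ r1) (V _ r2).
by ring.
Qed.

Lemma contsides_sq u (u' : C -> C) s : 0 < s ->
  (forall z, sq s z -> z != 0 -> cdiff u z (u' z)) -> contsides u (- s) s (- s) s.
Proof.
move=> s0 du.
have H (x y : R) : `|x| = s -> `|y| <= s -> cdiff u (Complex x y) (u' (Complex x y)) /\
    cdiff u (Complex y x) (u' (Complex y x)).
  by move=> xs ys; split; apply: du; rewrite ?sqP/= ?xs ?ys//;
    apply/eqP => -[x0 y0]; move: xs; rewrite ?x0 ?y0 normr0; lra.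
have N (t : R) : - s <= t <= s -> `|t| <= s by rewrite ler_norml.
have Hh (y : R) : `|y| = s -> ccI (fun x => u (Complex x y)) (- s) s.
  move=> ys; have c : cconton u (rect (- s) s y y).
    apply: (@cdiff_cconton _ _ _ u') => -[x y'] [/= xs]; rewrite -eq_le => /eqP <-.
    exact: (H y x ys (N _ xs)).2.
  by apply: ccI_hor c _; rewrite lexx.
have Hv (x : R) : `|x| = s -> ccI (fun y => u (Complex x y)) (- s) s.
  move=> xs; have c : cconton u (rect x x (- s) s).
    apply: (@cdiff_cconton _ _ _ u') => -[x' y] [/=]; rewrite -eq_le => /eqP <- ys.
    exact: (H x y xs (N _ ys)).1.
  by apply: ccI_ver c _; rewrite lexx.
by split; [apply: Hh|apply: Hh|apply: Hv|apply: Hv]; rewrite ?normrN gtr0_norm.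
Qed.

Lemma sqr_int_bound u s M : 0 < s -> contsides u (- s) s (- s) s ->
  (forall z, sq s z -> s <= cabs z -> cabs (u z) <= M) -> cabs (sqr_int u s) <= 16 * s * M.
Proof.
move=> s0 cu uM; have ss : - s <= s by lra.
rewrite (_ : 16 * s * M = 4 * ((s - - s) + (s - - s)) * M); last by ring.
have N (t : R) : - s <= t <= s -> `|t| <= s by rewrite ler_norml.
have s1 : `|- s| = s by rewrite normrN gtr0_norm.
have s2 : `|s| = s by rewrite gtr0_norm.
apply: bnd_bound => //; move=> x /N xs; split; apply: uM; rewrite ?sqP/= ?s1 ?s2 ?xs ?lexx //.
- exact: (sq_side s1 xs).2.
- exact: (sq_side s2 xs).2.
- exact: (sq_side s1 xs).1.
- exact: (sq_side s2 xs).1.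
Qed.

(** The integral does not depend on the side, and on a small square it is at most a constant times
    the supremum of |z u(z)|. *)
Lemma sqr_int_removable u (u' : C -> C) s : 0 < s ->
  (forall z, sq s z -> z != 0 -> cdiff u z (u' z)) ->
  (forall e : R, 0 < e -> exists2 d : R, 0 < d & forall z, z != 0 -> cabs z < d -> cabs (z * u z) <= e) ->
  sqr_int u s = 0.
Proof.
move=> s0 du lim; apply/eqP; rewrite -cabs_eq0 eq_le cabs_ge0 andbT.
apply/ler_addgt0Pr => e e0; rewrite add0r.
have [|d d0 h] := lim (e / 16); first by rewrite divr_gt0.
pose r := Num.min s (d / 4).
have r0 : 0 < r by rewrite lt_min s0 divr_gt0.
have rs : r <= s by rewrite ge_min lexx.
have rd : r <= d / 4 by rewrite ge_min lexx orbT.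
rewrite (sqr_int_indep r0 rs du).
have dr z : sq r z -> z != 0 -> cdiff u z (u' z).
  by move=> Rz; apply: du; move: Rz; apply: rect_sub; rewrite ?lerN2.
have := sqr_int_bound r0 (contsides_sq r0 dr) (M := e / 16 / r) => B.
apply: le_trans (B _) _; last by rewrite le_eqVlt; apply/orP; left; apply/eqP; field; rewrite gt_eqF.
move=> z /sqP[z1 z2] rz; have z0 : z != 0 by rewrite -cabs_gt0; exact: lt_le_trans rz.
rewrite ler_pdivlMr//.
apply: le_trans (h z z0 _); last by have := cabs_le_ReIm z; lra.
by rewrite cabsM mulrC; apply: ler_wpM2r => //; exact: cabs_ge0.
Qed.

End SquareCauchy.

Section CauchyEstimates.
Variable R : realType.
Local Notation C := (R[i]).
Implicit Types (u v h : C -> C) (z w l k : C).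

Lemma ri_ge (f : R -> R) a b m : a <= b -> contI f a b ->
  (forall x, a <= x <= b -> m <= f x) -> (b - a) * m <= ri f a b.
Proof.
by move=> ab cf fm; rewrite -ri_cst//; apply: le_ri => //; exact: contI_cst.
Qed.

Lemma contsides_inv (s : R) : 0 < s -> contsides (fun z : C => z^-1) (- s) s (- s) s.
Proof.
by move=> s0; apply: (contsides_sq (u' := fun z => - z^-1 ^+ 2)) => // z _; exact: cdiffV.
Qed.

(** The exact value is 2 pi i, but a lower bound is enough to divide by it. Each side contributes at
    least 1 to the imaginary part, because it has length 2s and s/(x^2+s^2) >= 1/(2s) on it. *)
Lemma sqr_int_inv_ge (s : R) : 0 < s -> 4 <= cabs (sqr_int (fun z : C => z^-1) s).
Proof.
move=> s0; have [c1 c2 c3 c4] := contsides_inv s0.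
apply: le_trans (ler_Im_cabs _); apply: le_trans (ler_norm _).
rewrite /sqr_int /bnd !(ReD, ImD, Im_mulE, ReN, ImN) /=.
have B (f : R -> R) : contI f (- s) s ->
    (forall x, - s <= x <= s -> (2 * s)^-1 <= f x) -> 1 <= ri f (- s) s.
  move=> cf fm; apply: le_trans (ri_ge _ cf fm); last lra.
  by rewrite le_eqVlt; apply/orP; left; apply/eqP; field; rewrite gt_eqF.
have S (x : R) : - s <= x <= s -> (2 * s)^-1 <= s / (x ^+ 2 + s ^+ 2).
  move=> xs; have x2 : x ^+ 2 <= s ^+ 2.
    by rewrite -subr_ge0 subr_sqr mulr_ge0//; lra.
  rewrite -[leLHS]mul1r ler_pdivlMr; last by rewrite ltr_wpDl ?sqr_ge0// exprn_gt0.
  rewrite mul1r ler_pdivrMl; last lra.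
  rewrite (_ : 2 * s * s = s ^+ 2 + s ^+ 2); last by ring.
  by rewrite lerD2r.
have h1 : 1 <= ri (fun x => complex.Im ((Complex x (- s))^-1)) (- s) s.
  apply: B => [|x xs]; first exact: ccI_Im c1.
  by rewrite /= mulNr opprK sqrrN; exact: S.
have h2 : ri (fun x => complex.Im ((Complex x s)^-1)) (- s) s <= -1.
  rewrite lerNr -[leRHS]mulN1r -riZ; last exact: ccI_Im c2.
  apply: B => [|x xs]; first exact/contIZ/(ccI_Im c2).
  by rewrite mulN1r /= opprK; exact: S.
have h3 : 1 <= ri (fun y => complex.Re ((Complex s y)^-1)) (- s) s.
  apply: B => [|x xs]; first exact: ccI_Re c3.
  by rewrite /= addrC; exact: S.
have h4 : ri (fun y => complex.Re ((Complex (- s) y)^-1)) (- s) s <= -1.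
  rewrite lerNr -[leRHS]mulN1r -riZ; last exact: ccI_Re c4.
  apply: B => [|x xs]; first exact/contIZ/(ccI_Re c4).
  by rewrite mulN1r /= mulNr opprK sqrrN addrC; exact: S.
lra.
Qed.

Lemma sq0 s : 0 < s -> sq s (0 : C).
Proof. by move=> s0; rewrite sqP/= normr0 ltW. Qed.

Section Formula.
Variables (h h' : C -> C) (s : R).
Hypotheses (s0 : 0 < s) (dh : forall z, sq s z -> cdiff h z (h' z)).

Let csh : contsides h (- s) s (- s) s.
Proof. by apply: contsides_sq => // z Sz _; exact: dh. Qed.

(** Cauchy's formula with the integral of 1/z left unevaluated: the singularity of (h(z) - h(0))/z
    is removable. *)
Lemma sqr_cauchy : sqr_int (fun z => h z * z^-1) s = h 0 * sqr_int (fun z => z^-1) s.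
Proof.
have dq z : sq s z -> z != 0 ->
    cdiff (fun z => h z * z^-1) z (h' z * z^-1 + h z * (- z^-1 ^+ 2)).
  by move=> Sz z0; apply: cdiffM; [exact: dh|exact: cdiffV].
have dk z : z != 0 -> cdiff (fun z => - h 0 * z^-1) z (- h 0 * (- z^-1 ^+ 2)).
  by move=> z0; apply: cdiffZ; exact: cdiffV.
have c1 := contsides_sq s0 dq.
have c2 : contsides (fun z => - h 0 * z^-1) (- s) s (- s) s.
  by apply: contsidesZ; exact: contsides_inv.
have E : sqr_int (fun z => h z * z^-1 + - h 0 * z^-1) s = 0.
  apply: sqr_int_removable => //.
    by move=> z Sz z0; apply: cdiffD; [exact: dq|exact: dk].
  move=> e e0; have [d d0 H] := cdiff_cont (dh (sq0 s0)) e0.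
  exists d => // z z0 zd; rewrite (_ : z * _ = h z - h 0); last by field.
  by apply: H; rewrite subr0.
move: E; rewrite /sqr_int bndD// bndZ//; last exact: contsides_inv.
by move=> /eqP; rewrite mulNr subr_eq0 => /eqP.
Qed.

(** The same argument one order higher: z times (h(z) - h(0))/z^2 - h'(0)/z tends to 0 at the
    origin. *)
Lemma sqr_cauchy_deriv :
  sqr_int (fun z => (h z - h 0) * z^-1 ^+ 2) s = h' 0 * sqr_int (fun z => z^-1) s.
Proof.
have dq z : sq s z -> z != 0 -> cdiff (fun z => (h z - h 0) * (z^-1 * z^-1)) z
    ((h' z + 0) * (z^-1 * z^-1) + (h z - h 0) * (- z^-1 ^+ 2 * z^-1 + z^-1 * - z^-1 ^+ 2)).
  move=> Sz z0; apply: cdiffM; first by apply: cdiffD; [exact: dh|exact: cdiff_cst].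
  by apply: cdiffM; exact: cdiffV.
have dk z : z != 0 -> cdiff (fun z => - h' 0 * z^-1) z (- h' 0 * (- z^-1 ^+ 2)).
  by move=> z0; apply: cdiffZ; exact: cdiffV.
have c1 := contsides_sq s0 dq.
have c2 : contsides (fun z => - h' 0 * z^-1) (- s) s (- s) s.
  by apply: contsidesZ; exact: contsides_inv.
have E : sqr_int (fun z => (h z - h 0) * (z^-1 * z^-1) + - h' 0 * z^-1) s = 0.
  apply: sqr_int_removable => //.
    by move=> z Sz z0; apply: cdiffD; [exact: dq|exact: dk].
  move=> e e0; have [d d0 H] := dh (sq0 s0) e0.
  exists d => // z z0 zd; rewrite (_ : z * _ = (h z - h 0 - h' 0 * (z - 0)) * z^-1); last by field.
  rewrite cabsM cabsV ler_pdivrMr ?cabs_gt0//.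
  by have := H z; rewrite subr0; apply.
move: E; rewrite /sqr_int bndD// bndZ//; last exact: contsides_inv.
by move=> /eqP; rewrite mulNr subr_eq0 => /eqP.
Qed.

(** Cauchy's formula with |1/z| <= 1/s on the contour and [sqr_int_inv_ge] for the divisor. The
    sides are kept as four separate integrals because this is integrated over s in
    [square_area_mean]. *)
Lemma sqr_mean : 2 * s * cabs (h 0) <=
  ri (fun x => cabs (h (Complex x (- s)))) (- s) s + ri (fun x => cabs (h (Complex x s))) (- s) s +
  (ri (fun y => cabs (h (Complex s y))) (- s) s + ri (fun y => cabs (h (Complex (- s) y))) (- s) s).
Proof.
have dq z : sq s z -> z != 0 ->
    cdiff (fun z => h z * z^-1) z (h' z * z^-1 + h z * (- z^-1 ^+ 2)).
  by move=> Sz z0; apply: cdiffM; [exact: dh|exact: cdiffV].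
have [c1 c2 c3 c4] := contsides_sq s0 dq; case: csh => d1 d2 d3 d4.
have B (F : R -> C) (G : R -> C) : ccI F (- s) s -> ccI (fun x => F x * (G x)^-1) (- s) s ->
    (forall x, - s <= x <= s -> s <= cabs (G x)) ->
    cabs (ci (fun x => F x * (G x)^-1) (- s) s) <= 2 / s * ri (fun x => cabs (F x)) (- s) s.
  move=> cF cFG sG; apply: le_trans (cabs_ci_le cFG) _; rewrite -mulrA ler_pM2l//.
  rewrite -riZ; last exact: ccI_cabs.
  apply: le_ri; [exact: ccI_cabs|exact/contIZ/ccI_cabs|move=> x xs].
  rewrite cabsM cabsV mulrC; apply: ler_wpM2r; first exact: cabs_ge0.
  by rewrite lef_pV2 ?posrE ?sG//; apply: lt_le_trans (sG _ xs).
have N (t : R) : - s <= t <= s -> `|t| <= s by rewrite ler_norml.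
have s1 : `|- s| = s by rewrite normrN gtr0_norm.
have s2 : `|s| = s by rewrite gtr0_norm.
have b1 := B _ _ d1 c1 (fun x xs => (sq_side s1 (N _ xs)).2).
have b2 := B _ _ d2 c2 (fun x xs => (sq_side s2 (N _ xs)).2).
have b3 := B _ _ d3 c3 (fun x xs => (sq_side s2 (N _ xs)).1).
have b4 := B _ _ d4 c4 (fun x xs => (sq_side s1 (N _ xs)).1).
have k4 := sqr_int_inv_ge s0; have := congr1 (@cabs R) sqr_cauchy; rewrite cabsM => E.
have E4 : cabs (h 0) * 4 <= cabs (sqr_int (fun z => h z * z^-1) s).
  by rewrite E; apply: ler_wpM2l => //; exact: cabs_ge0.
have : cabs (h 0) * 4 <= 2 / s * (
  ri (fun x => cabs (h (Complex x (- s)))) (- s) s + ri (fun x => cabs (h (Complex x s))) (- s) s +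
  (ri (fun y => cabs (h (Complex s y))) (- s) s + ri (fun y => cabs (h (Complex (- s) y))) (- s) s)).
  apply: le_trans E4 _; rewrite 3!mulrDr; apply: le_trans (cabsD _ _) _.
  apply: lerD; first by apply: le_trans (cabsD _ _) _; rewrite cabsN lerD.
  rewrite cabsM cabs_imag normr1 mul1r.
  by apply: le_trans (cabsD _ _) _; rewrite cabsN lerD.
set S := (_ + _); rewrite mulrAC ler_pdivlMr// => H; lra.
Qed.

Lemma cauchy_deriv0 M : (forall z, sq s z -> cabs (h z) <= M) -> cabs (h' 0) <= 8 * M / s.
Proof.
move=> hM; have dq z : sq s z -> z != 0 -> cdiff (fun z => (h z - h 0) * (z^-1 * z^-1)) z
    ((h' z + 0) * (z^-1 * z^-1) + (h z - h 0) * (- z^-1 ^+ 2 * z^-1 + z^-1 * - z^-1 ^+ 2)).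
  move=> Sz z0; apply: cdiffM; first by apply: cdiffD; [exact: dh|exact: cdiff_cst].
  by apply: cdiffM; exact: cdiffV.
have B := sqr_int_bound s0 (contsides_sq s0 dq) (M := 2 * M / s ^+ 2).
have : cabs (h' 0) * 4 <= 16 * s * (2 * M / s ^+ 2).
  apply: le_trans (B _) => [|z Sz sz].
    apply: le_trans (_ : cabs (h' 0 * sqr_int (fun z => z^-1) s) <= _).
      by rewrite cabsM; apply: ler_wpM2l; [exact: cabs_ge0|exact: sqr_int_inv_ge].
    by rewrite -sqr_cauchy_deriv.
  have z0 : 0 < cabs z by exact: lt_le_trans sz.
  rewrite !cabsM cabsV -invfM; apply: ler_pM; rewrite ?cabs_ge0 ?invr_ge0//.
  - exact: mulr_ge0 (cabs_ge0 _) (cabs_ge0 _).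
  - apply: le_trans (cabsD _ _) _; rewrite cabsN mulr_natl mulr2n.
    by apply: lerD; apply: hM => //; exact: sq0.
  - rewrite lef_pV2 ?posrE ?exprn_gt0 ?mulr_gt0// expr2.
    by apply: ler_pM => //; exact: ltW.
rewrite (_ : 16 * s * _ = 8 * M / s * 4); last by field; rewrite gt_eqF.
by rewrite ler_pM2r.
Qed.

End Formula.

(** The square of half-side r/8 about z stays within r/4 of z, hence inside the disc of radius r; 8
    M / (r/8) gives the constant 64. *)
Lemma cauchy_deriv h (h' : C -> C) z0 (r M : R) : 0 < r ->
  (forall z, cabs (z - z0) < r -> cdiff h z (h' z)) ->
  (forall z, cabs (z - z0) < r -> cabs (h z) <= M) ->
  forall z, cabs (z - z0) <= r / 2 -> cabs (h' z) <= 64 * M / r.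
Proof.
move=> r0 dh hM z zr; have s0 : 0 < r / 8 by rewrite divr_gt0.
have In w : sq (r / 8) w -> cabs (z + w - z0) < r.
  move=> /sqP[w1 w2]; have := cabs_le_ReIm w.
  by rewrite addrAC; have := cabsD (z - z0) w; lra.
have H := @cauchy_deriv0 (fun w => h (z + w)) (fun w => h' (z + w)) _ s0 _ M.
rewrite (_ : 64 * M / r = 8 * M / (r / 8)); last by field; rewrite gt_eqF.
rewrite -[z in cabs (h' z)]addr0; apply: H => w Sw; last exact/hM/In.
by apply: cdiff_shift; apply: dh; exact: In.
Qed.

Lemma eps_is_derive (f : R -> R) (x l : R) :
  (forall e : R, 0 < e -> exists2 d : R, 0 < d &
    forall y, `|y - x| < d -> `|f y - f x - l * (y - x)| <= e * `|y - x|) ->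
  is_derive x 1 f l.
Proof.
move=> H; have C : h^-1 *: ((f \o shift x) (h *: 1) - f x) @[h --> 0^'] --> l.
  apply/cvgrPdist_le => e e0; have [d d0 h] := H e e0.
  apply/nbhs_ballP; exists d => // t /=; rewrite /ball/= sub0r normrN => td t0.
  have := h (t + x); rewrite addrK => /(_ td).
  rewrite /shift/= /GRing.scale/= mulr1 => h'.
  rewrite (_ : l - _ = - (t^-1 * (f (t + x) - f x - l * t))); last by field.
  by rewrite normrN normrM normfV ler_pdivrMl ?normr_gt0// [leRHS]mulrC.
apply: DeriveDef; first by apply/cvg_ex; exists l.
exact: cvg_lim C.
Qed.

Lemma cdiff_segment_Re h (h' : C -> C) (z v : C) (t : R) : cdiff h (z + (t%:C)%C * v) (h' (z + (t%:C)%C * v)) ->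
  is_derive t 1 (fun x : R => complex.Re (h (z + (x%:C)%C * v))) (complex.Re (h' (z + (t%:C)%C * v) * v)).
Proof.
move=> dh; apply: eps_is_derive => e e0.
have k0 : 0 < cabs v + 1 by rewrite ltr_wpDl ?cabs_ge0.
have [|d d0 H] := dh (e / (cabs v + 1)); first by rewrite divr_gt0.
exists (d / (cabs v + 1)); first by rewrite divr_gt0.
move=> y yt; have E : z + (y%:C)%C * v - (z + (t%:C)%C * v) = ((y - t)%:C)%C * v.
  by rewrite rmorphB; ring.
have := H (z + (y%:C)%C * v); rewrite E cabsM cabsE_real => h1.
have ed : `|y - t| * cabs v <= `|y - t| * (cabs v + 1) by rewrite ler_wpM2l// lerDl.
have {}h1 := h1 (le_lt_trans ed _).
have -> : complex.Re (h (z + (y%:C)%C * v)) - complex.Re (h (z + (t%:C)%C * v)) -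
   complex.Re (h' (z + (t%:C)%C * v) * v) * (y - t) =
   complex.Re (h (z + (y%:C)%C * v) - h (z + (t%:C)%C * v) - h' (z + (t%:C)%C * v) * (((y - t)%:C)%C * v)).
  by rewrite !(ReD, ReN, Re_mulE, Im_mulE)/=; ring.
apply: le_trans (ler_Re_cabs _) _; apply: le_trans (h1 _) _.
  by rewrite -ltr_pdivlMr.
apply: le_trans (_ : e / (cabs v + 1) * (`|y - t| * (cabs v + 1)) <= _).
  by apply: ler_wpM2l ed; rewrite divr_ge0 ?ltW.
by rewrite (mulrC `|_|) mulrA divfK ?gt_eqF.
Qed.

(** The real mean value theorem along the segment, once for the real part of h and once for that of
    -i h; hence the factor 2. *)
Lemma cdiff_mvt h (h' : C -> C) (z v : C) (K : R) :
  (forall t : R, 0 <= t <= 1 -> cdiff h (z + (t%:C)%C * v) (h' (z + (t%:C)%C * v))) ->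
  (forall t : R, 0 <= t <= 1 -> cabs (h' (z + (t%:C)%C * v)) <= K) ->
  cabs (h (z + v) - h z) <= 2 * (K * cabs v).
Proof.
have RB (g g' : C -> C) : (forall t : R, 0 <= t <= 1 -> cdiff g (z + (t%:C)%C * v) (g' (z + (t%:C)%C * v))) ->
    (forall t : R, 0 <= t <= 1 -> cabs (g' (z + (t%:C)%C * v)) <= K) ->
    `|complex.Re (g (z + v) - g z)| <= K * cabs v.
  move=> dg gK; pose f (x : R) := complex.Re (g (z + (x%:C)%C * v)).
  pose f' (t : R) := complex.Re (g' (z + (t%:C)%C * v) * v).
  have df (t : R) : 0 <= t <= 1 -> is_derive t 1 f (f' t).
    by move=> t01; apply: cdiff_segment_Re; exact: dg.
  have [||c c01] := @MVT R f f' 0 1 ltr01.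
  - by move=> x; rewrite in_itv/= => /andP[x0 x1]; apply: df; rewrite !ltW.
  - apply: derivable_within_continuous => x; rewrite in_itv/= => x01.
    by have [] := df x x01.
  rewrite /f rmorph1 rmorph0 mul1r mul0r addr0 subr0 mulr1 ReD ReN => ->.
  apply: le_trans (ler_Re_cabs _) _; rewrite cabsM; apply: ler_wpM2r; first exact: cabs_ge0.
  by apply: gK; move: c01; rewrite in_itv/= => /andP[x0 x1]; rewrite !ltW.
move=> dh hK; apply: le_trans (cabs_le_ReIm _) _; rewrite mulr_natl mulr2n; apply: lerD.
  exact: (RB h h' dh hK).
have := RB (fun w => Complex 0 (-1) * h w) (fun w => Complex 0 (-1) * h' w).
rewrite -mulrBr (_ : complex.Re _ = complex.Im (h (z + v) - h z)); last first.
  by rewrite Re_mulE/=; ring.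
apply => t t01; first exact/cdiffZ/dh.
by rewrite cabsM cabs_imag normrN normr1 mul1r; exact: hK.
Qed.

Section Taylor.
Variables (h h' : C -> C) (z0 : C) (r M : R).
Hypotheses (r0 : 0 < r) (dh : forall z, cabs (z - z0) < r -> cdiff h z (h' z))
  (hM : forall z, cabs (z - z0) < r -> cabs (h z) <= M).

Let M0 : 0 <= M.
Proof. by apply: le_trans (cabs_ge0 (h z0)) (hM _); rewrite subrr cabs0. Qed.

Lemma segment_in z w (q t : R) : 0 <= t <= 1 -> cabs (z - z0) <= q -> cabs (w - z0) <= q ->
  cabs (z + (t%:C)%C * (w - z) - z0) <= q.
Proof.
move=> /andP[t0 t1] zq wq.
rewrite (_ : _ - z0 = ((1 - t)%:C)%C * (z - z0) + (t%:C)%C * (w - z0)); last first.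
  by rewrite rmorphB rmorph1; ring.
apply: le_trans (cabsD _ _) _; rewrite !cabsM !cabsE_real !ger0_norm ?subr_ge0//.
apply: le_trans (_ : (1 - t) * q + t * q <= _); last by lra.
by apply: lerD; apply: ler_wpM2l; rewrite ?subr_ge0.
Qed.

Lemma holo_lip z w : cabs (z - z0) <= r / 2 -> cabs (w - z0) <= r / 2 ->
  cabs (h w - h z) <= 128 * M / r * cabs (w - z).
Proof.
move=> zr wr; rewrite (_ : 128 * M / r * cabs (w - z) = 2 * (64 * M / r * cabs (w - z))); last by ring.
rewrite -{1}[w](subrKC z); apply: (cdiff_mvt (h' := h')) => t t01; have Iz := segment_in t01 zr wr.
  by apply: dh; apply: le_lt_trans Iz _; have := r0; lra.
exact: (cauchy_deriv r0 dh hM).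
Qed.

(** Cauchy's estimate for the difference of h and its translate by w - z0, which is small by
    [holo_lip]. In this way differentiability of h' is never invoked. *)
Lemma deriv_lip w : cabs (w - z0) <= r / 4 ->
  cabs (h' w - h' z0) <= 64 * (128 * M / r * cabs (w - z0)) / (r / 4).
Proof.
move=> wr; have r40 : 0 < r / 4 by rewrite divr_gt0.
pose k z := h (w - z0 + z) + -1 * h z; pose k' z := h' (w - z0 + z) + -1 * h' z.
have -> : h' w - h' z0 = k' z0 by rewrite /k' subrK mulN1r.
apply: (@cauchy_deriv k k' z0 _ _ r40) => [z zr|z zr|]; last by rewrite subrr cabs0; lra.
  have a1 : cabs (w - z0 + z - z0) < r.
    by rewrite -addrA; have := cabsD (w - z0) (z - z0); lra.
  by apply: cdiffD; [apply: cdiff_shift; exact: dh|apply/cdiffZ/dh; lra].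
have a1 : cabs (w - z0 + z - z0) <= r / 2.
  by rewrite -addrA; have := cabsD (w - z0) (z - z0); lra.
rewrite /k mulN1r; apply: le_trans (holo_lip _ a1) _; first lra.
by rewrite addrK.
Qed.

Lemma holo_taylor z : cabs (z - z0) <= r / 4 ->
  cabs (h z - h z0 - h' z0 * (z - z0)) <=
    2 * (64 * (128 * M / r) / (r / 4)) * cabs (z - z0) ^+ 2.
Proof.
move=> zr.
have In (t : R) : 0 <= t <= 1 -> cabs (z0 + (t%:C)%C * (z - z0) - z0) <= cabs (z - z0).
  by move=> t01; apply: segment_in; rewrite // subrr cabs0 cabs_ge0.
have := @cdiff_mvt (fun w => h w + - h' z0 * w) (fun w => h' w + - h' z0 * 1) z0 (z - z0)
  (64 * (128 * M / r * cabs (z - z0)) / (r / 4)).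
rewrite subrKC (_ : _ + _ - _ = h z - h z0 - h' z0 * (z - z0)); last by ring.
rewrite (_ : 2 * (_ * _) = 2 * (64 * (128 * M / r) / (r / 4)) * cabs (z - z0) ^+ 2); last by ring.
apply => t /In zt.
  apply: cdiffD; last exact/cdiffZ/cdiff_id.
  by apply: dh; apply: le_lt_trans (le_trans zt zr) _; have := r0; lra.
rewrite mulr1; apply: le_trans (deriv_lip (le_trans zt zr)) _.
rewrite ler_pM2r ?invr_gt0 ?divr_gt0// ler_pM2l// ler_wpM2l//.
by rewrite divr_ge0 ?mulr_ge0// ltW.
Qed.

End Taylor.

End CauchyEstimates.

Arguments normz {R n} z : simpl never.
Arguments psi {R n} z : simpl never.

(** * Holomorphic functions on the ball *)

Section MultiDiff.
Variables (R : realType) (n : nat).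
Local Notation C := (R[i]).
Local Notation Cn := ('rV[R[i]]_n).
Implicit Types (z w : Cn) (f : Cn -> C^o) (D : 'I_n -> C).

(** The sum norm carries all local estimates in several variables, since linear forms and sums over
    coordinates are bounded by it termwise; [nbhs_nrm1P] ties it to the topology of [CnN]. *)
Definition nrm1 z : R := \sum_k cabs (z 0 k).

Lemma nrm1_ge0 z : 0 <= nrm1 z.
Proof. by apply: sumr_ge0 => k _; exact: cabs_ge0. Qed.

Lemma cabs_nrm1 z k : cabs (z 0 k) <= nrm1 z.
Proof. by rewrite /nrm1 (bigD1 k)//= lerDl sumr_ge0// => i _; exact: cabs_ge0. Qed.

Lemma nrm1D z w : nrm1 (z + w) <= nrm1 z + nrm1 w.
Proof. by rewrite /nrm1 -big_split/=; apply: ler_sum => k _; rewrite mxE; exact: cabsD. Qed.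

Lemma nrm1Z (a : C) z : nrm1 (a *: z) = cabs a * nrm1 z.
Proof. by rewrite /nrm1 mulr_sumr; apply: eq_bigr => k _; rewrite mxE cabsM. Qed.

Lemma nrm1N z : nrm1 (- z) = nrm1 z.
Proof. by apply: eq_bigr => k _; rewrite mxE cabsN. Qed.

Lemma nrm10 : nrm1 0 = 0.
Proof. by rewrite /nrm1 big1// => k _; rewrite mxE cabs0. Qed.

Lemma nrm1_delta k : nrm1 (delta_mx 0 k) = 1.
Proof.
rewrite /nrm1 (bigD1 k)//= mxE !eqxx cabs1 big1 ?addr0// => i ik.
by rewrite mxE eqxx (negbTE ik) cabs0.
Qed.

Lemma ltr0c (x : R) : (0 < (x%:C)%C) = (0 < x).
Proof. by rewrite -[0 in LHS](rmorph0 (real_complex R)) ltcR. Qed.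

Lemma gt0_complex (e : C) : 0 < e -> exists2 d : R, 0 < d & e = (d%:C)%C.
Proof.
move=> e0; exists (complex.Re e); last by rewrite RRe_real// gtr0_real.
by move: e0; rewrite ltcE/= => /andP[].
Qed.

Lemma nbhs_nrm1P z (A : set (CnN n)) : nbhs (z : CnN n) A <->
  exists2 d : R, 0 < d & forall w, nrm1 (w - z) < d -> A w.
Proof.
split.
  move/nbhs_ballP => [e /= e0 eA]; have [d d0 dE] := gt0_complex e0.
  exists d => // w wz; apply: eA; split; first by [].
  move=> i j; rewrite /ball/= dE norm_cabs ltcR (le_lt_trans _ wz)//.
  rewrite (le_trans _ (cabs_nrm1 (w - z) j))// cabsB !mxE.
  by rewrite (ord1 i).
move=> [d d0 dA]; apply/nbhs_ballP; exists ((d / n.+1%:R)%:C)%C.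
  by rewrite /= ltr0c divr_gt0.
move=> w [_ zw]; apply: dA.
apply: le_lt_trans (_ : \sum_(k < n) d / n.+1%:R < _).
  apply: ler_sum => k _; have := zw 0 k; rewrite /ball/= norm_cabs ltcR => /ltW.
  by rewrite cabsB !mxE.
rewrite sumr_const card_ord -[_ *+ n]mulr_natr -mulrA gtr_pMr// mulrC ltr_pdivrMr// mul1r.
by rewrite ltr_nat.
Qed.

Lemma nrm1_mx_norm (h : CnN n) : (((nrm1 h)%:C)%C <= n%:R * `|h|).
Proof.
rewrite /nrm1 rmorph_sum/=; apply: le_trans (_ : \sum_(k < n) `|h| <= _).
  apply: ler_sum => k _; rewrite -norm_cabs.
  rewrite [leRHS]mx_normE -[leLHS]nngE num_le.
  exact: (le_bigmax _ _ ((0, k) : 'I_1 * 'I_n)).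
by rewrite sumr_const card_ord mulr_natl.
Qed.

Lemma mx_norm_nrm1 (h : CnN n) : `|h| <= ((nrm1 h)%:C)%C.
Proof.
have [h0|] := eqVneq (mx_norm h) 0.
  by rewrite [leLHS]h0 -(rmorph0 (real_complex R)) lecR nrm1_ge0.
move=> /mx_norm_neq0[[i k] /= E]; rewrite [leLHS]E norm_cabs lecR (ord1 i).
exact: cabs_nrm1.
Qed.

(** Frechet differentiability with the vector of partial derivatives as explicit data and real
    tolerances; [diff_fdiff] and [fdiff_diff] translate from and to [differentiable]. *)
Definition fdiff f z D := forall e : R, 0 < e -> exists2 d : R, 0 < d &
  forall w, nrm1 (w - z) < d ->
    cabs (f w - f z - \sum_k (w - z) 0 k * D k) <= e * nrm1 (w - z).

Definition dgrad f z k : C := 'D_(delta_mx 0 k) f z.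

Lemma diff_fdiff f z : differentiable f (z : CnN n) -> fdiff f z (dgrad f z).
Proof.
move=> df; have /diff_locallyP[_ /eqaddoP dl] := df.
move=> e e0; have en : 0 < (e%:C)%C :> C by rewrite ltr0c.
have /nbhs_nrm1P[d d0 H] := dl _ en.
exists d => // w wz; have := H (w - z); rewrite subr0 => /(_ wz) h0.
have {h0} : `|f (w - z + z) - (f z + 'd f (z : CnN n) (w - z))| <= (e%:C)%C * `|w - z : CnN n| := h0.
rewrite subrK.
have -> : 'd f (z : CnN n) (w - z) = \sum_k (w - z) 0 k * dgrad f z k.
  rewrite [w - z in LHS]row_sum_delta linear_sum/=; apply: eq_bigr => k _.
  by rewrite linearZ/= /dgrad deriveE.
rewrite opprD addrA norm_cabs => h1.
rewrite -lecR; apply: le_trans h1 _.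
rewrite rmorphM ler_pM2l//; exact: mx_norm_nrm1.
Qed.

Lemma fdiff_diff f z D : fdiff f z D -> differentiable f (z : CnN n) /\ dgrad f z = D.
Proof.
move=> df; pose L (h : CnN n) : C^o := \sum_k h 0 k * D k.
have Llin : linear L.
  move=> a x y; rewrite /L scaler_sumr -big_split/=; apply: eq_bigr => k _.
  by rewrite !mxE mulrDl -mulrA.
pose Lm := GRing.isLinear.Build _ _ _ _ L Llin.
pose LL : {linear CnN n -> C^o} := HB.pack L Lm.
have LB h : cabs (L h) <= (\sum_k cabs (D k)) * nrm1 h.
  apply: le_trans (cabs_sum _) _; rewrite mulr_suml; apply: ler_sum => k _.
  by rewrite cabsM mulrC; apply: ler_wpM2l; rewrite ?cabs_ge0 ?cabs_nrm1.
have S0 : 0 < \sum_k cabs (D k) + 1.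
  by rewrite ltr_wpDl// sumr_ge0// => k _; exact: cabs_ge0.
have Lc : continuous LL.
  apply: continuousfor0_continuous => A /nbhs_ballP[e /= e0 eA].
  change (nbhs (0 : CnN n) (LL @^-1` A)); have [r r0 rE] := gt0_complex e0.
  apply/nbhs_nrm1P; exists (r / (\sum_k cabs (D k) + 1)); first by rewrite divr_gt0.
  move=> w; rewrite subr0 => wr; apply: eA.
  rewrite /ball/= (_ : L 0 = 0) ?sub0r ?normrN ?rE ?norm_cabs ?ltcR; last first.
    by rewrite /L big1// => k _; rewrite mxE mul0r.
  apply: le_lt_trans (LB w) _.
  apply: le_lt_trans (_ : (\sum_k cabs (D k) + 1) * nrm1 w < _).
    by apply: ler_wpM2r; [exact: nrm1_ge0|rewrite lerDl].
  by rewrite mulrC -ltr_pdivlMr.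
have E : f \o shift (z : CnN n) = cst (f z) + LL +o_ (0 : CnN n) id.
  apply/eqaddoP => e e0; have [r r0 ->] := gt0_complex e0.
  have rn : 0 < r / n.+1%:R by rewrite divr_gt0.
  have [d d0 H] := df _ rn.
  apply/nbhs_nrm1P; exists d => // w; rewrite subr0 => wd.
  change (`|f (w + z) - (f z + L w)| <= (r%:C)%C * `|w : CnN n|).
  have := H (w + z); rewrite addrK => /(_ wd) h1.
  rewrite norm_cabs opprD addrA; apply: le_trans (_ : ((r / n.+1%:R * nrm1 w)%:C)%C <= _).
    by rewrite lecR.
  rewrite rmorphM/=; apply: le_trans (_ : ((r / n.+1%:R)%:C)%C * (n%:R * `|w : CnN n|) <= _).
    by apply: ler_wpM2l; [rewrite ltW// ltr0c|exact: nrm1_mx_norm].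
  rewrite mulrA; apply: ler_wpM2r => //.
  rewrite -(rmorph_nat (real_complex R)) -rmorphM lecR mulrAC ler_pdivrMr// ler_pM2l//.
  by rewrite ler_nat.
have U := diff_unique Lc E.
have df' : differentiable f (z : CnN n) by apply/diff_locallyP; rewrite U.
split => //; apply/funext => k; rewrite /dgrad deriveE// U/= /L (bigD1 k)//=.
rewrite mxE !eqxx mul1r big1 ?addr0// => j jk.
by rewrite mxE eqxx (negbTE jk) mul0r.
Qed.

Lemma holo_fdiff f z : holo f -> Bn z -> fdiff f z (dgrad f z).
Proof. by move=> hf Bz; apply: diff_fdiff; exact: hf. Qed.

Lemma RderE f z : Rder f z = \sum_k z 0 k * dgrad f z k.
Proof. by []. Qed.

Lemma fdiff_lip f z D : fdiff f z D -> exists2 d : R, 0 < d & forall w, nrm1 (w - z) < d ->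
  cabs (f w - f z) <= (\sum_k cabs (D k) + 1) * nrm1 (w - z).
Proof.
move=> /(_ _ ltr01)[d d0 H]; exists d => // w wz.
rewrite -[_ - _](subrK (\sum_k (w - z) 0 k * D k)).
apply: le_trans (cabsD _ _) _; rewrite mulrDl [leRHS]addrC; apply: lerD; first exact: H.
apply: le_trans (cabs_sum _) _; rewrite mulr_suml; apply: ler_sum => k _.
by rewrite cabsM mulrC; apply: ler_wpM2l; rewrite ?cabs_ge0 ?cabs_nrm1.
Qed.

Lemma fdiff_cont f z D : fdiff f z D -> forall e : R, 0 < e -> exists2 d : R, 0 < d &
  forall w, nrm1 (w - z) < d -> cabs (f w - f z) <= e.
Proof.
move=> /fdiff_lip[d d0 H] e e0.
have S0 : 0 < \sum_k cabs (D k) + 1.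
  by rewrite ltr_wpDl// sumr_ge0// => k _; exact: cabs_ge0.
exists (Num.min d (e / (\sum_k cabs (D k) + 1))); first by rewrite lt_min d0 divr_gt0.
move=> w; rewrite lt_min => /andP[/H w1 w2]; apply: le_trans w1 _.
by rewrite mulrC -ler_pdivlMr// ltW.
Qed.

Lemma fdiff_line f z v (t : C) D : fdiff f (z + t *: v) D ->
  cdiff (fun l => f (z + l *: v)) t (\sum_k v 0 k * D k).
Proof.
move=> df e e0; have v0 : 0 < nrm1 v + 1 by rewrite ltr_wpDl ?nrm1_ge0.
have [|d d0 H] := df (e / (nrm1 v + 1)); first by rewrite divr_gt0.
exists (d / (nrm1 v + 1)); first by rewrite divr_gt0.
move=> s st; have E : z + s *: v - (z + t *: v) = (s - t) *: v.
  by rewrite opprD addrACA subrr add0r scalerBl.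
have h1 : cabs (s - t) * nrm1 v <= cabs (s - t) * (nrm1 v + 1).
  by apply: ler_wpM2l; rewrite ?cabs_ge0 ?lerDl.
have := H (z + s *: v); rewrite E nrm1Z => /(_ (le_lt_trans h1 _)).
rewrite -ltr_pdivlMr// => /(_ st) h2.
rewrite (_ : (\sum_k v 0 k * D k) * (s - t) = \sum_k ((s - t) *: v) 0 k * D k); last first.
  by rewrite mulrC mulr_sumr; apply: eq_bigr => k _; rewrite mxE mulrA.
apply: le_trans h2 _.
apply: le_trans (_ : e / (nrm1 v + 1) * (cabs (s - t) * (nrm1 v + 1)) <= _).
  by apply: ler_wpM2l h1; rewrite divr_ge0 ?ltW.
by rewrite (mulrC (cabs _)) mulrA divfK ?gt_eqF.
Qed.

End MultiDiff.

Section EuclideanNorm.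
Variables (R : realType) (n : nat).
Local Notation C := (R[i]).
Local Notation Cn := ('rV[R[i]]_n).
Implicit Types (z w a : Cn).

Lemma sumsq_ge0 z : 0 <= \sum_(j < n) cabs (z 0 j) ^+ 2.
Proof. by apply: sumr_ge0 => j _; exact: sqr_ge0. Qed.

Lemma sqr_normz z : normz z ^+ 2 = \sum_(j < n) cabs (z 0 j) ^+ 2.
Proof. by rewrite /normz sqr_sqrtr// sumsq_ge0. Qed.

Lemma normz_ge0 z : 0 <= normz z.
Proof. exact: sqrtr_ge0. Qed.

Lemma ler_normz z (x : R) : 0 <= x -> normz z ^+ 2 <= x ^+ 2 -> normz z <= x.
Proof. by move=> x0; rewrite ler_pXn2r// nnegrE normz_ge0. Qed.

Lemma cabs_normz z k : cabs (z 0 k) <= normz z.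
Proof.
rewrite -(@ler_pXn2r _ 2)// ?nnegrE ?cabs_ge0 ?normz_ge0// sqr_normz (bigD1 k)//=.
by rewrite lerDl sumr_ge0// => i _; exact: sqr_ge0.
Qed.

Lemma normzZ (l : C) z : normz (l *: z) = cabs l * normz z.
Proof.
apply/eqP; rewrite -(@eqrXn2 _ 2)// ?mulr_ge0 ?cabs_ge0 ?normz_ge0//.
rewrite exprMn !sqr_normz mulr_sumr; apply/eqP; apply: eq_bigr => j _.
by rewrite mxE cabsM exprMn.
Qed.

Lemma normz0 : normz (0 : Cn) = 0.
Proof. by rewrite /normz big1 ?sqrtr0// => j _; rewrite mxE cabs0 expr0n. Qed.

(** Cauchy-Schwarz, obtained termwise from a b <= t a^2/2 + b^2/(2t) with t = |w|/|z|. *)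
Lemma sum_mul_le_normz z w : \sum_(j < n) cabs (z 0 j) * cabs (w 0 j) <= normz z * normz w.
Proof.
have [z0|z0] := eqVneq (normz z) 0.
  rewrite z0 mul0r big1// => j _; have := cabs_normz z j; rewrite z0 => h.
  by rewrite (_ : cabs _ = 0) ?mul0r//; apply/eqP; rewrite eq_le h cabs_ge0.
have [w0|w0] := eqVneq (normz w) 0.
  rewrite w0 mulr0 big1// => j _; have := cabs_normz w j; rewrite w0 => h.
  by rewrite mulrC (_ : cabs _ = 0) ?mul0r//; apply/eqP; rewrite eq_le h cabs_ge0.
have zp : 0 < normz z by rewrite lt_neqAle eq_sym z0 normz_ge0.
have wp : 0 < normz w by rewrite lt_neqAle eq_sym w0 normz_ge0.
pose t := normz w / normz z; have t0 : 0 < t by rewrite divr_gt0.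
rewrite (_ : normz z * normz w = t / 2 * normz z ^+ 2 + t^-1 / 2 * normz w ^+ 2); last first.
  by rewrite /t; field; rewrite z0 w0.
rewrite !sqr_normz !mulr_sumr -big_split/=; apply: ler_sum => j _.
rewrite -subr_ge0 (_ : _ - _ = t / 2 * (cabs (z 0 j) - t^-1 * cabs (w 0 j)) ^+ 2).
  by rewrite mulr_ge0 ?sqr_ge0// divr_ge0 ?ltW.
by field; rewrite gt_eqF.
Qed.

Lemma normzD z w : normz (z + w) <= normz z + normz w.
Proof.
apply: ler_normz; first by rewrite addr_ge0 ?normz_ge0.
rewrite sqrrD {1}sqr_normz; apply: le_trans (_ : \sum_(j < n)
   (cabs (z 0 j) ^+ 2 + cabs (z 0 j) * cabs (w 0 j) *+ 2 + cabs (w 0 j) ^+ 2) <= _).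
  apply: ler_sum => j _; rewrite -sqrrD mxE ler_pXn2r ?nnegrE ?cabs_ge0 ?addr_ge0 ?cabs_ge0//.
  exact: cabsD.
rewrite 2!big_split/= -!sqr_normz lerD2r lerD2l sumrMnl lerMn2r/=.
exact: sum_mul_le_normz.
Qed.

Lemma normz_nrm1 z : normz z <= nrm1 z.
Proof.
apply: ler_normz; first exact: nrm1_ge0.
rewrite sqr_normz expr2 {2}/nrm1 mulr_sumr; apply: ler_sum => j _.
by rewrite expr2; apply: ler_wpM2r; [exact: cabs_ge0|exact: cabs_nrm1].
Qed.

Lemma Bn_nrm1 z w : nrm1 (w - z) < 1 - normz z -> Bn w.
Proof.
rewrite /Bn/= => h; rewrite -[w](subrK z).
apply: le_lt_trans (normzD _ _) _; have := normz_nrm1 (w - z); lra.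
Qed.

Definition ip z a : C := \sum_(j < n) z 0 j * (a 0 j)^*%C.

Lemma cabs_conj (c : C) : cabs c^*%C = cabs c.
Proof. by case: c => x y; rewrite /cabs/= sqrrN. Qed.

Lemma cabs_ip z a : cabs (ip z a) <= normz z * normz a.
Proof.
apply: le_trans (cabs_sum _) _; apply: le_trans (sum_mul_le_normz z a).
by apply: ler_sum => j _; rewrite cabsM cabs_conj.
Qed.

Lemma ip_self z : ip z z = ((normz z ^+ 2)%:C)%C.
Proof.
rewrite sqr_normz rmorph_sum/=; apply: eq_bigr => j _.
by rewrite sqr_cabs add_Re2_Im2 sqr_normc.
Qed.

End EuclideanNorm.

(** * A Taylor criterion for holomorphy that passes to limits *)

Section QuadraticCriterion.
Variables (R : realType) (n : nat).
Local Notation C := (R[i]).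
Local Notation Cn := ('rV[R[i]]_n).
Implicit Types (z w l : Cn) (f : Cn -> C^o) (D : 'I_n -> C).
Local Notation ee k := (delta_mx 0 k : Cn).

Definition dquo f (s : R) z k : C := (f (z + (s%:C)%C *: ee k) - f z) / (s%:C)%C.

(* The linear part is given by difference quotients instead of derivatives, so
   that this form of a quadratic Taylor bound survives pointwise limits. *)
Definition quad f z (r K : R) := forall l (s : R), nrm1 l <= r -> 0 < s <= r ->
  cabs (f (z + l) - f z - \sum_k l 0 k * dquo f s z k) <= K * (nrm1 l ^+ 2 + nrm1 l * s).

(** The intervals of centre [x i] and radius [e i] meet pairwise, so the supremum of their left ends
    lies in all of them. *)
Lemma real_nested (x e : nat -> R) : (forall i j, x i - e i <= x j + e j) ->
  exists d, forall i, `|x i - d| <= e i.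
Proof.
move=> H; pose A := range (fun i => x i - e i).
have hs : has_sup A.
  by split; [exists (x 0%N - e 0%N), 0%N|exists (x 0%N + e 0%N) => _ [i _ <-]].
exists (sup A) => i; rewrite distrC ler_distl; apply/andP; split.
  by apply: ub_le_sup; [case: hs|exists i].
by apply: ge_sup; [case: hs|move=> _ [j _ <-]].
Qed.

Lemma complex_nested (x : nat -> C) (e : nat -> R) :
  (forall i j, cabs (x i - x j) <= e i + e j) -> exists d, forall i, cabs (x i - d) <= 2 * e i.
Proof.
move=> H.
have [a ha] : exists a, forall i, `|complex.Re (x i) - a| <= e i.
  apply: real_nested => i j; have := le_trans (ler_Re_cabs _) (H i j).
  by rewrite ReD ReN ler_norml => /andP[]; lra.
have [b hb] : exists a, forall i, `|complex.Im (x i) - a| <= e i.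
  apply: real_nested => i j; have := le_trans (ler_Im_cabs _) (H i j).
  by rewrite ImD ImN ler_norml => /andP[]; lra.
exists (Complex a b) => i; apply: le_trans (cabs_le_ReIm _) _.
by rewrite ReD ImD ReN ImN/= mulr_natl mulr2n lerD.
Qed.

(** Inserting a displacement of length s_i along a coordinate axis and the step s_j into the bound
    shows that the difference quotients are Cauchy with rate K s. Their limits are the partial
    derivatives, and the bound survives with quotients replaced by limits. *)
Lemma quad_fdiff f z r K : 0 < r -> 0 <= K -> quad f z r K -> exists D, fdiff f z D.
Proof.
move=> r0 K0 Q; pose s (j : nat) := r / j.+1%:R.
have s0 j : 0 < s j <= r.
  by rewrite divr_gt0//= ler_pdivrMr// -[leLHS]mulr1 ler_pM2l// ler1n.
have q k i j : cabs (dquo f (s i) z k - dquo f (s j) z k) <= K * s i + K * s j.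
  have /andP[si0 sir] := s0 i.
  have N : nrm1 ((s i)%:C%C *: ee k) = s i by rewrite nrm1Z nrm1_delta mulr1 cabsE_real gtr0_norm.
  have := Q ((s i)%:C%C *: ee k) (s j); rewrite N => /(_ sir (s0 j)).
  rewrite (bigD1 k)//= big1 => [|m mk]; last first.
    by rewrite !mxE eqxx (negbTE mk) mulr0 mul0r.
  rewrite addr0 !mxE !eqxx mulr1.
  have si : (s i)%:C%C != 0 :> C by rewrite -cabs_gt0 cabsE_real gtr0_norm.
  rewrite (_ : _ - _ = (s i)%:C%C * (dquo f (s i) z k - dquo f (s j) z k)); last first.
    by rewrite mulrBr {2}/dquo [X in _ = X - _]mulrC divfK.
  rewrite cabsM cabsE_real gtr0_norm// (_ : K * (_ + _) = s i * (K * s i + K * s j)); last by ring.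
  by rewrite ler_pM2l.
have /choice[D hD] : forall k, exists d, forall i, cabs (dquo f (s i) z k - d) <= 2 * (K * s i).
  by move=> k; apply: complex_nested => i j; exact: q.
exists D => e e0.
have K1 : 0 < K + 1 by rewrite ltr_wpDl.
exists (Num.min r (e / (K + 1))); first by rewrite lt_min r0 divr_gt0.
move=> w; rewrite lt_min => /andP[w1 w2]; set l := w - z in w1 w2 *.
have wE : w = z + l by rewrite /l subrKC.
have l0 := nrm1_ge0 l.
suff H : cabs (f w - f z - \sum_k l 0 k * D k) <= K * nrm1 l ^+ 2.
  apply: le_trans H _; rewrite expr2 mulrA; apply: ler_wpM2r => //.
  apply: le_trans (_ : (K + 1) * nrm1 l <= _); first by apply: ler_wpM2r; rewrite // lerDl.
  by rewrite mulrC -ler_pdivlMr// ltW.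
(* The error from replacing quotients by their limits is linear in the step [s j] and disappears as
   j grows. *)
have B j : cabs (f w - f z - \sum_k l 0 k * D k) <= K * nrm1 l ^+ 2 + 3 * K * nrm1 l * s j.
  rewrite -(subrK (\sum_k l 0 k * dquo f (s j) z k) (f w - f z)) -addrA -sumrB.
  apply: le_trans (cabsD _ _) _.
  rewrite (_ : _ + _ * s j = K * (nrm1 l ^+ 2 + nrm1 l * s j) + nrm1 l * (2 * (K * s j))); last by ring.
  apply: lerD; first by rewrite wE; apply: Q; rewrite ?s0// ltW.
  apply: le_trans (cabs_sum _) _; rewrite /nrm1 mulr_suml; apply: ler_sum => k _.
  by rewrite -mulrBr cabsM; apply: ler_wpM2l; [exact: cabs_ge0|exact: hD].
apply/ler_addgt0Pr => t t0.
pose A := 3 * K * nrm1 l * r; have A0 : 0 <= A by rewrite !mulr_ge0// ltW.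
apply: le_trans (B (Num.bound (A / t))) _; rewrite lerD2l /s mulrA -/A.
rewrite ler_pdivrMr// mulrC -ler_pdivrMr//.
by apply/ltW/(lt_trans (archi_boundP _)); rewrite ?divr_ge0// ?ltW// ltr_nat.
Qed.

(** One-variable Taylor along z + x v with |v| = 1 in the sum norm, used twice: for v = l/|l| and
    for the coordinate directions, which compare the quotients with the derivatives. *)
Lemma fdiff_quad f z (r M : R) : 0 < r ->
  (forall w, nrm1 (w - z) < r -> exists D, fdiff f w D) ->
  (forall w, nrm1 (w - z) < r -> cabs (f w) <= M) ->
  quad f z (r / 4) (2 * (64 * (128 * M / r) / (r / 4))).
Proof.
move=> r0 df fM l s lr /andP[s0 sr]; set K := (2 * _).
have /choice[D hD] : forall w, exists D, nrm1 (w - z) < r -> fdiff f w D.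
  move=> w; case: (ltP (nrm1 (w - z)) r) => [/df[D h]|_]; first by exists D.
  by exists (fun=> 0).
have T v (t : R) : nrm1 v = 1 -> 0 <= t <= r / 4 ->
    cabs (f (z + t%:C%C *: v) - f z - t%:C%C * \sum_k v 0 k * D z k) <= K * t ^+ 2.
  move=> v1 /andP[t0 tr].
  have In (x : C) : cabs (x - 0) < r -> nrm1 (z + x *: v - z) < r.
    by rewrite subr0 [z + _]addrC addrK nrm1Z v1 mulr1.
  have := @holo_taylor R (fun x : C => f (z + x *: v))
    (fun x => \sum_k v 0 k * D (z + x *: v) k) 0 r M r0 _ _ (t%:C)%C.
  rewrite !subr0 cabsE_real ger0_norm// scale0r addr0 [_ * (t%:C)%C]mulrC; apply => //.
    by move=> x xr; apply: fdiff_line; apply: hD; exact: In.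
  by move=> x xr; apply: fM; exact: In.
have d0 : fdiff f z (D z) by apply: hD; rewrite subrr nrm10.
have S1 : cabs (f (z + l) - f z - \sum_k l 0 k * D z k) <= K * nrm1 l ^+ 2.
  have [l0|l0] := eqVneq (nrm1 l) 0.
    have lk k : l 0 k = 0.
      by apply/eqP; rewrite -cabs_eq0 eq_le cabs_ge0 andbT -l0 cabs_nrm1.
    have -> : l = 0 by apply/rowP => k; rewrite mxE lk.
    rewrite addr0 subrr sub0r cabsN big1 ?cabs0 ?nrm10 ?expr0n ?mulr0// => k _.
    by rewrite mxE mul0r.
  have lp : 0 < nrm1 l by rewrite lt_neqAle eq_sym l0 nrm1_ge0.
  have lC : (nrm1 l)%:C%C != 0 :> C by rewrite -cabs_gt0 cabsE_real gtr0_norm.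
  have := T ((nrm1 l)%:C%C^-1 *: l) (nrm1 l).
  rewrite nrm1Z cabsV cabsE_real gtr0_norm// mulVf// scalerA divff// scale1r.
  rewrite lr ltW// => /(_ erefl isT).
  rewrite mulr_sumr (eq_bigr (fun k => l 0 k * D z k))// => k _.
  by rewrite mxE !mulrA divff// mul1r.
have S2 k : cabs (dquo f s z k - D z k) <= K * s.
  have := T (ee k) s (nrm1_delta _ k); rewrite sr ltW// => /(_ isT).
  rewrite (bigD1 k)//= big1 => [|m mk]; last by rewrite mxE eqxx (negbTE mk) mul0r.
  rewrite addr0 mxE !eqxx mul1r.
  have sC : s%:C%C != 0 :> C by rewrite -cabs_gt0 cabsE_real gtr0_norm.
  rewrite (_ : _ - _ = s%:C%C * (dquo f s z k - D z k)); last first.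
    by rewrite mulrBr /dquo [X in _ = X - _]mulrC divfK.
  by rewrite cabsM cabsE_real gtr0_norm// expr2 mulrCA ler_pM2l.
rewrite -(subrK (\sum_k l 0 k * D z k) (f (z + l) - f z)) -addrA -sumrB mulrDr.
apply: le_trans (cabsD _ _) _; apply: lerD => //.
apply: le_trans (cabs_sum _) _; rewrite mulrCA /nrm1 mulr_suml; apply: ler_sum => k _.
by rewrite -mulrBr cabsM; apply: ler_wpM2l; [exact: cabs_ge0|rewrite -cabsN opprB].
Qed.

(** For fixed l and s the bound involves only the values at z, z + l and the n points z + s e_k, so
    pointwise convergence suffices. The filter is arbitrary because both [\oo] and an ultrafilter
    are used later. *)
Lemma quad_lim (I : Type) (F : set_system I) {FF : ProperFilter F} (fj : I -> Cn -> C^o) f z r K :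
  (\forall j \near F, quad (fj j) z r K) ->
  (forall w, nrm1 (w - z) <= r -> forall e : R, 0 < e -> \forall j \near F, cabs (fj j w - f w) <= e) ->
  quad f z r K.
Proof.
move=> Q lim l s lr /andP[s0 sr].
apply/ler_addgt0Pr => t t0.
pose A := 2 + \sum_(k < n) cabs (l 0 k) * (2 / s).
have A0 : 0 < A.
  by rewrite ltr_wpDr// sumr_ge0// => k _; rewrite mulr_ge0 ?cabs_ge0 ?divr_ge0// ltW.
have tA : 0 < t / A by rewrite divr_gt0.
have N0 : nrm1 (z - z) <= r by rewrite subrr nrm10; lra.
have Nl : nrm1 (z + l - z) <= r by rewrite addrC addKr.
have Nk k : nrm1 (z + s%:C%C *: ee k - z) <= r.
  by rewrite addrC addKr nrm1Z nrm1_delta mulr1 cabsE_real gtr0_norm.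
have hkF : \forall j \near F, forall k,
    cabs (fj j (z + s%:C%C *: ee k) - f (z + s%:C%C *: ee k)) <= t / A.
  by apply: filter_forall => k; exact: lim.
have [j [[Qj h0] [hl hk]]] :=
  filter_ex (filterI (filterI Q (lim _ N0 _ tA)) (filterI (lim _ Nl _ tA) hkF)).
have := Qj l s lr; rewrite s0 sr => /(_ isT) B.
set X := fj j (z + l) - _ - _ in B.
rewrite -[_ - _ - _](subrK X); apply: le_trans (cabsD _ _) _.
rewrite addrC; apply: lerD => //.
have dq k : cabs (dquo (fj j) s z k - dquo f s z k) <= 2 / s * (t / A).
  rewrite /dquo -mulrBl cabsM cabsV cabsE_real gtr0_norm// mulrC ler_pdivrMl//.
  rewrite [leRHS](_ : _ = t / A + t / A); last by field; rewrite !gt_eqF.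
  rewrite (_ : _ - _ = (fj j (z + s%:C%C *: ee k) - f (z + s%:C%C *: ee k)) - (fj j z - f z)); last by ring.
  by apply: le_trans (cabsD _ _) _; rewrite cabsN lerD.
rewrite (_ : _ - X = - (fj j (z + l) - f (z + l)) + (fj j z - f z) +
    \sum_k l 0 k * (dquo (fj j) s z k - dquo f s z k)); last first.
  under [in RHS]eq_bigr do rewrite mulrBr; rewrite sumrB /X.
  have E (a b c d x y : C) : a - b - x - (c - d - y) = - (c - a) + (d - b) + (y - x) by ring.
  exact: E.
apply: le_trans (cabsD _ _) _.
rewrite [leRHS](_ : t = t / A + t / A + \sum_(k < n) cabs (l 0 k) * (2 / s * (t / A))); last first.
  transitivity (A * (t / A)); first by rewrite mulrC divfK ?gt_eqF.
  rewrite {1}/A mulrDl mulr_natl mulr2n mulr_suml; congr (_ + _).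
  by apply: eq_bigr => k _; rewrite -mulrA.
apply: lerD; first by apply: le_trans (cabsD _ _) _; rewrite cabsN lerD.
apply: le_trans (cabs_sum _) _; apply: ler_sum => k _.
by rewrite cabsM; apply: ler_wpM2l; [exact: cabs_ge0|exact: dq].
Qed.

End QuadraticCriterion.

Section HolomorphicFunctions.
Variables (R : realType) (n : nat).
Local Notation C := (R[i]).
Local Notation Cn := ('rV[R[i]]_n).
Implicit Types (z w l : Cn) (f g : Cn -> C^o) (D : 'I_n -> C).
Local Notation ee k := (delta_mx 0 k : Cn).

Lemma taylor_constant_ge0 (M r : R) : 0 <= M -> 0 < r ->
  0 <= 2 * (64 * (128 * M / r) / (r / 4)).
Proof.
move=> M0 /ltW r0; have h : 0 <= 128 * M / r by apply: divr_ge0 => //; exact: mulr_ge0.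
by apply: mulr_ge0 => //; apply: divr_ge0; [exact: mulr_ge0|exact: divr_ge0].
Qed.

Lemma holo_of_fdiff f : (forall z, Bn z -> exists D, fdiff f z D) -> holo f.
Proof. by move=> H z /H[D /fdiff_diff[]]. Qed.

Lemma fdiff_shift f a z D : fdiff f (z + a) D -> fdiff (fun w => f (w + a)) z D.
Proof.
move=> df e e0; have [d d0 H] := df e e0; exists d => // w wz.
by have := H (w + a); rewrite opprD addrACA subrr addr0; apply.
Qed.

Lemma fdiff_dquo f (s : R) z k D E : fdiff f z D -> fdiff f (z + s%:C%C *: ee k) E -> 0 < s ->
  exists D', fdiff (fun w => dquo f s w k : C^o) z D'.
Proof.
move=> df dg s0; exists (fun j => (E j - D j) / s%:C%C) => e e0.
have [|d d0 H] := df (e * s / 2); first by rewrite divr_gt0 ?mulr_gt0.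
have [|r r0 G] := fdiff_shift dg (e := e * s / 2); first by rewrite divr_gt0 ?mulr_gt0.
exists (Num.min d r); first by rewrite lt_min d0.
move=> w; rewrite lt_min => /andP[/H hw /G gw].
have sC : s%:C%C != 0 :> C by rewrite -cabs_gt0 cabsE_real gtr0_norm.
have E1 (a b c b' x y : C) : (a - b) / s%:C%C - (c - b') / s%:C%C - (x - y) / s%:C%C =
  ((a - c - x) - (b - b' - y)) / s%:C%C by ring.
rewrite (_ : \sum_k _ = (\sum_k (w - z) 0 k * E k - \sum_k (w - z) 0 k * D k) / s%:C%C); last first.
  by rewrite -sumrB mulr_suml; apply: eq_bigr => j _; rewrite -mulrBr mulrA.
rewrite /dquo E1 cabsM cabsV cabsE_real gtr0_norm// ler_pdivrMr//.
apply: le_trans (cabsD _ _) _; rewrite cabsN.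
rewrite (_ : e * _ * s = e * s / 2 * nrm1 (w - z) + e * s / 2 * nrm1 (w - z)); last by field.
by rewrite lerD.
Qed.

Section LocalBounds.
Variables (f : Cn -> C^o) (z : Cn) (r M : R).
Hypotheses (r0 : 0 < r) (df : forall w, nrm1 (w - z) < r -> exists D, fdiff f w D)
  (fM : forall w, nrm1 (w - z) < r -> cabs (f w) <= M).

Lemma fdiff_lip_bound w : nrm1 (w - z) <= r / 2 -> cabs (f w - f z) <= 128 * M / r * nrm1 (w - z).
Proof.
move=> wr; have [l0|l0] := eqVneq (nrm1 (w - z)) 0.
  have lk k : (w - z) 0 k = 0.
    by apply/eqP; rewrite -cabs_eq0 eq_le cabs_ge0 andbT -l0 cabs_nrm1.
  have -> : w = z by apply/rowP => k; have := lk k; rewrite !mxE => /eqP; rewrite subr_eq0 => /eqP.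
  by rewrite !subrr cabs0 nrm10 mulr0.
have lp : 0 < nrm1 (w - z) by rewrite lt_neqAle eq_sym l0 nrm1_ge0.
have lC : (nrm1 (w - z))%:C%C != 0 :> C by rewrite -cabs_gt0 cabsE_real gtr0_norm.
pose v := (nrm1 (w - z))%:C%C^-1 *: (w - z).
have v1 : nrm1 v = 1 by rewrite nrm1Z cabsV cabsE_real gtr0_norm// mulVf.
have In (x : C) : cabs (x - 0) < r -> nrm1 (z + x *: v - z) < r.
  by rewrite subr0 [z + _]addrC addrK nrm1Z v1 mulr1.
have /choice[D hD] : forall w, exists D, nrm1 (w - z) < r -> fdiff f w D.
  move=> w'; case: (ltP (nrm1 (w' - z)) r) => [/df[D h]|_]; first by exists D.
  by exists (fun=> 0).
have := @holo_lip R (fun x : C => f (z + x *: v))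
    (fun x => \sum_k v 0 k * D (z + x *: v) k) 0 r M r0 _ _ 0 (nrm1 (w - z))%:C%C.
rewrite !subr0 cabs0 cabsE_real gtr0_norm// scale0r addr0 scalerA divff// scale1r.
rewrite [z + (w - z)]addrC subrK; apply => //.
- by move=> x xr; apply: fdiff_line; apply: hD; exact: In.
- by move=> x xr; apply: fM; exact: In.
- by rewrite divr_ge0// ltW.
Qed.

End LocalBounds.

Lemma holo_locally_bounded f z : holo f -> Bn z -> exists r M : R,
  [/\ 0 < r, r <= 1 - normz z & forall w, nrm1 (w - z) < r -> cabs (f w) <= M].
Proof.
move=> hf Bz; have [d d0 H] := fdiff_cont (holo_fdiff hf Bz) ltr01.
have B0 : 0 < 1 - normz z by rewrite subr_gt0.
exists (Num.min d (1 - normz z)), (cabs (f z) + 1); split.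
- by rewrite lt_min d0.
- by rewrite ge_min lexx orbT.
move=> w; rewrite lt_min => /andP[/H h _].
by rewrite -(subrK (f z) (f w)) addrC; apply: le_trans (cabsD _ _) _; rewrite lerD2l.
Qed.

(** A local bound uniform in j gives Taylor constants uniform in j, and these pass to the limit. *)
Lemma holo_pointwise_lim (I : Type) (F : set_system I) {FF : ProperFilter F}
    (fj : I -> Cn -> C^o) f :
  (forall j, holo (fj j)) ->
  (forall z, Bn z -> exists r M : R, 0 < r /\ forall j w, nrm1 (w - z) < r -> cabs (fj j w) <= M) ->
  (forall z, Bn z -> forall e : R, 0 < e -> \forall j \near F, cabs (fj j z - f z) <= e) ->
  holo f.
Proof.
move=> hf bd lim; apply: holo_of_fdiff => z Bz.
have [r [M [r0 rM]]] := bd z Bz.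
have B0 : 0 < 1 - normz z by rewrite subr_gt0.
pose s := Num.min r (1 - normz z).
have s0 : 0 < s by rewrite lt_min r0.
have InB w : nrm1 (w - z) < s -> Bn w.
  by rewrite lt_min => /andP[_]; exact: Bn_nrm1.
have Q j : quad (fj j) z (s / 4) (2 * (64 * (128 * M / s) / (s / 4))).
  apply: fdiff_quad => // w ws.
    by exists (dgrad (fj j) w); apply: holo_fdiff => //; exact: InB.
  by apply: rM; move: ws; rewrite lt_min => /andP[].
have [j0 _] := filter_ex (@filterT _ F _).
have M0 : 0 <= M by apply: le_trans (cabs_ge0 _) (rM j0 z _); rewrite subrr nrm10.
apply: (@quad_fdiff _ _ f z (s / 4) (2 * (64 * (128 * M / s) / (s / 4)))).
- by rewrite divr_gt0.
- exact: taylor_constant_ge0.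
apply: (quad_lim (F := F) (fj := fj)); first exact: nearW.
move=> w ws; apply: lim; apply: InB; lra.
Qed.

(** Near z the partial derivative is the pointwise limit of difference quotients. These are
    differentiable and bounded by the local Lipschitz constant of f, so their common quadratic
    Taylor bound passes to the limit. *)
Lemma holo_dgrad f k : holo f -> holo (fun z => dgrad f z k : C^o).
Proof.
move=> hf; apply: holo_of_fdiff => z Bz.
have [r [M [r0 rB rM]]] := holo_locally_bounded hf Bz.
have InB w : nrm1 (w - z) < r -> Bn w by move=> h; apply: (@Bn_nrm1 _ _ z); lra.
have dF w : nrm1 (w - z) < r -> fdiff f w (dgrad f w) by move=> /InB; exact: holo_fdiff.
have M0 : 0 <= M by apply: le_trans (cabs_ge0 _) (rM z _); rewrite subrr nrm10.
pose s j : R := r / 4 / j.+1%:R.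
have s0 j : 0 < s j by rewrite !divr_gt0.
have sr j : s j <= r / 4.
  by rewrite ler_pdivrMr// -[leLHS]mulr1 ler_pM2l ?divr_gt0// ler1n.
have Nk w j : nrm1 (w + (s j)%:C%C *: ee k - w) = s j.
  by rewrite addrC addKr nrm1Z nrm1_delta mulr1 cabsE_real gtr0_norm.
have In w v : nrm1 (w - z) < r / 2 -> nrm1 (v - w) < r / 2 -> nrm1 (v - z) < r.
  by move=> h1 h2; have := nrm1D (v - w) (w - z); rewrite addrA subrK; lra.
have r2 : 0 < r / 2 by rewrite divr_gt0.
pose G j w : C^o := dquo f (s j) w k.
have dG j w : nrm1 (w - z) < r / 2 -> exists D, fdiff (G j) w D.
  move=> wz; apply: fdiff_dquo => //; apply: dF; first lra.
  by apply: In wz _; rewrite Nk; have := sr j; lra.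
have bG j w : nrm1 (w - z) < r / 2 -> cabs (G j w) <= 128 * M / (r / 2).
  move=> wz; have sC : (s j)%:C%C != 0 :> C by rewrite -cabs_gt0 cabsE_real gtr0_norm.
  rewrite cabsM cabsV cabsE_real gtr0_norm// ler_pdivrMr//.
  rewrite -[X in _ * X](Nk w j); apply: fdiff_lip_bound => //.
  - by move=> v vw; exists (dgrad f v); apply: dF; exact: In vw.
  - by move=> v vw; apply: rM; exact: In vw.
  - by rewrite Nk; have := sr j; lra.
have Q j := fdiff_quad r2 (dG j) (bG j).
apply: (@quad_fdiff _ _ _ z (r / 2 / 4)
   (2 * (64 * (128 * (128 * M / (r / 2)) / (r / 2)) / (r / 2 / 4)))).
- by rewrite !divr_gt0.
- by apply: taylor_constant_ge0 => //; apply: divr_ge0; [exact: mulr_ge0|exact: ltW].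
apply: (quad_lim (F := \oo) (fj := G)); first exact: nearW.
move=> w ws e e0; have wr : nrm1 (w - z) < r by lra.
have [d d0 H] := dF w wr e e0.
exists (Num.bound (r / 4 / d)) => // j /= jd.
have sd : s j < d.
  rewrite ltr_pdivrMr// [ltRHS]mulrC -ltr_pdivrMr//.
  apply: lt_le_trans (archi_boundP _) _; first by rewrite ltW// !divr_gt0.
  by rewrite ler_nat leqW.
have sC : (s j)%:C%C != 0 :> C by rewrite -cabs_gt0 cabsE_real gtr0_norm.
have := H (w + (s j)%:C%C *: ee k); rewrite Nk => /(_ sd).
rewrite (bigD1 k)//= big1 => [|m mk]; last by rewrite !mxE eqxx (negbTE mk) !mulr0 addrAC subrr add0r mul0r.
rewrite !mxE !eqxx mulr1 addr0 [w 0 k + _]addrC addrK => h.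
have E (a : C) : a / (s j)%:C%C - dgrad f w k = (a - (s j)%:C%C * dgrad f w k) / (s j)%:C%C.
  by rewrite mulrBl [(s j)%:C%C * _]mulrC mulfK.
by rewrite /G /dquo E cabsM cabsV cabsE_real gtr0_norm// ler_pdivrMr.
Qed.

Lemma holoD f g : holo f -> holo g -> holo (fun z => f z + g z : C^o).
Proof. by move=> hf hg z Bz; exact: differentiableD (hf z Bz) (hg z Bz). Qed.

Lemma holoM f g : holo f -> holo g -> holo (fun z => f z * g z : C^o).
Proof. by move=> hf hg z Bz; exact: differentiableM (hf z Bz) (hg z Bz). Qed.

Lemma holo_cst (c : C) : holo (fun _ : Cn => c : C^o).
Proof. by move=> z Bz; exact: differentiable_cst. Qed.

Lemma holo_coord k : holo (fun z => z 0 k : C^o).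
Proof.
apply: holo_of_fdiff => z _; exists (fun j => (j == k)%:R) => e e0; exists 1 => // w _.
rewrite (bigD1 k)//= big1 => [|j jk]; last by rewrite (negbTE jk) mulr0.
rewrite eqxx mulr1 addr0 !mxE subrr cabs0; apply: mulr_ge0; first exact: ltW.
exact: nrm1_ge0.
Qed.

Lemma holo_sum (I : Type) (s : seq I) (F : I -> Cn -> C^o) : (forall k, holo (F k)) ->
  holo (fun z => \sum_(k <- s) F k z : C^o).
Proof.
move=> hF; elim: s => [|k s IH].
  by rewrite (_ : (fun z => _) = (fun _ => 0)); [exact: holo_cst|apply/funext => z; rewrite big_nil].
rewrite (_ : (fun z => _) = (fun z => F k z + \sum_(k <- s) F k z)); first exact: holoD.
by apply/funext => z; rewrite big_cons.
Qed.

Lemma holoX f m : holo f -> holo (fun z => f z ^+ m : C^o).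
Proof.
move=> hf; elim: m => [|m IH]; first exact: holo_cst.
rewrite (_ : (fun z => _) = (fun z => f z * f z ^+ m)); first exact: holoM.
by apply/funext => z; rewrite exprS.
Qed.

Lemma holo_Rder f : holo f -> holo (Rder f : Cn -> C^o).
Proof.
move=> hf; apply: (@holo_sum _ _ (fun k z => z 0 k * dgrad f z k : C^o)) => k.
by apply: holoM; [exact: holo_coord|exact: holo_dgrad].
Qed.

Lemma holo_scale f (l : C) : cabs l <= 1 -> holo f -> holo (fun z => f (l *: z) : C^o).
Proof.
move=> l1 hf; apply: holo_of_fdiff => z Bz.
have Blz : Bn (l *: z).
  rewrite /Bn/= normzZ; apply: le_lt_trans Bz.
  by rewrite -[leRHS]mul1r; apply: ler_wpM2r => //; exact: normz_ge0.
exists (fun k => l * dgrad f (l *: z) k) => e e0.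
have [d d0 H] := holo_fdiff hf Blz e0; exists d => // w wd.
have N : nrm1 (l *: w - l *: z) <= nrm1 (w - z).
  by rewrite -scalerBr nrm1Z -[leRHS]mul1r; apply: ler_wpM2r => //; exact: nrm1_ge0.
have := H (l *: w) (le_lt_trans N wd).
rewrite (eq_bigr (fun k => (w - z) 0 k * (l * dgrad f (l *: z) k))) => [h|k _]; last first.
  by rewrite !mxE; ring.
by apply: le_trans h _; rewrite ler_pM2l.
Qed.

Lemma holo_ip a : holo (fun z => ip z a : C^o).
Proof.
apply: (@holo_sum _ _ (fun k z => z 0 k * (a 0 k)^*%C : C^o)) => k.
by apply: holoM; [exact: holo_coord|exact: holo_cst].
Qed.

End HolomorphicFunctions.

(** * Iterated Lebesgue integrals *)

Section RealIntegrals.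
Variable R : realType.
Local Notation mu := (@lebesgue_measure R).
Local Notation mR := (measurableTypeR R).
Local Open Scope ereal_scope.

(** The integral of a nonnegative function is a supremum over simple functions below it, so
    monotonicity holds without any measurability; this spares such obligations in all later
    comparisons. *)
Lemma le_integral_nneg d (T : measurableType d) (m : {measure set T -> \bar R}) (f g : T -> \bar R) :
  (forall x, 0 <= f x) -> (forall x, f x <= g x) -> \int[m]_x f x <= \int[m]_x g x.
Proof.
move=> f0 fg; have g0 x : 0 <= g x by exact: le_trans (fg x).
rewrite !ge0_integralTE//; apply: le_ereal_sup => _ /= [h hf <-]; exists h => // x.
exact: le_trans (hf x) (fg x).
Qed.

Lemma measurable_affine (a b : R) : measurable_fun setT (fun x : mR => (a * x + b)%R : mR).
Proof. by apply: measurable_funD => //; apply: measurable_funM. Qed.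

(** The rescaled image of Lebesgue measure under the affine map agrees with Lebesgue measure on
    half-open intervals, hence everywhere by uniqueness. *)
Lemma lebesgue_measure_affine (a b : R) (A : set mR) : (a != 0)%R -> measurable A ->
  mu A = `|a|%:E * mu ((fun x => a * x + b)%R @^-1` A).
Proof.
move=> a0 mA; pose phi := (fun x : mR => (a * x + b)%R : mR).
have mphi : measurable_fun setT phi by exact: measurable_affine.
have a1 : (0 < `|a|)%R by rewrite normr_gt0.
pose m0 : {measure set mR -> \bar R} := measure_function_pushforward__canonical__measure_function_Measure mu mphi.
pose m : {measure set mR -> \bar R} := mscale (NngNum (ltW a1)) m0.
rewrite (_ : _ * _ = m A) //; apply: lebesgue_measure_unique => // X.
move=> /ocitvP[->|[[c d] /= cd ->]]; first by rewrite !measure0.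
have -> : m `]c, d]%classic = `|a|%:E * mu ((fun x => a * x + b)%R @^-1` `]c, d]%classic) by [].
rewrite lebesgue_measure_itv/= lte_fin cd -EFinD.
have [ap|an|/eqP] := ltgtP 0%R a; last by rewrite eq_sym (negbTE a0).
  rewrite (_ : _ @^-1` _ = `]((c - b) / a)%R, ((d - b) / a)%R]%classic); last first.
    apply/seteqP; split => x /=; rewrite !in_itv/= ltr_pdivrMr// ler_pdivlMr// ltrBlDr lerBrDr mulrC//.
  rewrite lebesgue_measure_itv/= lte_fin ltr_pM2r ?invr_gt0// ltrD2r cd -EFinD -EFinM gtr0_norm//.
  by congr EFin; field; rewrite gt_eqF.
rewrite (_ : _ @^-1` _ = `[((d - b) / a)%R, ((c - b) / a)%R[%classic); last first.
  by apply/seteqP; split => x /=; rewrite !in_itv/= ler_ndivrMr// ltr_ndivlMr// ltrBlDr lerBrDr mulrC andbC.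
rewrite lebesgue_measure_itv/= lte_fin ltr_nM2r ?invr_lt0// ltrD2r cd -EFinD -EFinM ltr0_norm//.
by congr EFin; field; rewrite lt_eqF.
Qed.

Lemma integral_affine (a b : R) (f : mR -> \bar R) : (a != 0)%R -> measurable_fun setT f ->
  (forall x, 0 <= f x) -> \int[mu]_x f x = `|a|%:E * \int[mu]_x f (a * x + b)%R.
Proof.
move=> a0 mf f0; pose phi := (fun x : mR => (a * x + b)%R : mR).
have mphi : measurable_fun setT phi by exact: measurable_affine.
have a1 : (0 < `|a|)%R by rewrite normr_gt0.
pose m0 : {measure set mR -> \bar R} := measure_function_pushforward__canonical__measure_function_Measure mu mphi.
pose m : {measure set mR -> \bar R} := mscale (NngNum (ltW a1)) m0.
have E : \int[mu]_x f x = \int[m]_x f x.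
  by apply: eq_measure_integral => A mA _; exact: (lebesgue_measure_affine b a0 mA).
by rewrite E ge0_integral_mscale// ge0_integral_pushforward.
Qed.

End RealIntegrals.

Section ComplexIntegral.
Variable R : realType.
Local Notation C := (R[i]).
Local Notation mu := (@lebesgue_measure R).
Local Notation mR := (measurableTypeR R).
Local Open Scope ereal_scope.
Implicit Types h : C -> \bar R.

Definition cmeas h := measurable_fun setT (fun xy : mR * mR => h (Complex xy.1 xy.2)).

Lemma cmeas_inner h : cmeas h -> forall x : R, measurable_fun setT (fun y : mR => h (Complex x y)).
Proof. by move=> mh x; exact: measurableT_comp mh (pair1_measurable _). Qed.

Lemma cmeas_outer h : cmeas h -> (forall c, 0 <= h c) ->
  measurable_fun setT (fun x : mR => \int[mu]_y h (Complex x y)).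
Proof.
by move=> mh h0; apply: (measurable_fun_fubini_tonelli_F (m2 := mu) (fun xy : mR * mR => h (Complex xy.1 xy.2))).
Qed.

Lemma cmeas_outer_swap h : cmeas h -> (forall c, 0 <= h c) ->
  measurable_fun setT (fun y : mR => \int[mu]_x h (Complex x y)).
Proof.
move=> mh h0; apply: (measurable_fun_fubini_tonelli_F (m2 := mu) (fun xy : mR * mR => h (Complex xy.2 xy.1))) => //.
apply: (measurableT_comp (f := fun xy : mR * mR => h (Complex xy.1 xy.2)) (g := fun xy : mR * mR => (xy.2, xy.1))) => //.
exact: measurable_fun_pair.
Qed.

Lemma cint_swap h : cmeas h -> (forall c, 0 <= h c) ->
  cint h = \int[mu]_y \int[mu]_x h (Complex x y).
Proof.
by move=> mh h0; apply: (fubini_tonelli (m1 := mu) (m2 := mu) (fun xy : mR * mR => h (Complex xy.1 xy.2))).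
Qed.

Lemma cint_ge0 h : (forall c, 0 <= h c) -> 0 <= cint h.
Proof. by move=> h0; apply: integral_ge0 => x _; apply: integral_ge0. Qed.

Lemma le_cint h k : (forall c, 0 <= h c) -> (forall c, h c <= k c) -> cint h <= cint k.
Proof.
move=> h0 hk; apply: le_integral_nneg => x; first exact: integral_ge0.
exact: le_integral_nneg.
Qed.

Lemma eq_cint h k : (forall c, h c = k c) -> cint h = cint k.
Proof. by move=> hk; congr cint; apply/funext. Qed.

Lemma cintD h k : cmeas h -> cmeas k -> (forall c, 0 <= h c) -> (forall c, 0 <= k c) ->
  cint (fun c => h c + k c) = cint h + cint k.
Proof.
move=> mh mk h0 k0; rewrite /cint.
under eq_integral => x _.
  rewrite ge0_integralD//; [|exact: cmeas_inner|exact: cmeas_inner].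
  over.
rewrite ge0_integralD//; [by move=> x _; exact: integral_ge0|exact: cmeas_outer|
  by move=> x _; exact: integral_ge0|exact: cmeas_outer].
Qed.

Lemma cintZ h (k : R) : cmeas h -> (forall c, 0 <= h c) -> (0 <= k)%R ->
  cint (fun c => k%:E * h c) = k%:E * cint h.
Proof.
move=> mh h0 k0; rewrite /cint.
under eq_integral => x _.
  rewrite ge0_integralZl_EFin//; last exact: cmeas_inner.
  over.
rewrite ge0_integralZl_EFin//; last exact: cmeas_outer.
by move=> x _; exact: integral_ge0.
Qed.

Lemma cint_fatou (h : nat -> C -> \bar R) : (forall j, cmeas (h j)) -> (forall j c, 0 <= h j c) ->
  cint (fun c => limn_einf (h^~ c)) <= limn_einf (fun j => cint (h j)).
Proof.
move=> mh h0.
have L0 (u : nat -> \bar R) : (forall j, 0 <= u j) -> 0 <= limn_einf u.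
  by move=> u0; rewrite limn_einf_lim; apply: lime_ge; [exact: is_cvg_einfs|apply: nearW => j; apply: le_ereal_inf_tmp => _ [i _ <-]].
apply: le_trans (fatou mu measurableT (f := fun j x => \int[mu]_y h j (Complex x y)) _ _); last first.
- by move=> j x _; exact: integral_ge0.
- by move=> j; exact: cmeas_outer.
apply: le_integral_nneg => x; first by apply: integral_ge0 => y _; exact: L0.
by apply: fatou => // j; exact: cmeas_inner.
Qed.

Lemma cmeas_comp h (phi : mR * mR -> mR * mR) : cmeas h -> measurable_fun setT phi ->
  measurable_fun setT (fun xy => h (Complex (phi xy).1 (phi xy).2)).
Proof. by move=> mh mphi; apply: (measurableT_comp mh mphi). Qed.

Lemma mule2_eq (a b c : R) (I J : \bar R) : (a * b = c)%R -> I = J ->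
  a%:E * (b%:E * I) = c%:E * J.
Proof. by move=> <- ->; rewrite muleA EFinM. Qed.

(** Multiplication by x0 + i y0 is factored into two affine substitutions in one real variable each:
    x = (D/x0) u - y0 y/x0 with D = |l|^2, then y = x0 v + y0 u. Together they give x = x0 u - y0 v,
    and their factors multiply to D. *)
Lemma cint_scale h (l : C) : l != 0%R -> cmeas h -> (forall c, 0 <= h c) ->
  cint h = (cabs l ^+ 2)%:E * cint (fun c => h (l * c)%R).
Proof.
case: l => x0 y0 l0 mh h0; rewrite sqr_cabs/=.
have mX (p q r : R) : measurable_fun setT (fun xy : mR * mR => (p * xy.1 + q * xy.2 + r)%R : mR).
  by apply: measurable_funD => //; apply: measurable_funD; apply: measurable_funM.
have mA (p q r p' q' r' : R) : measurable_fun setT (fun xy : mR * mR =>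
    h (Complex (p * xy.1 + q * xy.2 + r) (p' * xy.1 + q' * xy.2 + r'))%R).
  by apply: (cmeas_comp (phi := fun xy : mR * mR => ((p * xy.1 + q * xy.2 + r)%R : mR,
     (p' * xy.1 + q' * xy.2 + r')%R : mR))) => //; apply: measurable_fun_pair.
(* For x0 = 0 the factorisation would divide by 0; the map then exchanges the axes, up to sign and
   scale, and Tonelli does the rest. *)
have [x00|x00] := eqVneq x0 0%R.
  have y00 : y0 != 0%R by apply: contra l0 => /eqP y00; rewrite x00 y00.
  have my : (- y0)%R != 0%R by rewrite oppr_eq0.
  rewrite /cint (integral_affine 0%R my); [|exact: cmeas_outer|by move=> x; exact: integral_ge0].
  under eq_integral => v _.
    rewrite (integral_affine 0%R y00)//; last exact: cmeas_inner.
    over.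
  have m1 : measurable_fun setT (fun xy : mR * mR =>
      h (Complex (- y0 * xy.1 + 0) (y0 * xy.2 + 0))%R).
    have := mA (- y0)%R 0%R 0%R 0%R y0 0%R; congr measurable_fun.
    by apply/funext => xy; congr h; congr Complex; ring.
  have f1 := measurable_fun_fubini_tonelli_F (m2 := mu) _ m1 (fun _ => h0 _).
  rewrite (ge0_integralZl_EFin mu measurableT (fun x _ => integral_ge0 _ (fun _ _ => h0 _)) f1 (normr_ge0 y0)).
  apply: mule2_eq; first by rewrite normrN -normrM x00 expr0n add0r -expr2 ger0_norm// sqr_ge0.
  rewrite (fubini_tonelli (m1 := mu) (m2 := mu) _ m1 (fun _ => h0 _)) /=.
  apply: eq_integral => u _; apply: eq_integral => v _; congr h.
  by rewrite x00; apply: complex_eqP; rewrite /= ?Re_mulE ?Im_mulE/=; ring.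
pose D := (x0 ^+ 2 + y0 ^+ 2)%R.
have D0 : (0 < D)%R by rewrite ltr_pwDl ?sqr_ge0// exprn_even_gt0.
have Dx : (D / x0)%R != 0%R by rewrite mulf_neq0 ?invr_eq0// gt_eqF.
rewrite cint_swap//.
under eq_integral => y _.
  rewrite (integral_affine (- y0 * y / x0)%R Dx)//; last first.
    by have := cmeas_comp (phi := fun xy : mR * mR => (xy.2, xy.1)) mh => H;
      apply: (measurableT_comp (H _) (pair1_measurable y)); exact: measurable_fun_pair.
  over.
have m1 : measurable_fun setT (fun yu : mR * mR => h (Complex (D / x0 * yu.2 + - y0 * yu.1 / x0) yu.1)%R).
  have := mA (- y0 / x0)%R (D / x0)%R 0%R 1%R 0%R 0%R; congr measurable_fun.
  by apply/funext => xy; congr h; congr Complex; ring.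
have f1 := measurable_fun_fubini_tonelli_F (m2 := mu) _ m1 (fun _ => h0 _).
rewrite (ge0_integralZl_EFin mu measurableT (fun x _ => integral_ge0 _ (fun _ _ => h0 _)) f1 (normr_ge0 _)).
rewrite (fubini_tonelli (m1 := mu) (m2 := mu) _ m1 (fun _ => h0 _)) /=.
under eq_integral => u _.
  rewrite (integral_affine (y0 * u)%R x00)//; last first.
    apply: (measurableT_comp m1 (g := fun y : mR => (y, u : mR))).
    by apply: measurable_fun_pair.
  over.
have m2 : measurable_fun setT (fun uv : mR * mR =>
    h (Complex (D / x0 * uv.1 + - y0 * (x0 * uv.2 + y0 * uv.1) / x0) (x0 * uv.2 + y0 * uv.1))%R).
  have := mA x0 (- y0)%R 0%R y0 x0 0%R; congr measurable_fun.
  apply/funext => xy; congr h; congr Complex; last by ring.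
  by rewrite /D; field.
have f2 := measurable_fun_fubini_tonelli_F (m2 := mu) _ m2 (fun _ => h0 _).
rewrite (ge0_integralZl_EFin mu measurableT (fun x _ => integral_ge0 _ (fun _ _ => h0 _)) f2 (normr_ge0 _)).
apply: mule2_eq; first by rewrite -normrM divfK// gtr0_norm.
apply: eq_integral => u _; apply: eq_integral => v _; congr h.
apply: complex_eqP; rewrite /= ?Re_mulE ?Im_mulE/=; last by ring.
by rewrite /D; field.
Qed.

End ComplexIntegral.

Arguments vint : simpl never.
Arguments cint : simpl never.

Section IteratedIntegral.
Variable R : realType.
Local Notation C := (R[i]).
Local Notation mu := (@lebesgue_measure R).
Local Notation mR := (measurableTypeR R).

(** Generators of the sigma-algebra of real and imaginary coordinates. It suits the inductive
    definition of [vint], and [open_measurable_Mn] shows that it contains the open sets. *)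
Definition coord_sets n : set (set (@CnN R n)) :=
  [set A | exists (k : 'I_n) (B : set mR), measurable B /\
     (A = [set z : 'rV[C]_n | B (complex.Re (z 0 k))] \/ A = [set z : 'rV[C]_n | B (complex.Im (z 0 k))])].

Local Notation Mn n := (g_sigma_algebraType (@coord_sets n)).

Lemma measurable_Re_coord n (k : 'I_n) : measurable_fun setT (fun z : Mn n => complex.Re ((z : 'rV[C]_n) 0 k) : mR).
Proof. by move=> _ B mB; rewrite setTI; apply: sub_sigma_algebra; exists k, B; split => //; left. Qed.

Lemma measurable_Im_coord n (k : 'I_n) : measurable_fun setT (fun z : Mn n => complex.Im ((z : 'rV[C]_n) 0 k) : mR).
Proof. by move=> _ B mB; rewrite setTI; apply: sub_sigma_algebra; exists k, B; split => //; right. Qed.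

Lemma measurable_to_Mn d (T : measurableType d) n (phi : T -> Mn n) :
  (forall k, measurable_fun setT (fun t => complex.Re ((phi t : 'rV[C]_n) 0 k) : mR)) ->
  (forall k, measurable_fun setT (fun t => complex.Im ((phi t : 'rV[C]_n) 0 k) : mR)) ->
  measurable_fun setT phi.
Proof.
move=> mr mi; apply: (@measurability _ _ _ (Mn n) setT phi (@coord_sets n)) => //.
move=> _ [_ [k [B [mB [->|->]]]] <-]; first by have := mr k measurableT B mB.
by have := mi k measurableT B mB.
Qed.

Definition slice n (f : 'rV[C]_n.+1 -> \bar R) (c : C) : 'rV[C]_n -> \bar R :=
  fun z => f (row_mx (const_mx c : 'rV[C]_1) z).

Lemma vintS n (f : 'rV[C]_n.+1 -> \bar R) : vint f = cint (fun c => vint (slice f c)).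
Proof. by []. Qed.

Lemma vint_ge0 n (f : 'rV[C]_n -> \bar R) : (forall z, (0 <= f z)%E) -> (0 <= vint f)%E.
Proof.
elim: n f => [|n IH] f f0; first exact: f0.
rewrite vintS; by apply: cint_ge0 => c; apply: IH => z; exact: f0.
Qed.

Lemma le_vint n (f g : 'rV[C]_n -> \bar R) : (forall z, (0 <= f z)%E) ->
  (forall z, (f z <= g z)%E) -> (vint f <= vint g)%E.
Proof.
elim: n f g => [|n IH] f g f0 fg; first exact: fg.
rewrite !vintS; apply: le_cint => c; first by apply: vint_ge0 => z; exact: f0.
by apply: IH => z; [exact: f0|exact: fg].
Qed.

Lemma eq_vint n (f g : 'rV[C]_n -> \bar R) : (forall z, f z = g z) -> vint f = vint g.
Proof. by move=> fg; congr vint; apply/funext. Qed.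

Definition pmeas d (T : measurableType d) n (f : T -> 'rV[C]_n -> \bar R) :=
  measurable_fun setT (fun x : T * Mn n => f x.1 x.2).

Definition vmeas n (f : 'rV[C]_n -> \bar R) := measurable_fun setT (f : Mn n -> \bar R).

Lemma measurable_glue d (T : measurableType d) n (a b : T -> R) (g : T -> Mn n) :
  measurable_fun setT (a : T -> mR) -> measurable_fun setT (b : T -> mR) -> measurable_fun setT g ->
  measurable_fun setT (fun t => row_mx (const_mx (Complex (a t) (b t)) : 'rV[C]_1) (g t : 'rV[C]_n) : Mn n.+1).
Proof.
move=> ma mb mg; apply: measurable_to_Mn => k.
  rewrite (_ : (fun t => _) = (fun t => if fintype.split (k : 'I_(1 + n)) is inr j then complex.Re ((g t : 'rV[C]_n) 0 j) else a t)); last first.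
    by apply/funext => t; rewrite mxE; case: fintype.split => j; rewrite ?mxE.
  case: fintype.split => [_|j]; first exact: ma.
  exact: measurableT_comp (measurable_Re_coord j) mg.
rewrite (_ : (fun t => _) = (fun t => if fintype.split (k : 'I_(1 + n)) is inr j then complex.Im ((g t : 'rV[C]_n) 0 j) else b t)); last first.
  by apply/funext => t; rewrite mxE; case: fintype.split => j; rewrite ?mxE.
case: fintype.split => [_|j]; first exact: mb.
exact: measurableT_comp (measurable_Im_coord j) mg.
Qed.

Lemma pmeas_slice d (T : measurableType d) n (f : T -> 'rV[C]_n.+1 -> \bar R) : pmeas f ->
  pmeas (fun x : (T * mR) * mR => slice (f x.1.1) (Complex x.1.2 x.2)).
Proof.
move=> mf; apply: (measurableT_comp mf (g := fun y : ((T * mR) * mR) * Mn n =>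
  (y.1.1.1, row_mx (const_mx (Complex y.1.1.2 y.1.2) : 'rV[C]_1) (y.2 : 'rV[C]_n) : Mn n.+1))).
apply: measurable_fun_pair; first by do 2! apply: measurableT_comp => //.
by apply: measurable_glue => //; apply: measurableT_comp => //; apply: measurableT_comp.
Qed.

(** Each coordinate peeled off adds two real variables to the parameter space, so the induction
    generalises over [T]; Tonelli then integrates the two variables out. *)
Lemma vint_pmeas d (T : measurableType d) n (f : T -> 'rV[C]_n -> \bar R) : pmeas f ->
  (forall t z, (0 <= f t z)%E) -> measurable_fun setT (fun t => vint (f t)).
Proof.
elim: n d T f => [|n IH] d T f mf f0.
  apply: (measurableT_comp mf (g := fun t : T => (t, 0 : Mn 0))).
  exact: measurable_fun_pair.
have m1 := IH _ _ _ (pmeas_slice mf) (fun t z => f0 _ _).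
have m2 := measurable_fun_fubini_tonelli_F (m2 := mu) _ m1 (fun x => vint_ge0 (fun z => f0 _ _)).
exact: (measurable_fun_fubini_tonelli_F (m2 := mu) _ m2 (fun x => integral_ge0 _ (fun _ _ => vint_ge0 (fun z => f0 _ _)))).
Qed.

Lemma pmeas_vmeas d (T : measurableType d) n (f : T -> 'rV[C]_n -> \bar R) t : pmeas f -> vmeas (f t).
Proof. by move=> mf; apply: (measurableT_comp mf (pair1_measurable t)). Qed.

Lemma vmeas_slice n (f : 'rV[C]_n.+1 -> \bar R) c : vmeas f -> vmeas (slice f c).
Proof.
move=> mf; case: c => x y.
by apply: (measurableT_comp mf (g := fun z : Mn n => row_mx (const_mx (Complex x y) : 'rV[C]_1) (z : 'rV[C]_n) : Mn n.+1));
  apply: measurable_glue.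
Qed.

Lemma cmeas_slice n (f : 'rV[C]_n.+1 -> \bar R) : vmeas f -> (forall z, (0 <= f z)%E) ->
  cmeas (fun c => vint (slice f c)).
Proof.
move=> mf f0; apply: (vint_pmeas (f := fun xy : mR * mR => slice f (Complex xy.1 xy.2))) => [|t z]; last exact: f0.
apply: (measurableT_comp mf (g := fun y : (mR * mR) * Mn n =>
  row_mx (const_mx (Complex y.1.1 y.1.2) : 'rV[C]_1) (y.2 : 'rV[C]_n) : Mn n.+1)).
by apply: measurable_glue => //; apply: measurableT_comp.
Qed.

Lemma vintD n (f g : 'rV[C]_n -> \bar R) : vmeas f -> vmeas g -> (forall z, (0 <= f z)%E) ->
  (forall z, (0 <= g z)%E) -> vint (fun z => f z + g z)%E = (vint f + vint g)%E.
Proof.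
elim: n f g => [//|n IH] f g mf mg f0 g0; rewrite !vintS.
rewrite -cintD; [|exact: cmeas_slice|exact: cmeas_slice| |].
- by apply: eq_cint => c; rewrite -IH => // [||z|z]; [exact: vmeas_slice|exact: vmeas_slice|exact: f0|exact: g0].
- by move=> c; apply: vint_ge0 => z; exact: f0.
- by move=> c; apply: vint_ge0 => z; exact: g0.
Qed.

Lemma vintZ n (f : 'rV[C]_n -> \bar R) (k : R) : vmeas f -> (forall z, (0 <= f z)%E) -> 0 <= k ->
  vint (fun z => k%:E * f z)%E = (k%:E * vint f)%E.
Proof.
elim: n f => [//|n IH] f mf f0 k0; rewrite !vintS.
rewrite -(cintZ (cmeas_slice mf f0) (fun c => vint_ge0 (fun z => f0 _)) k0).
by apply: eq_cint => c; rewrite -IH => // [|z]; [exact: vmeas_slice|exact: f0].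
Qed.

Lemma limn_einf_ge0 (u : nat -> \bar R) : (forall j, (0 <= u j)%E) -> (0 <= limn_einf u)%E.
Proof.
move=> u0; rewrite limn_einf_lim; apply: lime_ge; first exact: is_cvg_einfs.
by apply: nearW => j; apply: le_ereal_inf_tmp => _ [i _ <-].
Qed.

Lemma vint_fatou n (h : nat -> 'rV[C]_n -> \bar R) : (forall j, vmeas (h j)) ->
  (forall j z, (0 <= h j z)%E) ->
  (vint (fun z => limn_einf (h^~ z)) <= limn_einf (fun j => vint (h j)))%E.
Proof.
elim: n h => [|n IH] h mh h0; first exact: lexx.
under [X in (_ <= limn_einf X)%E]eq_fun do rewrite vintS.
apply: le_trans (cint_fatou _ _); last 2 first.
- by move=> j; exact: cmeas_slice.
- by move=> j c; apply: vint_ge0 => z; exact: h0.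
rewrite vintS; apply: le_cint => c; first by apply: vint_ge0 => z; exact: limn_einf_ge0.
by apply: IH => j; [exact: vmeas_slice|move=> z; exact: h0].
Qed.

(** Each complex coordinate contributes one factor |l|^2 by [cint_scale]. *)
Lemma vint_scale n (f : 'rV[C]_n -> \bar R) (l : C) : l != 0 -> vmeas f -> (forall z, (0 <= f z)%E) ->
  vint f = ((cabs l ^+ (2 * n))%:E * vint (fun z => f (l *: z)))%E.
Proof.
elim: n f => [|n IH] f l0 mf f0.
  by rewrite muln0 expr0 mul1e; change (f 0 = f (l *: 0)); rewrite scaler0.
rewrite vintS (cint_scale l0); [|exact: cmeas_slice|by move=> c; apply: vint_ge0 => z; exact: f0].
suff H : cint (fun c => vint (slice f (l * c))) =
    ((cabs l ^+ (2 * n))%:E * vint (fun z => f (l *: z)))%E.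
  by rewrite H; apply: mule2_eq; rewrite // -exprD mulnS.
rewrite vintS.
have ms c : vmeas (slice f c) by exact: vmeas_slice.
have E c : vint (slice f (l * c)) = ((cabs l ^+ (2 * n))%:E * vint (slice (fun z => f (l *: z)) c))%E.
  rewrite IH//; last by move=> z; exact: f0.
  congr (_ * _)%E; apply: eq_vint => z; congr f; apply/rowP => i; rewrite !mxE.
  by case: fintype.split => j; rewrite !mxE.
rewrite (eq_cint E) cintZ//; [|by move=> c; apply: vint_ge0 => z; exact: f0|by rewrite exprn_ge0 ?cabs_ge0].
apply: cmeas_slice => //.
apply: (measurableT_comp mf (g := fun z : Mn n.+1 => l *: (z : 'rV[C]_n.+1) : Mn n.+1)).
apply: measurable_to_Mn => k.
  under eq_fun do rewrite mxE Re_mulE.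
  by apply: measurable_funB; apply: measurable_funM => //; [exact: measurable_Re_coord|exact: measurable_Im_coord].
under eq_fun do rewrite mxE Im_mulE.
by apply: measurable_funD; apply: measurable_funM => //; [exact: measurable_Im_coord|exact: measurable_Re_coord].
Qed.

Lemma vint_swap n (f : mR -> 'rV[C]_n -> \bar R) : pmeas f -> (forall t z, (0 <= f t z)%E) ->
  (\int[mu]_t vint (f t) = vint (fun z => \int[mu]_t f t z))%E.
Proof.
elim: n f => [|n IH] f mf f0; first exact: erefl.
have m1 : measurable_fun setT (fun x : (mR * mR) * mR => vint (slice (f x.1.1) (Complex x.1.2 x.2))).
  by apply: vint_pmeas (pmeas_slice mf) _ => t z; exact: f0.
have v0 t c : (0 <= vint (slice (f t) c))%E by apply: vint_ge0 => z; exact: f0.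
under eq_integral do rewrite vintS.
have m2 := measurable_fun_fubini_tonelli_F (m2 := mu) _ m1 (fun x => v0 _ _).
rewrite (fubini_tonelli (m1 := mu) (m2 := mu) _ m2 (fun tx => integral_ge0 _ (fun _ _ => v0 _ _))) /=.
rewrite vintS; apply: eq_integral => x _.
have m3 : measurable_fun setT (fun ty : mR * mR => vint (slice (f ty.1) (Complex x ty.2))).
  apply: (measurableT_comp m1 (g := fun ty : mR * mR => ((ty.1, x : mR), ty.2))).
  by apply: measurable_fun_pair => //; apply: measurable_fun_pair.
rewrite (fubini_tonelli (m1 := mu) (m2 := mu) _ m3 (fun _ => v0 _ _)) /=.
apply: eq_integral => y _; apply: (IH (fun t => slice (f t) (Complex x y))) => [|t z]; last exact: f0.
apply: (measurableT_comp mf (g := fun tz : mR * Mn n =>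
  (tz.1, row_mx (const_mx (Complex x y) : 'rV[C]_1) (tz.2 : 'rV[C]_n) : Mn n.+1))).
by apply: measurable_fun_pair => //; apply: measurable_glue.
Qed.

End IteratedIntegral.

(** * Measurability of the integrands *)

Section MeasurabilityCn.
Variables (R : realType) (n : nat).
Local Notation C := (R[i]).
Local Notation Cn := ('rV[R[i]]_n).
Local Notation mR := (measurableTypeR R).
Local Notation Mn n := (g_sigma_algebraType (@coord_sets R n)).
Implicit Types (z w : Cn) (f : Cn -> C^o).

(** A countable base of the topology, indexed by a countable type so that open sets become countable
    unions. *)
Definition rat_box (q : {ffun 'I_n -> rat * rat}) (m : nat) : set Cn :=
  [set z | forall k, `|complex.Re (z 0 k) - ratr (q k).1| < m.+1%:R^-1 /\
                     `|complex.Im (z 0 k) - ratr (q k).2| < m.+1%:R^-1].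

Lemma measurable_rat_box q m : measurable (rat_box q m : set (Mn n)).
Proof.
have -> : rat_box q m = \bigcap_(k in setT)
   ([set z : Cn | `|complex.Re (z 0 k) - ratr (q k).1| < m.+1%:R^-1] `&`
    [set z : Cn | `|complex.Im (z 0 k) - ratr (q k).2| < m.+1%:R^-1]).
  by apply/seteqP; split => z /= H k; [move=> _; exact: H|exact: H].
apply: fin_bigcap_measurable => [|k _]; first exact: finite_finset.
have B (a e : R) : measurable ([set x : mR | `|x - a| < e] : set mR).
  rewrite (_ : [set _ | _] = ball a e); first exact: measurable_ball.
  by apply/seteqP; split => x /=; rewrite /ball/= distrC.
apply: (@measurableI _ (Mn n)).
  by have := @measurable_Re_coord R n k measurableT _ (B (ratr (q k).1) m.+1%:R^-1); rewrite setTI.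
by have := @measurable_Im_coord R n k measurableT _ (B (ratr (q k).2) m.+1%:R^-1); rewrite setTI.
Qed.

Lemma rat_box_sub z (d : R) : 0 < d -> exists q m, rat_box q m z /\
  forall w, rat_box q m w -> nrm1 (w - z) < d.
Proof.
move=> d0; pose m := Num.bound (n%:R * 4 / d).
have md : n%:R * (4 * m.+1%:R^-1) < d.
  rewrite mulrA ltr_pdivrMr// [ltRHS]mulrC -ltr_pdivrMr//.
  apply: lt_le_trans (archi_boundP _) _; first by rewrite divr_ge0 ?mulr_ge0// ltW.
  by rewrite ler_nat.
have e0 : 0 < m.+1%:R^-1 :> R by rewrite invr_gt0.
have near_lt (x q e : R) : x < q -> q < x + e -> `|x - q| < e.
  by move=> h1 h2; rewrite ltr_norml; apply/andP; split; lra.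
have /choice[q1 hq1] : forall k, exists q : rat, `|complex.Re (z 0 k) - ratr q| < m.+1%:R^-1.
  move=> k; have [|q] := @rat_in_itvoo R (complex.Re (z 0 k)) (complex.Re (z 0 k) + m.+1%:R^-1).
    by rewrite ltrDl.
  by rewrite in_itv/= => /andP[h1 h2]; exists q; exact: near_lt.
have /choice[q2 hq2] : forall k, exists q : rat, `|complex.Im (z 0 k) - ratr q| < m.+1%:R^-1.
  move=> k; have [|q] := @rat_in_itvoo R (complex.Im (z 0 k)) (complex.Im (z 0 k) + m.+1%:R^-1).
    by rewrite ltrDl.
  by rewrite in_itv/= => /andP[h1 h2]; exists q; exact: near_lt.
exists [ffun k => (q1 k, q2 k)], m; split; first by move=> k; rewrite ffunE.
move=> w hw; apply: le_lt_trans md.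
rewrite mulr_natl -[X in _ *+ X]card_ord -sumr_const; apply: ler_sum => k _.
apply: le_trans (cabs_le_ReIm _) _; have := hw k; rewrite !ffunE/= => -[h1 h2].
rewrite !mxE !ReD !ReN !ImD !ImN.
have four (a b c x y t e : R) : `|a - t| < e -> `|c - t| < e -> `|b - y| < e -> `|x - y| < e ->
    `|a - c| + `|b - x| <= 4 * e.
  move=> k1 k2 k3 k4; have := ler_distD t a c; have := ler_distD y b x.
  by rewrite !(distrC t) !(distrC y); lra.
exact: (four _ _ _ _ _ _ _ h1 (hq1 k) h2 (hq2 k)).
Qed.

Lemma open_measurable_Mn (A : set Cn) :
  (forall z, A z -> exists2 d : R, 0 < d & forall w, nrm1 (w - z) < d -> A w) ->
  measurable (A : set (Mn n)).
Proof.
move=> oA; have -> : A = \bigcup_(x : {ffun 'I_n -> rat * rat} * nat)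
    (if `[< rat_box x.1 x.2 `<=` A >] then rat_box x.1 x.2 else set0).
  apply/seteqP; split => [z Az|z [[q m] _ /=]]; last by case: asboolP => // h; exact: h.
  have [d d0 dA] := oA z Az; have [q [m [qz qw]]] := rat_box_sub z d0.
  exists (q, m) => //=; rewrite asboolT// => w hw; exact/dA/qw.
apply: (@countable_bigcupT_measurable _ (Mn n)) => [|[q m] /=]; first exact: countableP.
by case: asboolP => _; [exact: measurable_rat_box|exact: measurable0].
Qed.

(** Lower semicontinuity is the right generality here: it holds for nonnegative functions extended
    by 0 from the open ball, which may jump at the sphere. *)
Lemma lsc_measurable (F : Cn -> R) :
  (forall a z, a < F z -> exists2 d : R, 0 < d & forall w, nrm1 (w - z) < d -> a < F w) ->
  measurable_fun setT (F : Mn n -> mR).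
Proof.
move=> oF; apply: (measurability _ (RGenOInfty.measurableE R)) => _ [_ [a ->] <-].
rewrite setTI; apply: open_measurable_Mn => z /=; rewrite in_itv/= andbT => /oF[d d0 H].
by exists d => // w /H; rewrite in_itv/= andbT.
Qed.

Lemma measurable_normz : measurable_fun setT (@normz R n : Mn n -> mR).
Proof.
apply: lsc_measurable => a z az; exists (normz z - a); first by rewrite subr_gt0.
move=> w wz; have := normzD (z - w) w; rewrite subrK; have := normz_nrm1 (z - w).
by rewrite -nrm1N opprB; lra.
Qed.

Lemma measurable_on_ball (F : Cn -> R) : (forall z, Bn z -> 0 <= F z) ->
  (forall z, Bn z -> forall e : R, 0 < e -> exists2 d : R, 0 < d &
     forall w, nrm1 (w - z) < d -> `|F w - F z| <= e) ->
  measurable_fun setT ((fun z => if normz z < 1 then F z else 0) : Mn n -> mR).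
Proof.
move=> F0 cF; apply: lsc_measurable => a z; case: (ltP (normz z) 1) => [Bz aF|_ a0].
  have e0 : 0 < (F z - a) / 2 by rewrite divr_gt0// subr_gt0.
  have [d d0 H] := cF z Bz _ e0.
  exists (Num.min d (1 - normz z)); first by rewrite lt_min d0 subr_gt0.
  move=> w; rewrite lt_min => /andP[/H + /Bn_nrm1 Bw]; rewrite Bw ler_norml => /andP[]; lra.
exists 1 => // w _; case: (ltP (normz w) 1) => [Bw|_]; last exact: a0.
exact: lt_le_trans a0 (F0 _ Bw).
Qed.

Lemma measurable_holo f : holo f ->
  measurable_fun setT ((fun z => if normz z < 1 then cabs (f z) else 0) : Mn n -> mR).
Proof.
move=> hf; apply: measurable_on_ball => [z _|z Bz e e0]; first exact: cabs_ge0.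
have [d d0 H] := fdiff_cont (holo_fdiff hf Bz) e0; exists d => // w /H.
exact: le_trans (cabs_dist _ _).
Qed.

Definition rho z : R := 1 - normz z ^+ 2.

Lemma rho_gt0 z : Bn z -> 0 < rho z.
Proof. by move=> Bz; rewrite /rho subr_gt0 expr_lt1// normz_ge0. Qed.

Lemma rho_le1 z : rho z <= 1.
Proof. by rewrite /rho lerBlDr lerDl sqr_ge0. Qed.

Lemma psiE z : psi z = (rho z)^-1.
Proof. by []. Qed.

Lemma psi_ge1 z : Bn z -> 1 <= psi z.
Proof. by move=> Bz; rewrite psiE invf_ge1 ?rho_gt0// rho_le1. Qed.

Lemma measurable_rho : measurable_fun setT (rho : Mn n -> mR).
Proof.
by apply: measurable_funB => //; apply: measurable_funX; exact: measurable_normz.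
Qed.

Lemma measurable_psi :
  measurable_fun setT ((fun z => if normz z < 1 then psi z else 0) : Mn n -> mR).
Proof.
(* The inverse is written as the real power -1, whose measurability is available; the two agree
   where [rho] is positive. *)
have -> : (fun z => if normz z < 1 then psi z else 0) =
    (fun z => if normz z < 1 then rho z `^ (-1) else 0).
  apply/funext => z; case: ifPn => // Bz; rewrite psiE powR_inv1//.
  exact/ltW/rho_gt0.
apply: (@measurable_fun_ifT _ _ (Mn n) mR) => //.
- by apply: measurable_fun_ltr => //; exact: measurable_normz.
- by apply: (measurableT_comp (measurable_powR _)); exact: measurable_rho.
Qed.

Definition winteg (p : R) (w : Cn -> R) f : Cn -> \bar R := fun z =>
  if normz z < 1 then ((cabs (f z)) `^ p * expR (- psi z) * w z)%:E else 0%E.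

Lemma wintE p (w : Cn -> R) f : wint p w f = vint (winteg p w f).
Proof. by []. Qed.

Lemma vmeas_winteg p (w : Cn -> R) f : holo f ->
  measurable_fun setT ((fun z => if normz z < 1 then w z else 0) : Mn n -> mR) ->
  vmeas (winteg p w f).
Proof.
move=> hf mw; rewrite /vmeas.
have -> : winteg p w f = EFin \o (fun z => if normz z < 1 then
    (if normz z < 1 then cabs (f z) else 0) `^ p * expR (- (if normz z < 1 then psi z else 0)) *
     (if normz z < 1 then w z else 0) else 0).
  by apply/funext => z; rewrite /winteg/=; case: ifP.
apply/measurable_EFinP; apply: (@measurable_fun_ifT _ _ (Mn n) mR) => //.
  by apply: measurable_fun_ltr => //; exact: measurable_normz.
apply: measurable_funM => //; apply: measurable_funM.
  by apply: (measurableT_comp (measurable_powR _)); exact: measurable_holo.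
apply: (measurableT_comp (@measurable_expR R)).
by apply: measurable_funN; exact: measurable_psi.
Qed.

Lemma winteg_ge0 p (w : Cn -> R) f : (forall z, Bn z -> 0 <= w z) -> forall z, (0 <= winteg p w f z)%E.
Proof.
move=> w0 z; rewrite /winteg; case: ifPn => // Bz; rewrite lee_fin.
by rewrite !mulr_ge0 ?powR_ge0 ?expR_ge0 ?w0.
Qed.

Lemma measurable_ball1 : measurable_fun setT ((fun z => if normz z < 1 then 1 else 0) : Mn n -> mR).
Proof.
apply: (@measurable_fun_ifT _ _ (Mn n) mR) => //.
by apply: measurable_fun_ltr => //; exact: measurable_normz.
Qed.

End MeasurabilityCn.

(** * Point evaluations on the weighted Bergman space *)

Section PowerTrick.
Variable R : realType.
Implicit Types (p x l A J : R).

(** Either x <= l, or x^p l^(1-p) = x (x/l)^(p-1) is at least x. *)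
Lemma le_young_split p x l : 1 <= p -> 0 <= x -> 0 < l -> x <= l + x `^ p * l `^ (1 - p).
Proof.
move=> p1 x0 l0; case: (lerP x l) => xl.
  by apply: le_trans xl _; rewrite lerDl mulr_ge0 ?powR_ge0.
have xp : 0 < x by exact: lt_trans xl.
apply: le_trans (_ : x `^ p * x `^ (1 - p) <= _).
  rewrite -powRD; last by rewrite (gt_eqF xp) implybT.
  by rewrite (_ : p + (1 - p) = 1) ?powRr1//; ring.
apply: ler_wpDl; first exact: ltW.
apply: ler_wpM2l; first exact: powR_ge0.
rewrite -opprB !powRN lef_pV2 ?posrE ?powR_gt0//.
by apply: ge0_ler_powR; rewrite ?subr_ge0// ?nnegrE; exact: ltW.
Qed.

(* Replaces Hoelder's inequality: optimise a family of linear bounds in l. *)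
Lemma power_of_linear_bounds p x A J : 1 <= p -> 0 <= x -> 0 < A -> 0 <= J ->
  (forall l, 0 < l -> x <= A * l + l `^ (1 - p) * J) ->
  x `^ p <= 2 * (2 * A) `^ (p - 1) * J.
Proof.
move=> p1 x0 A0 J0 H; have p0 : 0 < p by lra.
have [->|xn0] := eqVneq x 0; first by rewrite powR0 ?gt_eqF// !mulr_ge0 ?powR_ge0.
have xp : 0 < x by rewrite lt_neqAle eq_sym xn0.
(* With this l the term A l is x/2 and is absorbed on the left. *)
have l0 : 0 < x / (2 * A) by rewrite divr_gt0 ?mulr_gt0.
have := H _ l0; rewrite (_ : A * (x / (2 * A)) = x / 2); last by field; rewrite gt_eqF.
move=> h; have {h} : x / 2 <= (x / (2 * A)) `^ (1 - p) * J by lra.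
rewrite -opprB powRN ler_pdivlMl ?powR_gt0// mulrC => h.
have A2 : 0 < (2 * A) `^ (p - 1) by rewrite powR_gt0// mulr_gt0.
have E : x `^ (p - 1) = (x / (2 * A)) `^ (p - 1) * (2 * A) `^ (p - 1).
  rewrite -powRM; [|exact: ltW|by rewrite ltW// mulr_gt0].
  by rewrite divfK// gt_eqF// mulr_gt0.
rewrite -mulr_powRB1// E (_ : _ * _ = (2 * (2 * A) `^ (p - 1)) * (x / 2 * (x / (2 * A)) `^ (p - 1))); last by field.
by rewrite ler_pM2l// mulr_gt0.
Qed.

Lemma ler_powRD p x y : 1 <= p -> 0 <= x -> 0 <= y ->
  (x + y) `^ p <= 2 `^ p * (x `^ p + y `^ p).
Proof.
move=> p1 x0 y0; have p0 : 0 <= p by lra.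
apply: le_trans (_ : (2 * Num.max x y) `^ p <= _).
  apply: ge0_ler_powR => //; rewrite ?nnegrE; first exact: addr_ge0.
    by rewrite mulr_ge0// le_max x0.
  by rewrite mulr_natl mulr2n lerD// le_max lexx ?orbT.
rewrite powRM//; last by rewrite le_max x0.
apply: ler_wpM2l; first exact: powR_ge0.
by case: (lerP x y) => _; rewrite ?lerDl ?lerDr powR_ge0.
Qed.

End PowerTrick.

(** * Sub-mean value inequalities *)

Section AreaMean.
Variable R : realType.
Local Notation C := (R[i]).
Local Notation mu := (@lebesgue_measure R).
Local Notation mR := (measurableTypeR R).
Local Open Scope ereal_scope.

Lemma ri_le_integral (f : R -> R) (g : R -> \bar R) a b : contI f a b ->
  (forall x, (0 <= f x)%R) -> (forall x, 0 <= g x) ->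
  (forall x, (a <= x <= b)%R -> (f x)%:E <= g x) -> (ri f a b)%:E <= \int[mu]_x g x.
Proof.
move=> cf f0 g0 fg; rewrite /ri /Rintegral fineK; last first.
  by apply: integrable_fin_num => //; exact: contI_integrable.
rewrite integral_mkcond; apply: le_integral_nneg => x.
  by apply: erestrict_ge0 => y _; rewrite lee_fin.
by rewrite patchE; case: ifPn => // /set_mem/=; rewrite in_itv/= => /fg.
Qed.

Lemma measurable_shift_complex (h : C -> \bar R) (a : C) : cmeas h -> cmeas (fun c => h (a + c)%R).
Proof.
case: a => x y mh.
apply: (@cmeas_comp _ h (fun xy : mR * mR => ((x + xy.1)%R : mR, (y + xy.2)%R : mR))) => //.
by apply: measurable_fun_pair; apply: measurable_funD.
Qed.

Lemma cint_shift (h : C -> \bar R) (a : C) : cmeas h -> (forall c, 0 <= h c) ->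
  cint h = cint (fun c => h (a + c)%R).
Proof.
case: a => x0 y0 mh h0; have o1 : (1%R : R) != 0%R by exact: oner_neq0.
have S (f : mR -> \bar R) (t : R) : measurable_fun setT f -> (forall x, 0 <= f x) ->
    \int[mu]_x f x = \int[mu]_x f (t + x)%R.
  move=> mf f0; rewrite (integral_affine t o1)// normr1 mul1e.
  by apply: eq_integral => x _; rewrite mul1r addrC.
rewrite /cint (S _ x0); [|exact: cmeas_outer|by move=> x; exact: integral_ge0].
apply: eq_integral => x _; rewrite (S _ y0)//; exact: cmeas_inner.
Qed.

(** [sqr_mean] is integrated over s in [d/2, d]. As s varies, each of the four sides sweeps out part
    of the square, so the right-hand sides integrate to at most 4 times the area integral, while the
    left gives (d/2) d |h(0)|. *)
Lemma square_area_mean (h h' : C -> C) (d : R) : (0 < d)%R ->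
  (forall z, sq d z -> cdiff h z (h' z)) ->
  let H := fun c => (if `[< sq d c >] then cabs (h c) else 0%R)%:E in
  cmeas H -> (d ^+ 2 / 8 * cabs (h 0))%:E <= cint H.
Proof.
move=> d0 dh H mH; have H0 c : 0 <= H c by rewrite /H lee_fin; case: ifP; rewrite ?cabs_ge0.
pose Ih y := \int[mu]_x H (Complex x y); pose Iv x := \int[mu]_y H (Complex x y).
have Ih0 y : 0 <= Ih y by exact: integral_ge0.
have Iv0 y : 0 <= Iv y by exact: integral_ge0.
have mIv : measurable_fun setT (Iv : mR -> \bar R) by exact: cmeas_outer.
have mIh : measurable_fun setT (Ih : mR -> \bar R) by exact: cmeas_outer_swap.
have eIv : \int[mu]_x Iv x = cint H by [].
have eIh : \int[mu]_x Ih x = cint H by exact: (esym (cint_swap mH H0)).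
have m1 : (-1)%R != 0%R :> R by rewrite oppr_eq0 oner_neq0.
have N (f : mR -> \bar R) : measurable_fun setT f -> (forall x, 0 <= f x) ->
    \int[mu]_x f (- x)%R = \int[mu]_x f x.
  move=> mf f0; rewrite [RHS](integral_affine 0%R m1)// normrN1 mul1e.
  by apply: eq_integral => x _; rewrite addr0 mulN1r.
have mN (f : mR -> \bar R) : measurable_fun setT f -> measurable_fun setT (fun x : mR => f (- x)%R).
  by move=> mf; apply: (measurableT_comp mf (g := fun x : mR => (- x)%R : mR)); exact: measurable_funN.
pose S s := Ih (- s)%R + Ih s + (Iv s + Iv (- s)%R).
have S0 s : 0 <= S s by apply: adde_ge0; apply: adde_ge0.
have ES : \int[mu]_s S s = 4%:E * cint H.
  have mNh := mN _ mIh; have mNv := mN _ mIv.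
  rewrite /S (ge0_integralD mu measurableT (fun x _ => adde_ge0 (Ih0 _) (Ih0 _))
    (emeasurable_funD mNh mIh) (fun x _ => adde_ge0 (Iv0 _) (Iv0 _)) (emeasurable_funD mIv mNv)).
  rewrite (ge0_integralD mu measurableT (fun x _ => Ih0 _) mNh (fun x _ => Ih0 _) mIh).
  rewrite (ge0_integralD mu measurableT (fun x _ => Iv0 _) mIv (fun x _ => Iv0 _) mNv).
  rewrite (N _ mIh Ih0) (N _ mIv Iv0) eIh eIv; have := cint_ge0 H0; case: (cint H) => [r|_|//].
    by rewrite lee_fin -!EFinD -EFinM => _; congr EFin; ring.
  by rewrite !addye// gt0_muley// lte_fin.
have P s : (d / 2 <= s <= d)%R -> (d * cabs (h 0))%:E <= S s.
  move=> /andP[s1 s2]; have s0 : (0 < s)%R by lra.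
  have In z : sq s z -> sq d z by apply: rect_sub; rewrite ?lerN2.
  have dhs z : sq s z -> cdiff h z (h' z) by move=> /In; exact: dh.
  apply: le_trans (_ : (2 * s * cabs (h 0))%:E <= _).
    by rewrite lee_fin; apply: ler_wpM2r; [exact: cabs_ge0|lra].
  have := sqr_mean s0 dhs; rewrite -lee_fin => /le_trans; apply.
  have [c1 c2 c3 c4] : contsides h (- s) s (- s) s.
    by apply: (contsides_sq s0) => z Sz _; exact: dhs.
  have K c : sq s c -> (cabs (h c))%:E <= H c by move=> /In Sc; rewrite /H asboolT.
  have sqs (x y : R) : (- s <= x <= s)%R -> (- s <= y <= s)%R -> sq s (Complex x y) by [].
  have ss : (- s <= s <= s)%R by rewrite lexx; lra.
  have sn : (- s <= - s <= s)%R by rewrite lexx; lra.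
  rewrite !EFinD /S; apply: leeD; apply: leeD.
  - exact: (ri_le_integral (ccI_cabs c1) (fun x => cabs_ge0 _) (fun x => H0 _) (fun x xs => K _ (sqs _ _ xs sn))).
  - exact: (ri_le_integral (ccI_cabs c2) (fun x => cabs_ge0 _) (fun x => H0 _) (fun x xs => K _ (sqs _ _ xs ss))).
  - exact: (ri_le_integral (ccI_cabs c3) (fun x => cabs_ge0 _) (fun x => H0 _) (fun x xs => K _ (sqs _ _ ss xs))).
  - exact: (ri_le_integral (ccI_cabs c4) (fun x => cabs_ge0 _) (fun x => H0 _) (fun x xs => K _ (sqs _ _ sn xs))).
have : (d / 2 * (d * cabs (h 0)))%:E <= \int[mu]_s S s.
  have := @ri_le_integral (fun=> (d * cabs (h 0))%R) S (d / 2) d (@contI_cst _ _ _ _).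
  rewrite ri_cst; last lra.
  rewrite (_ : d - d / 2 = d / 2)%R; last by field.
  by apply => // x; rewrite mulr_ge0 ?cabs_ge0 ?ltW.
rewrite ES; have := cint_ge0 H0; case: (cint H) => [r||//]; rewrite ?leey//.
by rewrite -EFinM !lee_fin => _ h1; lra.
Qed.

Lemma cint_square (d : R) : (0 < d)%R ->
  cmeas (fun c : C => (if `[< sq d c >] then 1 else 0)%R%:E) /\
  cint (fun c : C => (if `[< sq d c >] then 1 else 0)%R%:E) = (4 * d ^+ 2)%:E.
Proof.
move=> d0; pose A : set mR := `[(- d)%R, d]%classic.
have mA : measurable A by exact: measurable_itv.
have E (x y : R) : (if `[< sq d (Complex x y) >] then 1 else 0)%R = (\1_A x * \1_A y)%R :> R.
  rewrite !indicE; have -> : `[< sq d (Complex x y) >] = (x \in A) && (y \in A).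
    apply/asboolP/andP => -[h1 h2]; [by split; apply/mem_set|by split; exact/set_mem].
  by case: (x \in A); case: (y \in A); rewrite ?mulr1 ?mulr0.
have mu_A : mu A = (2 * d)%:E.
  rewrite /A lebesgue_measure_itv/= lte_fin ifT; last lra.
  by rewrite -EFinD; congr EFin; ring.
have iA : \int[mu]_x (\1_A x)%:E = (2 * d)%:E.
  by rewrite integral_indic// setIT; exact: mu_A.
split.
  rewrite /cmeas; apply/measurable_EFinP => /=.
  rewrite (_ : (fun _ => _) = (fun xy : mR * mR => \1_A xy.1 * \1_A xy.2)%R); last first.
    by apply/funext => -[x y]; exact: E.
  by apply: measurable_funM; (apply: measurableT_comp; [exact: measurable_indic|]).
rewrite /cint; under eq_integral => x _.
  rewrite (_ : \int[mu]_y _ = (\1_A x)%:E * (2 * d)%:E); last first.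
    under eq_integral do rewrite E EFinM.
    rewrite ge0_integralZl_EFin//; last exact/measurable_EFinP/measurable_indic.
    by rewrite iA.
  over.
rewrite ge0_integralZr//; [|exact/measurable_EFinP/measurable_indic|by rewrite lee_fin mulr_ge0// ltW].
by rewrite iA -EFinM; congr EFin; ring.
Qed.

End AreaMean.

Section MeanValue.
Variable R : realType.
Local Notation C := (R[i]).
Local Notation mR := (measurableTypeR R).
Local Notation Mn n := (g_sigma_algebraType (@coord_sets R n)).
Variable p : R.
Hypothesis p1 : 1 <= p.

Let p0 : 0 < p. Proof. exact: lt_le_trans p1. Qed.

(** The constant of [power_of_linear_bounds] with A = 32 and a factor 8 in J: dividing by d^2/8
    turns the area 4 d^2 into 32 and leaves 8/d^2 before the p-th power integral. *)
Definition Kmean : R := 2 * (2 * 32) `^ (p - 1) * 8.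

Lemma Kmean_gt0 : 0 < Kmean.
Proof. by rewrite /Kmean !mulr_gt0// powR_gt0. Qed.

(** The area mean is split by [le_young_split] at each level l, which gives a family of bounds
    linear in the integral of |h|^p; optimising over l yields the p-th power. *)
Lemma square_Lp_mean (h h' : C -> C) (a : C) (d : R) : 0 < d ->
  (forall z, sq d (z - a) -> cdiff h z (h' z)) ->
  let H := fun c => if `[< sq d (c - a) >] then cabs (h c) else 0 in
  measurable_fun setT (fun xy : mR * mR => H (Complex xy.1 xy.2) : mR) ->
  (((cabs (h a)) `^ p)%:E <= (Kmean / d ^+ 2)%:E * cint (fun c => (H c `^ p)%:E))%E.
Proof.
move=> d0 dh H mH; have H0 c : 0 <= H c by rewrite /H; case: ifP; rewrite ?cabs_ge0.
have cH : cmeas (fun c => (H c)%:E) by exact/measurable_EFinP.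
have cHp : cmeas (fun c => (H c `^ p)%:E).
  by apply/measurable_EFinP; apply: (measurableT_comp (measurable_powR _) mH).
have Hp0 c : (0 <= (H c `^ p)%:E)%E by rewrite lee_fin powR_ge0.
have [cS iS] := cint_square d0.
have Sq0 (c : C) : (0 <= (if `[< sq d c >] then 1 else 0)%R%:E :> \bar R)%E by rewrite lee_fin; case: ifP.
pose Sa (c : C) := (if `[< sq d (c - a) >] then 1 else 0 : R)%:E.
have Sa0 c : (0 <= Sa c)%E by rewrite lee_fin; case: ifP.
have cSa : cmeas Sa.
  have := measurable_shift_complex (- a) cS; congr cmeas.
  by apply/funext => c; rewrite /Sa [c - a]addrC.
have iSa : cint Sa = (4 * d ^+ 2)%:E.
  rewrite (cint_shift a cSa Sa0) -iS; apply: eq_cint => c.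
  by rewrite /Sa addrC addKr.
have dha z : sq d z -> cdiff (fun z => h (a + z)) z (h' (a + z)).
  by move=> Sz; apply: cdiff_shift; apply: dh; rewrite addrC addKr.
have L1 : ((d ^+ 2 / 8 * cabs (h a))%:E <= cint (fun c => (H c)%:E))%E.
  rewrite (cint_shift a cH (fun c => H0 c)).
  have := square_area_mean d0 dha; rewrite addr0.
  have -> : (fun c => (if `[< sq d c >] then cabs (h (a + c)) else 0)%:E) = (fun c => (H (a + c))%:E).
    by apply/funext => c; rewrite /H [a + c - a]addrC addKr.
  by apply; exact: measurable_shift_complex a cH.
have J0 : (0 <= cint (fun c => (H c `^ p)%:E))%E by exact: cint_ge0.
case EJ : (cint (fun c => (H c `^ p)%:E)) J0 => [r||//]; last first.
  by move=> _; rewrite gt0_muley ?leey// lte_fin divr_gt0 ?Kmean_gt0// exprn_gt0.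
rewrite lee_fin => r0; rewrite -EFinM lee_fin.
have B l : 0 < l -> cabs (h a) <= 32 * l + l `^ (1 - p) * (8 / d ^+ 2 * r).
  move=> l0; have l10 : 0 <= l `^ (1 - p) by exact: powR_ge0.
  have : ((d ^+ 2 / 8 * cabs (h a))%:E <= (l * (4 * d ^+ 2) + l `^ (1 - p) * r)%:E)%E.
    apply: le_trans L1 _; apply: le_trans (_ : cint (fun c => l%:E * Sa c + (l `^ (1 - p))%:E * (H c `^ p)%:E) <= _)%E.
      apply: le_cint => c; first by rewrite lee_fin.
      rewrite /Sa /H -!EFinM -EFinD lee_fin; case: ifP => _.
        by rewrite mulr1 [X in _ <= _ + X]mulrC; exact: (le_young_split p1 (cabs_ge0 (h c)) l0).
      by rewrite mulr0 add0r mulr_ge0 ?powR_ge0.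
    rewrite cintD.
    - by rewrite (cintZ cSa Sa0 (ltW l0)) (cintZ cHp Hp0 l10) iSa EJ -!EFinM -EFinD.
    - by apply/measurable_EFinP; apply: measurable_funM => //; exact/measurable_EFinP.
    - by apply/measurable_EFinP; apply: measurable_funM => //; exact/measurable_EFinP.
    - by move=> c; rewrite mule_ge0// lee_fin ltW.
    - by move=> c; rewrite mule_ge0.
  rewrite lee_fin => h1; have d2 : 0 < d ^+ 2 by rewrite exprn_gt0.
  rewrite -(@ler_pM2l _ (d ^+ 2 / 8)) ?divr_gt0//; apply: le_trans h1 _.
  rewrite le_eqVlt; apply/orP; left; apply/eqP; field.
  by rewrite gt_eqF.
have J8 : 0 <= 8 / d ^+ 2 * r by rewrite mulr_ge0// divr_ge0// exprn_ge0// ltW.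
have := power_of_linear_bounds p1 (cabs_ge0 (h a)) _ J8 B; rewrite /Kmean => h1.
apply: le_trans (h1 _) _ => //; rewrite le_eqVlt; apply/orP; left; apply/eqP; field.
by rewrite gt_eqF.
Qed.

Definition qbox n (a : 'rV[C]_n) (d : R) : set 'rV[C]_n := [set z | forall k, sq d (z 0 k - a 0 k)].

Lemma row_mx0E n (c : C) (z : 'rV[C]_n) : (row_mx (const_mx c : 'rV[C]_1) z : 'rV[C]_n.+1) 0 0 = c.
Proof.
have -> : (0 : 'I_n.+1) = lshift n (0 : 'I_1) :> 'I_(1 + n) by apply/val_inj.
by rewrite (@row_mxEl _ 1 1 n) mxE.
Qed.

Lemma row_mxSE n (c : C) (z : 'rV[C]_n) j :
  (row_mx (const_mx c : 'rV[C]_1) z : 'rV[C]_n.+1) 0 (lift ord0 j) = z 0 j.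
Proof.
have -> : lift ord0 j = rshift 1 j :> 'I_(1 + n) by apply/val_inj.
by rewrite (@row_mxEr _ 1 1 n).
Qed.

(** Induction on n: the one-variable inequality in the first coordinate with the others at their
    centre, then the induction hypothesis on each slice. Differentiability in each coordinate
    separately is what both steps consume. *)
Lemma box_Lp_mean n (f : 'rV[C]_n -> C) (a : 'rV[C]_n) (d : R) : 0 < d ->
  (forall z, qbox a d z -> forall k, exists l,
     cdiff (fun t => f (z + t *: (delta_mx 0 k : 'rV[C]_n))) 0 l) ->
  let F := fun z => if `[< qbox a d z >] then cabs (f z) else 0 in
  measurable_fun setT (F : Mn n -> mR) ->
  (((cabs (f a)) `^ p)%:E <= ((Kmean / d ^+ 2) ^+ n)%:E * vint (fun z => (F z `^ p)%:E))%E.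
Proof.
elim: n f a => [|n IH] f a d0 df F mF.
  rewrite expr0 mul1e; change ((((cabs (f a)) `^ p)%:E <= (F 0 `^ p)%:E)%E).
  rewrite /F asboolT; last by case.
  by rewrite (_ : a = 0)//; apply/rowP => -[].
have K0 : 0 <= Kmean / d ^+ 2 by rewrite divr_ge0 ?exprn_ge0 ?ltW ?Kmean_gt0.
pose a0 := a 0 0; pose a' : 'rV[C]_n := \row_j a 0 (lift ord0 j).
pose gl (c : C) (z : 'rV[C]_n) : 'rV[C]_n.+1 := row_mx (const_mx c : 'rV[C]_1) z.
have glP (z : 'rV[C]_n.+1) (w : 'rV[C]_n.+1) : z 0 0 = w 0 0 ->
    (forall j, z 0 (lift ord0 j) = w 0 (lift ord0 j)) -> z = w.
  by move=> e0 e1; apply/rowP => k; case: (unliftP ord0 k) => [j ->|->].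
have addE m (x y : 'rV[C]_m) t k : (x + t *: y) 0 k = x 0 k + t * y 0 k by rewrite !mxE.
have d1 j : (delta_mx 0 (lift ord0 j) : 'rV[C]_n.+1) 0 0 = 0 by rewrite mxE.
have d2 i j : (delta_mx 0 (lift ord0 j) : 'rV[C]_n.+1) 0 (lift ord0 i) =
   (delta_mx 0 j : 'rV[C]_n) 0 i by rewrite !mxE (inj_eq lift_inj).
have d3 : (delta_mx 0 ord0 : 'rV[C]_n.+1) 0 0 = 1 by rewrite mxE.
have d4 i : (delta_mx 0 ord0 : 'rV[C]_n.+1) 0 (lift ord0 i) = 0 by rewrite mxE.
have aE : gl a0 a' = a.
  by apply: glP => [|j]; rewrite ?row_mx0E ?row_mxSE ?mxE.
have qb c z : sq d (c - a0) -> qbox a' d z -> qbox a d (gl c z).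
  move=> Sc Qz k; case: (unliftP ord0 k) => [j ->|->]; last by rewrite row_mx0E.
  by rewrite row_mxSE; have := Qz j; rewrite mxE.
have bq c z : sq d (c - a0) -> qbox a d (gl c z) -> qbox a' d z.
  by move=> Sc Q j; have := Q (lift ord0 j); rewrite row_mxSE mxE.
have Sq0 : sq d (0 : C) by exact: sq0.
have Qa' : qbox a' d a' by move=> k; rewrite subrr.
have Fp0 z : (0 <= (F z `^ p)%:E)%E by rewrite lee_fin powR_ge0.
have mFp : vmeas (fun z => (F z `^ p)%:E).
  by apply/measurable_EFinP; apply: (measurableT_comp (measurable_powR _) mF).
have step c : sq d (c - a0) ->
    (((cabs (f (gl c a'))) `^ p)%:E <= ((Kmean / d ^+ 2) ^+ n)%:E * vint (slice (fun z => (F z `^ p)%:E) c))%E.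
  move=> Sc; have FE z : (if `[< qbox a' d z >] then cabs (f (gl c z)) else 0) = F (gl c z).
    rewrite /F; case: (asboolP (qbox a' d z)) => Qz; first by rewrite asboolT//; exact: qb.
    by rewrite asboolF// => /(bq _ _ Sc).
  have := IH (fun z => f (gl c z)) a' d0.
  rewrite (_ : (fun z => if _ then _ else _) = (fun z => F (gl c z))); last by apply/funext => z; exact: FE.
  apply.
    move=> z Qz j; have [l hl] := df _ (qb _ _ Sc Qz) (lift ord0 j); exists l.
    move: hl; rewrite (_ : (fun t => _) = (fun t => f (gl c (z + t *: delta_mx 0 j))))//.
    apply/funext => t; congr f; apply: glP => [|i]; rewrite addE ?row_mx0E ?row_mxSE.
      by rewrite d1 mulr0 addr0.
    by rewrite d2 addE.
  have gm : measurable_fun setT (fun z : Mn n => gl c (z : 'rV[C]_n) : Mn n.+1).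
    by rewrite /gl; case: (c) => x y; apply: measurable_glue.
  exact: (measurableT_comp mF gm).
have dg c : sq d (c - a0) -> exists l, cdiff (fun c => f (gl c a')) c l.
  move=> Sc; have [l hl] := df _ (qb _ _ Sc Qa') ord0; exists l.
  have hc : cdiff (fun t => f (gl (c + t) a')) 0 l.
    move: hl; rewrite (_ : (fun t => f (_ + _)) = (fun t => f (gl (c + t) a')))//.
    apply/funext => t; congr f; apply: glP => [|i]; rewrite addE ?row_mx0E ?row_mxSE.
      by rewrite d3 mulr1.
    by rewrite d4 mulr0 addr0.
  have := @cdiff_shift _ (fun t => f (gl (c + t) a')) (- c) c l; rewrite addNr => /(_ hc).
  by rewrite (_ : (fun w => _) = (fun c => f (gl c a')))//; apply/funext => w; rewrite addrA subrr add0r.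
have /choice[h' hh'] : forall c, exists l, sq d (c - a0) -> cdiff (fun c => f (gl c a')) c l.
  move=> c; case: (pselect (sq d (c - a0))) => [/dg[l hl]|n0]; first by exists l.
  by exists 0.
have HE c : (if `[< sq d (c - a0) >] then cabs (f (gl c a')) else 0) = F (gl c a').
  rewrite /F; case: (asboolP (sq d (c - a0))) => Sc; first by rewrite asboolT//; exact: qb.
  by rewrite asboolF// => /(_ 0); rewrite row_mx0E.
have mH : measurable_fun setT (fun xy : mR * mR => F (gl (Complex xy.1 xy.2) a') : mR).
  apply: (measurableT_comp mF (g := fun xy : mR * mR => gl (Complex xy.1 xy.2) a' : Mn n.+1)).
  by apply: measurable_glue.
have := @square_Lp_mean (fun c => f (gl c a')) h' a0 d d0 hh'.
rewrite (_ : (fun c => if _ then _ else _) = (fun c => F (gl c a'))); last by apply/funext => c; exact: HE.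
move=> /(_ mH); rewrite aE => /le_trans; apply.
rewrite -(mule2_eq (esym (exprS (Kmean / d ^+ 2) n)) erefl).
apply: lee_wpmul2l; first by rewrite lee_fin.
rewrite vintS -(cintZ (cmeas_slice mFp Fp0) (fun c => vint_ge0 (fun z => Fp0 _)) (exprn_ge0 n K0)).
apply: le_cint => c //.
rewrite -HE; case: asboolP => Sc; first exact: step.
rewrite powR0 ?gt_eqF//; apply: mule_ge0; first by rewrite lee_fin exprn_ge0.
by apply: vint_ge0 => z; exact: Fp0.
Qed.

End MeanValue.

Section Evaluation.
Variables (R : realType) (n : nat) (p : R).
Local Notation C := (R[i]).
Local Notation Cn := ('rV[R[i]]_n).
Local Notation mR := (measurableTypeR R).
Local Notation Mn n := (g_sigma_algebraType (@coord_sets R n)).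
Implicit Types (f g : Cn -> C^o) (z w a : Cn).
Hypothesis p1 : 1 <= p.

Let p0 : 0 < p. Proof. exact: lt_le_trans p1. Qed.

Lemma measurable_qbox a (d : R) : measurable (qbox a d : set (Mn n)).
Proof.
rewrite -[qbox a d]setCK; apply: measurableC; apply: open_measurable_Mn => z nz.
have [k nk] : exists k, ~ sq d (z 0 k - a 0 k) by apply/not_existsP => H; apply: nz => k; apply: contrapT; exact: H.
pose e := Num.max (`|complex.Re (z 0 k - a 0 k)|) (`|complex.Im (z 0 k - a 0 k)|) - d.
have e0 : 0 < e.
  rewrite subr_gt0 ltNge; apply/negP => le; apply: nk; apply/sqP; move: le.
  by rewrite ge_max => /andP[].
exists e => // w wz Qw; have /sqP[w1 w2] := Qw k.
have wk : cabs (w 0 k - z 0 k) < e by apply: le_lt_trans wz; have := cabs_nrm1 (w - z) k; rewrite !mxE.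
have E : z 0 k - a 0 k = (w 0 k - a 0 k) - (w 0 k - z 0 k) by ring.
have h1 : `|complex.Re (z 0 k - a 0 k)| < d + e.
  rewrite E ReD ReN; apply: le_lt_trans (ler_normB _ _) _.
  by apply: ler_ltD => //; apply: le_lt_trans (ler_Re_cabs _) wk.
have h2 : `|complex.Im (z 0 k - a 0 k)| < d + e.
  rewrite E ImD ImN; apply: le_lt_trans (ler_normB _ _) _.
  by apply: ler_ltD => //; apply: le_lt_trans (ler_Im_cabs _) wk.
have : Num.max (`|complex.Re (z 0 k - a 0 k)|) (`|complex.Im (z 0 k - a 0 k)|) < d + e.
  by rewrite gt_max h1.
by rewrite /e subrKC ltxx.
Qed.

Lemma measurable_if_qbox a (d : R) (F : Cn -> R) : measurable_fun setT (F : Mn n -> mR) ->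
  measurable_fun setT ((fun z => if `[< qbox a d z >] then F z else 0) : Mn n -> mR).
Proof.
move=> mF; apply: (@measurable_fun_ifT _ _ (Mn n) mR) => //.
apply: (@measurable_fun_bool _ (Mn n) setT _ true).
rewrite setTI (_ : _ @^-1` _ = qbox a d); first exact: measurable_qbox.
by apply/seteqP; split => z /= /asboolP.
Qed.

Lemma qbox_near a z (d : R) : qbox a d z -> nrm1 (z - a) <= n%:R * (2 * d).
Proof.
move=> Q; rewrite mulr_natl -[X in _ *+ X]card_ord -sumr_const; apply: ler_sum => k _.
have := Q k; rewrite sqP !mxE => -[h1 h2]; apply: le_trans (cabs_le_ReIm _) _.
by rewrite mulr_natl mulr2n lerD.
Qed.

Lemma half_rho_le (A r Z : R) : 0 <= A -> A < 1 -> 0 < r -> r = 1 - A ^+ 2 -> 0 <= Z ->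
  Z <= A + r / 8 -> r / 2 <= 1 - Z ^+ 2.
Proof.
move=> A0 A1 r0 rE Z0 ZA.
have h : Z ^+ 2 <= (A + r / 8) ^+ 2 by rewrite ler_pXn2r ?nnegrE//; lra.
have Ar : A * r <= r by rewrite -[leRHS]mul1r ler_pM2r// ltW.
have r1 : r <= 1 by rewrite rE; have := sqr_ge0 A; lra.
have rr : r * r <= r by rewrite -[leRHS]mul1r ler_pM2r.
move: h; rewrite (_ : (A + r / 8) ^+ 2 = A ^+ 2 + A * r / 4 + r * r / 64); last by field.
lra.
Qed.

Lemma near_rho a z : Bn a -> nrm1 (z - a) <= rho a / 8 -> Bn z /\ psi z <= 2 * psi a.
Proof.
move=> Ba h; have r0 := rho_gt0 Ba; have a0 := normz_ge0 a.
have nz : normz z <= normz a + rho a / 8.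
  by rewrite -{1}(subrKC a z); apply: le_trans (normzD _ _) _; rewrite lerD2l (le_trans (normz_nrm1 _)).
have a1 : normz a < 1 by [].
have r1 : rho a <= 2 * (1 - normz a) by rewrite /rho; nra.
have z1 : normz z < 1 by lra.
split => //; rewrite !psiE; have z0 := normz_ge0 z.
have rz : rho a / 2 <= rho z by apply: (half_rho_le a0).
by rewrite -[2]invrK -invfM mulrC lef_pV2 ?posrE ?rho_gt0// divr_gt0.
Qed.

(** The mean value inequality on a box of half-side proportional to [rho a], on which psi <= 2
    psi(a). Removing exp(-psi) costs exp(2 psi(a)); the constant is of order psi(a)^(2n) and is
    absorbed in exp(2n psi(a)). Only exponential growth in psi matters later. *)
Lemma Ap_eval : exists2 C1 : R, 1 <= C1 & forall f a, holo f -> Bn a ->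
  (((cabs (f a)) `^ p)%:E <= (C1 * expR ((2 * n + 2)%:R * psi a))%:E * Apint p f)%E.
Proof.
pose K := Num.max 1 (Kmean p * (16 * n.+1%:R) ^+ 2).
have K1 : 1 <= K by rewrite le_max lexx.
have N0 : n.+1%:R != 0 :> R by rewrite pnatr_eq0.
exists (K ^+ n); first by rewrite exprn_ege1.
move=> f a hf Ba; have r0 := rho_gt0 Ba.
pose d := rho a / (16 * n.+1%:R); have d0 : 0 < d by rewrite divr_gt0 ?mulr_gt0.
have near z : qbox a d z -> Bn z /\ psi z <= 2 * psi a.
  move=> /qbox_near h; apply: near_rho => //; apply: le_trans h _.
  rewrite /d (_ : n%:R * _ = rho a / 8 * (n%:R / n.+1%:R)); last first.
    by move: N0; set N := n.+1%:R => N0; field.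
  rewrite -[leRHS]mulr1 ler_pM2l ?divr_gt0// ler_pdivrMr// mul1r ler_nat; exact: leqnSn.
have dfk z : qbox a d z -> forall k, exists l,
     cdiff (fun t => f (z + t *: (delta_mx 0 k : 'rV[C]_n))) 0 l.
  move=> /near[Bz _] k; exists (\sum_j (delta_mx 0 k : 'rV[C]_n) 0 j * dgrad f z j).
  by apply: fdiff_line; rewrite scale0r addr0; exact: holo_fdiff.
pose F z := if `[< qbox a d z >] then cabs (f z) else 0.
have mF : measurable_fun setT (F : Mn n -> mR).
  rewrite (_ : F = fun z => if `[< qbox a d z >] then (if normz z < 1 then cabs (f z) else 0) else 0).
    by apply: measurable_if_qbox; exact: measurable_holo.
  by apply/funext => z; rewrite /F; case: asboolP => // /near[-> _].
apply: le_trans (box_Lp_mean p1 d0 dfk mF) _.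
have w0 z : (0 <= winteg p (fun=> 1%R) f z)%E by exact: winteg_ge0.
have mw : vmeas (winteg p (fun=> 1%R) f) by apply: vmeas_winteg => //; exact: measurable_ball1.
have e0 : 0 <= expR (2 * psi a) by exact: expR_ge0.
have K2 : 0 <= Kmean p / d ^+ 2 by rewrite divr_ge0 ?exprn_ge0 ?ltW ?Kmean_gt0.
apply: le_trans (_ : ((Kmean p / d ^+ 2) ^+ n)%:E * ((expR (2 * psi a))%:E * Apint p f) <= _)%E.
  apply: lee_wpmul2l; first by rewrite lee_fin exprn_ge0.
  rewrite /Apint wintE -vintZ//; apply: le_vint => z; first by rewrite lee_fin powR_ge0.
  rewrite /F; case: asboolP => Qz; last first.
    by rewrite powR0 ?gt_eqF//; apply: mule_ge0.
  have [Bz hz] := near z Qz; rewrite /winteg Bz mulr1 -EFinM lee_fin mulrCA -expRD.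
  rewrite -[leLHS]mulr1; apply: ler_wpM2l; first exact: powR_ge0.
  by rewrite -[leLHS]expR0 ler_expR subr_ge0.
rewrite muleA -EFinM; apply: lee_wpmul2r; first exact: vint_ge0.
have E : expR ((2 * n + 2)%:R * psi a) = expR (2 * n%:R * psi a) * expR (2 * psi a).
  by rewrite -expRD -mulrDl natrD natrM.
rewrite lee_fin E [leRHS]mulrA ler_pM2r ?expR_gt0//.
have -> : expR (2 * n%:R * psi a) = (expR (psi a) ^+ 2) ^+ n.
  by rewrite -exprM -expRM_natl natrM.
rewrite -exprMn lerXn2r ?nnegrE//; first by rewrite mulr_ge0 ?exprn_ge0 ?expR_ge0//; lra.
have -> : Kmean p / d ^+ 2 = Kmean p * (16 * n.+1%:R) ^+ 2 * psi a ^+ 2.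
  by rewrite /d psiE expr_div_n invf_div mulrA exprVn.
have psi0 : 0 <= psi a by apply: le_trans (psi_ge1 Ba).
apply: ler_pM.
- by apply: mulr_ge0; [exact/ltW/Kmean_gt0|rewrite exprn_ge0// mulr_ge0].
- exact: exprn_ge0.
- by rewrite le_max lexx orbT.
- by rewrite ler_pXn2r ?nnegrE ?expR_ge0//; have := expR_ge1Dx (psi a); lra.
Qed.

(** The ball lies in this box, so [4 ^+ n] bounds its volume, which [Apint_cst1] uses. *)
Lemma vint_unit_box m :
  (vint (fun z : 'rV[C]_m => (if `[< qbox 0 1 z >] then 1 else 0)%R%:E) <= (4 ^+ m)%:E :> \bar R)%E.
Proof.
elim: m => [|m IH].
  change (((if `[< qbox (0 : 'rV[C]_0) 1 0 >] then 1 else 0)%R%:E <= (1 : R)%:E)%E).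
  by rewrite lee_fin; case: ifP.
have [cS iS] := @cint_square R 1 ltr01.
have S0 (c : C) : (0 <= (if `[< sq 1 c >] then 1 else 0)%R%:E :> \bar R)%E by rewrite lee_fin; case: ifP.
rewrite vintS exprSr; apply: le_trans (_ : cint (fun c => (4 ^+ m)%:E * (if `[< sq 1 c >] then 1 else 0)%R%:E) <= _)%E; last first.
  by rewrite (cintZ cS S0) ?exprn_ge0// iS -EFinM expr1n mulr1.
apply: le_cint => c; first by apply: vint_ge0 => z; rewrite lee_fin; case: ifP.
case: asboolP => Sc.
  rewrite mule1; apply: le_trans IH; apply: le_vint => z; rewrite lee_fin; first by case: ifP.
  case: asboolP => Q; case: asboolP => Q' //; exfalso; apply: Q' => k.
  by have := Q (lift ord0 k); rewrite row_mxSE !mxE.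
rewrite mule0; apply: le_trans (_ : vint (fun z : 'rV[C]_m => 0%:E * 0%E) <= _)%E.
  apply: le_vint => z; first by rewrite lee_fin; case: ifP.
  rewrite mul0e lee_fin; case: asboolP => // /(_ 0); rewrite row_mx0E mxE subr0 => h; case: (Sc h).
rewrite vintZ ?mul0e//; exact: measurable_cst.
Qed.

Lemma Apint_cst1 : (Apint p (fun _ : Cn => 1%R : C^o) <= (4 ^+ n)%:E)%E.
Proof.
apply: le_trans (vint_unit_box n); apply: le_vint => z; first exact: winteg_ge0.
rewrite /winteg; case: ifPn => [Bz|_]; last by rewrite lee_fin; case: ifP.
have -> : `[< qbox 0 1 z >].
  apply/asboolP => k; rewrite sqP mxE subr0; have h := le_trans (cabs_normz z k) (ltW Bz).
  by split; [apply: le_trans (ler_Re_cabs _) h|apply: le_trans (ler_Im_cabs _) h].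
rewrite lee_fin cabs1 powR1 mul1r mulr1 -expR0 ler_expR oppr_le0.
by apply: le_trans (psi_ge1 Bz).
Qed.

Lemma le_psi z w : normz z <= normz w -> Bn w -> psi z <= psi w.
Proof.
move=> zw Bw; have Bz : Bn z by exact: le_lt_trans Bw.
rewrite !psiE lef_pV2 ?posrE ?rho_gt0// lerD2l lerN2 ler_pXn2r ?nnegrE ?normz_ge0//.
Qed.

Lemma Apint_ge0 f : (0 <= Apint p f)%E.
Proof. by apply: vint_ge0; exact: winteg_ge0. Qed.

Lemma Bn_scale (l : C) z : cabs l <= 1 -> Bn z -> Bn (l *: z).
Proof.
rewrite /Bn/= normzZ => l1; apply: le_lt_trans.
by rewrite -[leRHS]mul1r; apply: ler_wpM2r => //; exact: normz_ge0.
Qed.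

(** Substitute w = l z: psi(lz) <= psi(z), and the Jacobian |l|^(-2n) is at most 4^n. *)
Lemma Apint_dilate f (l : C) : holo f -> 2^-1 <= cabs l <= 1 ->
  (Apint p (fun z => f (l *: z)%R : C^o) <= (4 ^+ n)%:E * Apint p f)%E.
Proof.
move=> hf /andP[l2 l1]; have lp : 0 < cabs l by apply: lt_le_trans l2.
have l0 : l != 0 by rewrite -cabs_gt0.
have w0 z : (0 <= winteg p (fun=> 1%R) f z)%E by exact: winteg_ge0.
have mw : vmeas (winteg p (fun=> 1%R) f) by apply: vmeas_winteg => //; exact: measurable_ball1.
rewrite /Apint !wintE (vint_scale l0 mw w0) muleA -EFinM.
apply: le_trans (_ : vint (fun z => winteg p (fun=> 1%R) f (l *: z)%R) <= _)%E.
  apply: le_vint => z; first exact: winteg_ge0.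
  rewrite {1}/winteg; case: ifPn => [Bz|_]; last exact: w0.
  have Blz : Bn (l *: z) by exact: Bn_scale.
  rewrite /winteg Blz lee_fin !mulr1; apply: ler_wpM2l; first exact: powR_ge0.
  rewrite ler_expR lerN2; apply: le_psi => //; rewrite normzZ -[leRHS]mul1r.
  by apply: ler_wpM2r => //; exact: normz_ge0.
rewrite -[leLHS]mul1e; apply: lee_wpmul2r; first by apply: vint_ge0 => z; exact: w0.
rewrite lee_fin mulrC exprM -exprMn exprn_ege1//.
have : (2^-1) ^+ 2 <= cabs l ^+ 2 by rewrite ler_pXn2r ?nnegrE ?cabs_ge0.
by rewrite expr2; lra.
Qed.

Lemma Apint_scale f (l : C) : holo f -> Apint p (fun z => (l * f z)%R : C^o) = ((cabs l `^ p)%:E * Apint p f)%E.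
Proof.
move=> hf; rewrite /Apint !wintE -vintZ ?powR_ge0//; last 2 first.
- by apply: vmeas_winteg => //; exact: measurable_ball1.
- exact: winteg_ge0.
apply: eq_vint => z; rewrite /winteg; case: ifP => _; last by rewrite mule0.
by rewrite cabsM powRM ?cabs_ge0// -EFinM; congr EFin; ring.
Qed.

Lemma le_Apint f g : (forall z, Bn z -> cabs (f z) <= cabs (g z)) -> (Apint p f <= Apint p g)%E.
Proof.
move=> fg; apply: le_vint => z; first exact: winteg_ge0.
rewrite /winteg; case: ifPn => // Bz; rewrite lee_fin !mulr1; apply: ler_wpM2r; first exact: expR_ge0.
by apply: ge0_ler_powR; rewrite ?nnegrE ?cabs_ge0 ?fg// ltW.
Qed.

End Evaluation.

(** * The integration operator *)

Section CompactBalls.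
Variables (R : realType) (n : nat).
Local Notation C := (R[i]).
Local Notation Cn := ('rV[R[i]]_n).
Implicit Types (z w : Cn).

Lemma compact_sq (d : R) : compact (sq d : set (C^o)).
Proof.
have -> : (sq d : set C^o) = (fun xy : R * R => Complex xy.1 xy.2 : C^o) @` (`[- d, d]%classic `*` `[- d, d]%classic).
  apply/seteqP; split => [[x y] [/= hx hy]|_ [[x y] [/= hx hy] <-]].
    by exists (x, y) => //; split; rewrite /= in_itv.
  by move: hx hy; rewrite !in_itv.
apply: continuous_compact; last by apply: compact_setX; exact: segment_compact.
apply: continuous_subspaceT => -[x y] A /nbhs_ballP[e /= e0 eA].
have [r r0 rE] := gt0_complex e0; have r2 : 0 < r / 2 by rewrite divr_gt0.
exists (ball x (r / 2), ball y (r / 2)); first by split; exact: nbhsx_ballx.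
move=> [x' y'] [/= hx hy]; apply: eA; rewrite /ball/= rE norm_cabs ltcR.
apply: le_lt_trans (cabs_le_ReIm _) _; rewrite /= [ltRHS]splitr.
exact: ltrD.
Qed.

Lemma compact_cball (s : R) : compact ([set z | normz z <= s] : set (@CnN R n)).
Proof.
apply: (@subclosed_compact _ _ [set v : 'rV[C^o]_n | forall i, sq s (v ord0 i)]).
- move=> z H /=; rewrite leNgt; apply/negP => sz.
  have [] := H [set w : @CnN R n | s < normz w].
    apply/nbhs_nrm1P; exists (normz z - s); first by rewrite subr_gt0.
    move=> w wz /=; have := normzD (z - w) w; rewrite subrK; have := normz_nrm1 (z - w).
    by rewrite -nrm1N opprB; lra.
  by move=> w [/= h1 h2]; move: (le_lt_trans h1 h2); rewrite ltxx.
- by apply: (@rV_compact (R[i])^o n (fun=> sq s)) => _; exact: compact_sq.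
move=> z /= zs i; rewrite sqP; have h := le_trans (cabs_normz z i) zs.
by split; [apply: le_trans (ler_Re_cabs _) h|apply: le_trans (ler_Im_cabs _) h].
Qed.

Lemma compact_local_bound (K : set (@CnN R n)) (F : Cn -> R) : compact K ->
  (forall z, K z -> exists d M : R, 0 < d /\ forall w, nrm1 (w - z) < d -> F w <= M) ->
  exists M, forall z, K z -> F z <= M.
Proof.
move=> /compact_near_coveringP cK H.
suff : \forall M \near +oo, K `<=` (fun z => F z <= M).
  by move=> H1; have [M hM] := @filter_ex _ (pinfty_nbhs R) _ _ H1; exists M.
apply: cK => z Kz; have [d [M [d0 hd]]] := H z Kz.
exists ([set w | nrm1 (w - z) < d], [set M' | M < M']).
  by split; [apply/nbhs_nrm1P; exists d|by exists M; split; [exact: num_real|]].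
by move=> [w M'] [/= /hd h1 h2]; apply: le_trans h1 (ltW h2).
Qed.

Lemma holo_bounded_cball (f : Cn -> C^o) (s : R) : holo f -> s < 1 ->
  exists M, forall z, normz z <= s -> cabs (f z) <= M.
Proof.
move=> hf s1.
have [|M hM] := @compact_local_bound [set z | normz z <= s] (fun z => cabs (f z)) (@compact_cball s).
  move=> z /= zs; have [r [M [r0 _ rM]]] := holo_locally_bounded hf (le_lt_trans zs s1).
  by exists r, M.
by exists M.
Qed.

(** [psi] is locally bounded on the ball, hence bounded on K, which keeps K away from the sphere. *)
Lemma compact_normz_lt1 (K : set (@CnN R n)) : compact K -> K `<=` @Bn R n ->
  exists2 s : R, 0 <= s < 1 & forall z, K z -> normz z <= s.
Proof.
move=> cK KB.
have [|M hM] := @compact_local_bound K (fun z => psi z) cK; last first.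
  exists (Num.max 0 (1 - (Num.max 1 M)^-1 / 2)).
    rewrite le_max lexx gt_max ltr01/= gtrBl divr_gt0// invr_gt0 lt_max ltr01//.
  move=> z Kz; have Bz := KB z Kz; rewrite le_max; apply/orP; right.
  have M1 : psi z <= Num.max 1 M by rewrite le_max hM// orbT.
  have rz : (Num.max 1 M)^-1 <= rho z.
    by rewrite -[leRHS]invrK -psiE lef_pV2 ?posrE// ?lt_max ?ltr01// (lt_le_trans ltr01)// psi_ge1.
  have : rho z <= 2 * (1 - normz z).
    rewrite /rho; have z1 : normz z < 1 by []. 
    have : 0 <= (1 - normz z) * (1 - normz z) by rewrite mulr_ge0// subr_ge0 ltW.
    by rewrite expr2; lra.
  lra.
move=> z Kz; have Bz := KB z Kz.
exists (rho z / 8 / 1), (2 * psi z); split; first by rewrite !divr_gt0// rho_gt0.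
by move=> w wz; apply: (near_rho Bz _).2; move: wz; rewrite divr1 => /ltW.
Qed.

End CompactBalls.


Section Kernel.
Variables (R : realType) (n : nat).
Local Notation C := (R[i]).
Local Notation Cn := ('rV[R[i]]_n).
Implicit Types (z w l : Cn) (f g : Cn -> C^o).

Lemma ccI_ray f z (a b : R) : holo f -> Bn z -> 0 <= a -> b <= 1 ->
  ccI (fun t => f (t%:C%C *: z)) a b.
Proof.
move=> hf Bz a0 b1 t /andP[at0 tb] e e0.
have Bt : Bn (t%:C%C *: z).
  by apply: Bn_scale => //; rewrite cabsE_real ger0_norm ?(le_trans tb)// (le_trans a0).
have [d d0 H] := fdiff_cont (holo_fdiff hf Bt) e0.
exists (d / (nrm1 z + 1)); first by rewrite divr_gt0// ltr_wpDl// nrm1_ge0.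
move=> s sab st; apply: H; rewrite -scalerBl -rmorphB nrm1Z cabsE_real.
apply: le_lt_trans (_ : `|s - t| * (nrm1 z + 1) < _); first by rewrite ler_wpM2l// lerDl.
by rewrite -ltr_pdivlMr// ltr_wpDl// nrm1_ge0.
Qed.

Lemma ccI_sum (I : Type) (r : seq I) (F : I -> R -> C) a b : (forall k, ccI (F k) a b) ->
  ccI (fun t => \sum_(k <- r) F k t) a b.
Proof.
move=> cF; elim: r => [|k r IH].
  by under eq_fun do rewrite big_nil; exact: ccI_cst.
by under eq_fun do rewrite big_cons; exact: ccID.
Qed.

(* The integrand of V_g with the division by t carried out; unlike the one in [Vop]
   it has no junk value at t = 0. *)
Definition Gker g f (t : R) z : C := \sum_j z 0 j * (f (t%:C%C *: z) * dgrad g (t%:C%C *: z) j).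

Lemma ccI_Gker g f z : holo g -> holo f -> Bn z -> ccI (Gker g f ^~ z) 0 1.
Proof.
move=> hg hf Bz; apply: ccI_sum => j; apply: ccIZ.
by apply: (ccI_ray (f := fun w => f w * dgrad g w j : C^o)) => //; apply: holoM => //; exact: holo_dgrad.
Qed.

Lemma Gker_eq g f t z : t != 0 ->
  Gker g f t z = f (t%:C%C *: z) * Rder g (t%:C%C *: z) / t%:C%C.
Proof.
move=> t0; have tC : t%:C%C != 0 :> C by rewrite -cabs_gt0 cabsE_real normr_gt0.
rewrite /Gker RderE mulr_sumr mulr_suml; apply: eq_bigr => j _.
by rewrite !mxE; field.
Qed.

(** A single point is a null set, so the integral ignores t = 0, where the division in [Vop] returns
    a default value. *)
Lemma Rintegral_Ioc_eq (h G : R -> R) : contI G 0 1 -> (forall t, t != 0 -> h t = G t) ->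
  Rintegral lebesgue_measure `[0, 1] h = ri G 0 1.
Proof.
move=> cG hG; have iG := contI_integrable cG.
have iG' : lebesgue_measure.-integrable `]0, 1] (EFin \o G).
  by apply: integrableS iG => //; apply: subset_itvr; rewrite bnd_simp.
have eq01 : {in `]0, 1]%classic, h =1 G}.
  by move=> x; rewrite inE/= in_itv/= => /andP[x0 _]; apply: hG; rewrite gt_eqF.
rewrite -Rintegral_itv_obnd_cbnd; last first.
  by apply: eq_integrable iG' => // x xI /=; rewrite eq01.
transitivity (Rintegral lebesgue_measure `]0, 1] G); first exact: eq_Rintegral.
exact: Rintegral_itv_obnd_cbnd.
Qed.

Lemma VopE g f z : holo g -> holo f -> Bn z -> Vop g f z = ci (Gker g f ^~ z) 0 1.
Proof.
move=> hg hf Bz; have cG := ccI_Gker hg hf Bz; apply: complex_eqP => /=.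
  by apply: Rintegral_Ioc_eq; [exact: ccI_Re|move=> t t0; rewrite Gker_eq].
by apply: Rintegral_Ioc_eq; [exact: ccI_Im|move=> t t0; rewrite Gker_eq].
Qed.

Lemma cabs_VopB g f z (M : R) : holo g -> holo f -> Bn z ->
  (forall t, 0 <= t <= 1 -> cabs (Gker g f t z) <= M) -> cabs (Vop g f z) <= 2 * M.
Proof.
move=> hg hf Bz H; rewrite VopE//; have := cabs_ci_bound ler01 (ccI_Gker hg hf Bz) H.
by rewrite subr0 mulr1.
Qed.

Lemma VopB g f1 f2 z : holo g -> holo f1 -> holo f2 -> Bn z ->
  Vop g (fun w => f1 w - f2 w) z = Vop g f1 z - Vop g f2 z.
Proof.
move=> hg h1 h2 Bz.
have h3 : holo (fun w => -1 * f2 w : C^o) by apply: holoM => //; exact: holo_cst.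
have E w : f1 w - f2 w = f1 w + -1 * f2 w by rewrite mulN1r.
have hD : holo (fun w => f1 w - f2 w : C^o) by under eq_fun do rewrite E; exact: holoD.
rewrite (VopE hg h1 Bz) (VopE hg h2 Bz) (VopE hg hD Bz).
rewrite -mulN1r -ciZ; last exact: ccI_Gker.
rewrite -ciD; [|exact: ccI_Gker|exact/ccIZ/ccI_Gker].
apply: eq_ci => t _; rewrite /Gker mulr_sumr -big_split/=; apply: eq_bigr => j _; ring.
Qed.

Lemma ri_subst (G : R -> R) (s : R) : 0 < s -> contI G 0 s ->
  ri (fun t => s * G (s * t)) 0 1 = ri G 0 s.
Proof.
move=> s0 cG; pose F t : R := s * t.
have dF (x : R) : is_derive x (1 : R) F s.
  by rewrite /F; apply: is_derive_eq; rewrite /GRing.scale/= ?mulr0 ?addr0 ?add0r mulr1.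
have DF : F^`() = cst s by apply/funext => x; rewrite derive1E; have [_ ->] := dF x.
have E := @integration_by_substitution_increasing R F G 0 1 ler01.
have -> : ri G 0 s = fine (\int[lebesgue_measure]_(x in `[F 0%R, F 1%R]) (G x)%:E)%E.
  by rewrite /F mulr0 mulr1.
rewrite E; last by rewrite /F mulr0 mulr1.
- rewrite /ri /Rintegral; congr fine.
  by apply: eq_integral => x _ /=; rewrite DF/= mulrC.
- by move=> x y _ _ xy; rewrite /F ltr_pM2l.
- by rewrite DF => x _; exact: cvg_cst.
- by rewrite DF; apply: is_cvg_cst.
- by rewrite DF; apply: is_cvg_cst.
- split => [x _||]; first by have [] := dF x.
    apply: cvg_at_right_filter; apply: differentiable_continuous; apply/derivable1_diffP; by have [] := dF 0.
  apply: cvg_at_left_filter; apply: differentiable_continuous; apply/derivable1_diffP; by have [] := dF 1.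
Qed.

Lemma Gker_scale g f (s t : R) z : Gker g f t (s%:C%C *: z) = s%:C%C * Gker g f (s * t) z.
Proof.
rewrite /Gker mulr_sumr; apply: eq_bigr => j _.
by rewrite scalerA -rmorphM [t * s]mulrC mxE mulrA.
Qed.

(** Along a fixed ray the kernel does not change with the endpoint, so V_g is there an indefinite
    integral. [Rder_Vop] differentiates it and [Vop_half] splits it. *)
Lemma Vop_ray g f z (s : R) : holo g -> holo f -> Bn z -> 0 < s <= 1 ->
  Vop g f (s%:C%C *: z) = ci (Gker g f ^~ z) 0 s.
Proof.
move=> hg hf Bz /andP[s0 s1]; have Bs : Bn (s%:C%C *: z).
  by apply: Bn_scale => //; rewrite cabsE_real gtr0_norm.
rewrite (VopE hg hf Bs).
transitivity (ci (fun t => s%:C%C * Gker g f (s * t) z) 0 1).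
  by apply: eq_ci => t _; exact: Gker_scale.
have c0 : ccI (Gker g f ^~ z) 0 s by apply: ccI_sub (ccI_Gker hg hf Bz).
apply: complex_eqP => /=.
  rewrite -(ri_subst s0 (ccI_Re c0)); apply: eq_ri => t _.
  by rewrite Re_mulE /= mul0r subr0.
rewrite -(ri_subst s0 (ccI_Im c0)); apply: eq_ri => t _.
by rewrite Im_mulE /= mul0r addr0.
Qed.

End Kernel.

Section IntegrationOperator.
Variables (R : realType) (n : nat).
Local Notation C := (R[i]).
Local Notation Cn := ('rV[R[i]]_n).
Implicit Types (z w l : Cn) (f g : Cn -> C^o).

Lemma ci_sum (I : Type) (r : seq I) (F : I -> R -> C) a b : (forall k, ccI (F k) a b) ->
  ci (fun t => \sum_(k <- r) F k t) a b = \sum_(k <- r) ci (F k) a b.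
Proof.
move=> cF; elim: r => [|k r IH].
  under eq_ci do rewrite big_nil.
  rewrite big_nil; apply: complex_eqP => /=; rewrite /ri /Rintegral integral0_eq//.
under eq_ci do rewrite big_cons; rewrite big_cons ciD ?IH//; exact: ccI_sum.
Qed.

Lemma holo_Gker g f (t : R) : 0 <= t <= 1 -> holo g -> holo f -> holo (Gker g f t : Cn -> C^o).
Proof.
move=> /andP[t0 t1] hg hf; apply: (@holo_sum _ _ _ _ (fun j z => z 0 j * (f (t%:C%C *: z) * dgrad g (t%:C%C *: z) j) : C^o)) => j.
apply: holoM; first exact: holo_coord.
apply: (@holo_scale _ _ (fun w => f w * dgrad g w j : C^o)); first by rewrite cabsE_real ger0_norm.
by apply: holoM => //; exact: holo_dgrad.
Qed.

Lemma Gker_bounded g f (s : R) : holo g -> holo f -> s < 1 ->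
  exists M, forall z (t : R), normz z <= s -> 0 <= t <= 1 -> cabs (Gker g f t z) <= M.
Proof.
move=> hg hf s1.
have hF j : holo (fun w => f w * dgrad g w j : C^o) by apply: holoM => //; exact: holo_dgrad.
have /choice[M hM] j := holo_bounded_cball (hF j) s1.
exists (\sum_j M j) => z t zs /andP[t0 t1]; apply: le_trans (cabs_sum _) _.
apply: ler_sum => j _; rewrite cabsM -[leRHS]mul1r.
apply: ler_pM; rewrite ?cabs_ge0//; first by apply: le_trans (cabs_normz _ _) (le_trans zs (ltW s1)).
apply: hM; apply: le_trans zs; rewrite normzZ cabsE_real ger0_norm// -[leRHS]mul1r.
by apply: ler_wpM2r => //; exact: normz_ge0.
Qed.

(** Replaces differentiation under the integral sign. The kernel satisfies [quad] with constants
    uniform in t, and [quad] bounds an expression linear in finitely many values, so it can be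
    integrated over t at the cost of a factor 2. *)
Lemma quad_Vop g f z : holo g -> holo f -> Bn z -> exists r K, [/\ 0 < r, 0 <= K & quad (Vop g f) z r K].
Proof.
move=> hg hf Bz; have z1 : normz z < 1 by [].
pose r : R := (1 - normz z) / 2; have r0 : 0 < r by rewrite divr_gt0// subr_gt0.
have [M hM] := @Gker_bounded g f ((1 + normz z) / 2) hg hf (ltac:(lra)).
have nw w : nrm1 (w - z) <= r -> normz w <= (1 + normz z) / 2.
  move=> wz; rewrite -[w](subrK z); apply: le_trans (normzD _ _) _.
  have := normz_nrm1 (w - z); rewrite /r in wz; lra.
have Bw w : nrm1 (w - z) <= r -> Bn w by move=> /nw h; apply: le_lt_trans h _; lra.
have M0 : 0 <= M.
  apply: le_trans (hM z 0 _ _); [exact: cabs_ge0| |by rewrite lexx ler01].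
  by apply: nw; rewrite subrr nrm10 ltW.
pose K := 2 * (64 * (128 * M / r) / (r / 4)).
have Q t : 0 <= t <= 1 -> quad (Gker g f t : Cn -> C^o) z (r / 4) K.
  move=> t01; apply: fdiff_quad => // w /ltW wr; last exact/hM/t01/nw.
  by exists (dgrad (Gker g f t : Cn -> C^o) w); apply: holo_fdiff (Bw _ wr); exact: holo_Gker.
exists (r / 4), (2 * K); split; [by rewrite divr_gt0|by rewrite mulr_ge0// taylor_constant_ge0|].
move=> l s lr sr; have /andP[s0 s1] := sr.
have Bl : Bn (z + l) by apply: Bw; rewrite addrC addKr; lra.
have Bs k : Bn (z + s%:C%C *: (delta_mx 0 k : Cn)).
  by apply: Bw; rewrite addrC addKr nrm1Z nrm1_delta mulr1 cabsE_real gtr0_norm//; lra.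
have cG w : Bn w -> ccI (Gker g f ^~ w) 0 1 by exact: ccI_Gker.
have c1 w : Bn w -> ccI (fun t => -1 * Gker g f t w) 0 1 by move=> /cG h; exact: ccIZ.
(* The expression bounded by [quad], rewritten with sums and scalar multiples only, so that
   linearity of [ci] applies term by term. *)
pose Q1 t := (Gker g f t (z + l) + -1 * Gker g f t z)
  + \sum_k (- (l 0 k / s%:C%C)) * (Gker g f t (z + s%:C%C *: (delta_mx 0 k : Cn)) + -1 * Gker g f t z).
have cQ2 k : ccI (fun t => (- (l 0 k / s%:C%C)) * (Gker g f t (z + s%:C%C *: (delta_mx 0 k : Cn)) + -1 * Gker g f t z)) 0 1.
  by apply: ccIZ; apply: ccID; [exact: cG|exact: c1].
have cQ1 : ccI Q1 0 1 by apply: ccID; [apply: ccID; [exact: cG|exact: c1]|exact: ccI_sum].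
have E (h : Cn -> C) : h (z + l) - h z - \sum_k l 0 k * dquo h s z k = (h (z + l) + -1 * h z)
  + \sum_k (- (l 0 k / s%:C%C)) * (h (z + s%:C%C *: (delta_mx 0 k : Cn)) + -1 * h z).
  rewrite mulN1r; congr (_ + _); rewrite -sumrN; apply: eq_bigr => k _; rewrite /dquo.
  by rewrite mulNr mulrA mulrAC.
have -> : Vop g f (z + l) - Vop g f z - \sum_k l 0 k * dquo (Vop g f) s z k = ci Q1 0 1.
  have VE := VopE hg hf; move: (Vop g f) VE => V VE; rewrite (E V).
  rewrite (VE _ Bl) (VE _ Bz) /Q1 (ciD (ccID (cG _ Bl) (c1 _ Bz)) (ccI_sum _ cQ2)).
  rewrite (ciD (cG _ Bl) (c1 _ Bz)) (ciZ (-1) (cG _ Bz)) (ci_sum _ cQ2).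
  congr (_ + _); apply: eq_bigr => k _; rewrite (VE _ (Bs k)).
  by rewrite (ciZ _ (ccID (cG _ (Bs k)) (c1 _ Bz))) (ciD (cG _ (Bs k)) (c1 _ Bz)) (ciZ (-1) (cG _ Bz)).
apply: le_trans (cabs_ci_bound ler01 cQ1 (M := K * (nrm1 l ^+ 2 + nrm1 l * s)) _) _; last by rewrite subr0 mulr1 mulrA.
by move=> t t01; rewrite /Q1 -(E (Gker g f t)); apply: Q.
Qed.

Lemma holo_Vop g f : holo g -> holo f -> holo (Vop g f).
Proof.
move=> hg hf; apply: holo_of_fdiff => z Bz; have [r [K [r0 K0 Q]]] := quad_Vop hg hf Bz.
exact: quad_fdiff Q.
Qed.

(** The radial derivative is the derivative of l -> V_g f(lz) at l = 1, already known to exist, so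
    it can be read off from the quotients at l = 1 - m. By [Vop_ray] these are means of the kernel
    over [1-m, 1], which tend to its value at t = 1. *)
Lemma Rder_Vop g f z : holo g -> holo f -> Bn z -> Rder (Vop g f) z = f z * Rder g z.
Proof.
move=> hg hf Bz; have cG := ccI_Gker hg hf Bz.
have G1 : Gker g f 1 z = f z * Rder g z by rewrite Gker_eq ?oner_eq0// rmorph1 scale1r divr1.
apply/eqP; rewrite -subr_eq0 -G1 -cabs_eq0 eq_le cabs_ge0 andbT.
apply/ler_addgt0Pr => e e0; rewrite add0r.
have hV := holo_Vop hg hf.
have dV : cdiff (fun l : C => Vop g f (0 + l *: z)) 1 (Rder (Vop g f) z).
  by rewrite RderE; apply: fdiff_line; rewrite add0r scale1r; exact: holo_fdiff.
have e3 : 0 < e / 3 by rewrite divr_gt0.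
have [d d0 H] := dV _ e3; have [d' d'0 H'] := cG 1 (ltac:(rewrite lexx ler01//)) _ e3.
have [q q0 /and3P[q1 qd qd']] : exists2 q, 0 < q & [&& q <= 1, q <= d & q <= d'].
  by exists (Num.min 1 (Num.min d d')); rewrite ?lt_min ?ltr01 ?d0// !ge_min !lexx ?orbT.
pose m := q / 2; have m0 : 0 < m by rewrite divr_gt0.
have [m1 md md'] : [/\ m < 1, m < d & m < d'] by rewrite /m; split; lra.
have V1 : Vop g f z = Vop g f ((1 - m)%:C%C *: z) + ci (Gker g f ^~ z) (1 - m) 1.
  rewrite (Vop_ray hg hf Bz); last lra.
  by apply: etrans (VopE hg hf Bz) _; apply: ci_split => //; lra.
have cGm : ccI (Gker g f ^~ z) (1 - m) 1 by apply: ccI_sub cG; lra.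
have I1 : cabs (ci (Gker g f ^~ z) (1 - m) 1 - m%:C%C * Gker g f 1 z) <= 2 * m * (e / 3).
  have -> : ci (Gker g f ^~ z) (1 - m) 1 - m%:C%C * Gker g f 1 z =
      ci (fun t => Gker g f t z + - Gker g f 1 z) (1 - m) 1.
    rewrite (ciD cGm (@ccI_cst _ (- Gker g f 1 z) (1 - m) 1)) ci_cst; last lra.
    by rewrite mulrN; congr (_ - _%:C%C * _); ring.
  rewrite -[in leRHS](_ : 1 - (1 - m) = m); last by ring.
  apply: cabs_ci_bound; [lra|by apply: ccID => //; exact: ccI_cst|].
  move=> t tm; apply: H'; first lra.
  rewrite ler0_norm; lra.
have := H (1 - m)%:C%C; rewrite !add0r scale1r.
have -> : (1 - m)%:C%C - 1 = - m%:C%C :> C by rewrite rmorphB rmorph1 addrC addKr.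
rewrite cabsN cabsE_real gtr0_norm// => /(_ md) I2.
have : cabs (m%:C%C * (Rder (Vop g f) z - Gker g f 1 z)) <= 3 * m * (e / 3).
  have -> : m%:C%C * (Rder (Vop g f) z - Gker g f 1 z) =
     (Vop g f ((1 - m)%:C%C *: z) - Vop g f z - Rder (Vop g f) z * - m%:C%C)
     + (ci (Gker g f ^~ z) (1 - m) 1 - m%:C%C * Gker g f 1 z).
    rewrite V1; have E (a b c k x : C) : x * (c - k) = (a - (a + b) - c * - x) + (b - x * k) by ring.
    exact: E.
  apply: le_trans (cabsD _ _) _; lra.
rewrite cabsM cabsE_real gtr0_norm//.
have -> : 3 * m * (e / 3) = m * e by field.
by rewrite ler_pM2l.
Qed.

(** On [1/2, 1] the division by t costs at most a factor 2; the rest is a value of V_g f in the half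
    ball, where a supremum bound is enough. *)
Lemma Vop_half g f z : holo g -> holo f -> Bn z ->
  Vop g f z = Vop g f (2^-1%:C%C *: z) + ci (Gker g f ^~ z) 2^-1 1.
Proof.
move=> hg hf Bz; rewrite (Vop_ray hg hf Bz); last lra.
by apply: etrans (VopE hg hf Bz) _; apply: ci_split; [lra|lra|exact: ccI_Gker].
Qed.

End IntegrationOperator.

(** * Compactness *)

Section Montel.
Variables (R : realType) (n : nat) (p : R).
Hypothesis p1 : 1 <= p.
Local Notation C := (R[i]).
Local Notation Cn := ('rV[R[i]]_n).
Implicit Types (z w l : Cn) (f g : Cn -> C^o).

Lemma ApintD f g : inA p f -> inA p g ->
  (Apint p (fun z => (f z + g z)%R : C^o) <= (2 `^ p)%:E * (Apint p f + Apint p g))%E.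
Proof.
move=> [hf _] [hg _]; have [vf vg] : vmeas (winteg p (fun=> 1%R) f) /\ vmeas (winteg p (fun=> 1%R) g).
  by split; apply: vmeas_winteg => //; exact: measurable_ball1.
have p0 (h : Cn -> C^o) z : (0 <= winteg p (fun=> 1%R) h z)%E by exact: winteg_ge0.
rewrite /Apint !wintE -(vintD vf vg (p0 f) (p0 g)) -vintZ ?powR_ge0//; last 2 first.
- exact: emeasurable_funD.
- by move=> z; apply: adde_ge0; exact: p0.
apply: le_vint => z; first exact: p0.
rewrite /winteg; case: ifPn => _; last by rewrite adde0 mule0.
rewrite -EFinD -EFinM lee_fin !mulr1 -mulrDl mulrA; apply: ler_wpM2r; first exact: expR_ge0.
apply: le_trans (ler_powRD p1 (cabs_ge0 _) (cabs_ge0 _)).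
by apply: ge0_ler_powR; rewrite ?nnegrE ?addr_ge0 ?cabs_ge0 ?cabsD// (le_trans ler01 p1).
Qed.

Lemma inAN f : inA p f -> inA p (fun z => - f z : C^o) /\ Apint p (fun z => - f z : C^o) = Apint p f.
Proof.
move=> [hf lf]; have E : Apint p (fun z => - f z : C^o) = Apint p f.
  by apply/eqP; rewrite eq_le; apply/andP; split; apply: le_Apint => // z _; rewrite cabsN.
split; last exact: E; split; last by rewrite E.
rewrite (_ : (fun z => - f z : C^o) = (fun z => (-1 : C) * f z)); last by apply/funext => z; rewrite mulN1r.
by apply: holoM => //; exact: holo_cst.
Qed.

Lemma limn_einf_le_cst (u : nat -> \bar R) (M : \bar R) : (forall j, (u j <= M)%E) -> (limn_einf u <= M)%E.
Proof.
move=> uM; rewrite limn_einf_lim; apply: lime_le; first exact: is_cvg_einfs.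
by apply: nearW => j; apply: le_trans (uM j); apply: ereal_inf_lbound; exists j => //=.
Qed.

(** For a > 0 the power is continuous as exp(p ln x); for a = 0 the left side vanishes. *)
Lemma powR_le_limn_einf (x : nat -> R) (a k : R) : 0 <= a -> 0 <= k -> (forall j, 0 <= x j) ->
  x @ \oo --> a -> ((a `^ p * k)%:E <= limn_einf (fun j => (x j `^ p * k)%:E))%E.
Proof.
move=> a0 k0 x0 xa; have [->|an0] := eqVneq a 0.
  rewrite powR0; last by rewrite gt_eqF// (lt_le_trans ltr01 p1).
  by rewrite mul0r; apply: limn_einf_ge0 => j; rewrite lee_fin mulr_ge0// powR_ge0.
have ap : 0 < a by rewrite lt_def an0.
have cv : (fun j => (x j `^ p * k)%:E) @ \oo --> (a `^ p * k)%:E.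
  apply: cvg_EFin; first exact: nearW.
  apply: cvgM; last exact: cvg_cst.
  have E : \forall j \near \oo, expR (p * ln (x j)) = x j `^ p.
    near=> j; have xj : 0 < x j by near: j; exact: (cvgr_gt a xa).
    by rewrite /powR gt_eqF.
  apply: cvg_trans (near_eq_cvg E) _; rewrite /powR (negbTE an0).
  apply: continuous_cvg; first exact: continuous_expR.
  apply: cvgM; first exact: cvg_cst.
  by apply: continuous_cvg => //; exact: continuous_ln.
by rewrite is_cvg_limn_einfE; [rewrite (cvg_lim _ cv)|apply/cvg_ex; eexists; exact: cv].
Unshelve. all: by end_near. Qed.

Lemma Apint_fatou (f : nat -> Cn -> C^o) F (M : R) : (forall j, holo (f j)) ->
  (forall j, (Apint p (f j) <= M%:E)%E) ->
  (forall z, Bn z -> forall e : R, 0 < e -> \forall j \near \oo, cabs (f j z - F z) <= e) ->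
  (Apint p F <= M%:E)%E.
Proof.
move=> hf fM fF; apply: le_trans (_ : (vint (fun z => limn_einf (fun j => winteg p (fun=> 1%R) (f j) z)) <= _)%E).
  apply: le_vint => z; first exact: winteg_ge0.
  rewrite /winteg; case: ifPn => Bz; last by apply: limn_einf_ge0.
  rewrite mulr1; under eq_fun do rewrite mulr1.
  apply: powR_le_limn_einf => [||j|]; rewrite ?cabs_ge0 ?expR_ge0//.
  apply/cvgrPdist_le => e e0; have := fF z Bz e e0; apply: filterS => j; apply: le_trans.
  by rewrite distrC; exact: cabs_dist.
apply: le_trans (vint_fatou _ _) _ => [j|j z|].
- by apply: vmeas_winteg => //; exact: measurable_ball1.
- exact: winteg_ge0.
- by apply: limn_einf_le_cst => j; exact: fM.
Qed.

Lemma Ap_locally_bounded (f : nat -> Cn -> C^o) : Abounded p f ->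
  forall z, Bn z -> exists M, forall j w, nrm1 (w - z) <= rho z / 8 -> cabs (f j w) <= M.
Proof.
move=> [inf [M hM]] z Bz; have [C1 C11 HC] := Ap_eval n p1.
pose K := C1 * expR ((2 * n + 2)%:R * (2 * psi z)).
have K0 : 0 <= K by rewrite mulr_ge0 ?expR_ge0//; lra.
exists (1 + K * M) => j w wz; have [Bw pw] := near_rho Bz wz.
have h : (cabs (f j w)) `^ p <= K * M.
  rewrite -lee_fin; apply: le_trans (HC (f j) w (inf j).1 Bw) _; rewrite [leRHS]EFinM.
  apply: lee_pmul; [|exact: Apint_ge0| |exact: hM].
    by rewrite lee_fin mulr_ge0 ?expR_ge0//; lra.
  rewrite lee_fin; apply: ler_wpM2l; first lra.
  by rewrite ler_expR; apply: ler_wpM2l.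
have [c1|c1] := leP (cabs (f j w)) 1; first by apply: le_trans c1 _; rewrite lerDl; apply: le_trans h; exact: powR_ge0.
apply: le_trans (_ : cabs (f j w) `^ p <= _); last lra.
by rewrite -[leLHS]powRr1 ?cabs_ge0//; apply: ler_powR => //; exact: ltW.
Qed.

Lemma ultra_fmap (T V : Type) (h : T -> V) (U : set_system T) : UltraFilter U -> UltraFilter (fmap h U).
Proof.
move=> UU; split=> [|G PG hG]; first exact: fmap_proper_filter.
apply/seteqP; split => // A GA; have [//|UA] := in_ultra_setVsetC (h @^-1` A) UU.
by have /filter_ex[x []] : G (A `&` ~` A) by apply: filterI => //; apply: hG.
Qed.

(** Along an ultrafilter every bounded family of complex numbers converges, so a limit exists at all
    points at once, without a diagonal extraction. *)
Lemma ultra_pointwise_lim (f : nat -> Cn -> C^o) (U : set_system nat) : UltraFilter U -> Abounded p f ->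
  exists F : Cn -> C^o, forall z, Bn z -> forall e : R, 0 < e -> \forall j \near U, cabs (f j z - F z) <= e.
Proof.
move=> UU fb; have H z : exists c : C, Bn z -> forall e : R, 0 < e -> \forall j \near U, cabs (f j z - c) <= e.
  have [Bz|nB] := pselect (Bn z); last by exists 0.
  have [M hM] := Ap_locally_bounded fb Bz.
  have := @compact_sq R M; rewrite compact_ultra => /(_ (fmap (fun j => f j z) U) (ultra_fmap _ UU))[].
    rewrite /fmap/=; apply: (@filterE _ U _) => j /=; apply/sqP.
    have h : cabs (f j z) <= M by apply: hM; rewrite subrr nrm10 divr_ge0// ltW// rho_gt0.
    by split; [apply: le_trans (ler_Re_cabs _) h|apply: le_trans (ler_Im_cabs _) h].
  move=> c [_ Uc]; exists c => _ e e0.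
  have := @cvgr_dist_le _ _ _ U _ (fun j => f j z) c Uc (e%:C%C); rewrite ltr0c => /(_ _ e0).
  by apply: filterS => j; rewrite norm_cabs lecR cabsB.
by have [F HF] := choice H; exists F.
Qed.

(** The limit F is formed along an ultrafilter finer than [\oo] and is holomorphic by
    [holo_pointwise_lim]. A genuine subsequence is extracted only after convergence is known to be
    uniform on closed balls; Fatou's lemma then puts F into the space. *)
Lemma montel (f : nat -> Cn -> C^o) : Abounded p f ->
  exists phi : nat -> nat, {homo phi : a b / (a < b)%N} /\ exists F : Cn -> C^o, inA p F /\
  Abounded p (fun j z => f (phi j) z - F z : C^o) /\ ucc0 (fun j z => f (phi j) z - F z : C^o).
Proof.
move=> fb; have [inf [M hM]] := fb.
have [U [UU oU]] := @ultraFilterLemma nat \oo _.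
have [F HF] := ultra_pointwise_lim UU fb.
have hf j : holo (f j) := (inf j).1.
have hF : holo F.
  apply: (holo_pointwise_lim (F := U) hf) => // z Bz.
  have [B hB] := Ap_locally_bounded fb Bz; exists (rho z / 8), B.
  by split; [rewrite divr_gt0// rho_gt0|move=> j w /ltW; exact: hB].
(* The functions are equi-Lipschitz near each point, so convergence at the point spreads to a
   neighbourhood, and compactness of the closed ball makes it uniform. *)
have unif (s e : R) : s < 1 -> 0 < e -> \forall j \near U, forall z, normz z <= s -> cabs (f j z - F z) <= e.
  move=> s1 e0; have /compact_near_coveringP cK := @compact_cball R n s.
  have := @cK nat U (fun j z => cabs (f j z - F z) <= e) _.
  apply => z /= zs; have Bz : Bn z by exact: le_lt_trans s1.
  have [B hB] := Ap_locally_bounded fb Bz; have e3 : 0 < e / 3 by rewrite divr_gt0.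
  have r0 : 0 < rho z / 8 by rewrite divr_gt0// rho_gt0.
  have B0 : 0 <= B by apply: le_trans (hB 0%N z _); rewrite ?cabs_ge0// subrr nrm10 ltW.
  pose L := 128 * B / (rho z / 8) + 1.
  have L0 : 0 < L by apply: ltr_wpDl => //; apply: divr_ge0; [exact: mulr_ge0|exact: ltW].
  have lip j w : nrm1 (w - z) <= rho z / 8 / 2 -> cabs (f j w - f j z) <= L * nrm1 (w - z).
    move=> wz; apply: le_trans (_ : 128 * B / (rho z / 8) * nrm1 (w - z) <= _); last first.
      by apply: ler_wpM2r; [exact: nrm1_ge0|rewrite lerDl].
    apply: fdiff_lip_bound => // v vz; last by apply: hB; exact: ltW.
    by exists (dgrad (f j) v); apply: holo_fdiff => //; apply: (near_rho Bz _).1; exact: ltW.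
  have [d d0 Hd] := fdiff_cont (holo_fdiff hF Bz) e3.
  pose d' := Num.min d (Num.min (rho z / 8 / 2) (e / 3 / L)).
  exists ([set w | nrm1 (w - z) < d'], [set j | cabs (f j z - F z) <= e / 3]).
    split=> /=; last exact: HF.
    apply/nbhs_nrm1P; exists d' => //; rewrite !lt_min d0/=; apply/andP.
    by split; apply: divr_gt0.
  move=> [w j] [/= wd' fj]; move: wd'; rewrite !lt_min => /and3P[wd wr we].
  have -> : f j w - F w = (f j w - f j z) + ((f j z - F z) - (F w - F z)).
    have Er (a b c k : C) : a - k = (a - b) + ((b - c) - (k - c)) by ring.
    exact: Er.
  apply: le_trans (cabsD _ _) _; have h1 := lip j w (ltW wr); have h2 := Hd w wd.
  have := cabsD (f j z - F z) (- (F w - F z)); rewrite cabsN.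
  move: we; rewrite ltr_pdivlMr// mulrC => we; lra.
(* Radius and tolerance are tied to the same m, so one recursive choice of indices serves all
   compact sets. *)
have pick m N : exists j, (N < j)%N /\ forall z, normz z <= 1 - m.+1%:R^-1 -> cabs (f j z - F z) <= m.+1%:R^-1.
  have h1 : \forall j \near U, (N < j)%N by apply: oU; exact: nbhs_infty_gt.
  have h2 := @unif (1 - m.+1%:R^-1) m.+1%:R^-1 (ltac:(by rewrite ltrBlDr ltrDl invr_gt0)) (ltac:(by rewrite invr_gt0)).
  have [j [? ?]] := @filter_ex _ U _ _ (filterI h1 h2).
  by exists j.
have [q Hq] := choice (fun mN : nat * nat => pick mN.1 mN.2).
pose fix phi (m : nat) : nat := if m is m'.+1 then q (m, phi m') else q (0, 0)%N.
have phiS m : (phi m < phi m.+1)%N by exact: (Hq (m.+1, phi m)).1.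
have phiU m z : normz z <= 1 - m.+1%:R^-1 -> cabs (f (phi m) z - F z) <= m.+1%:R^-1.
  by case: m => [|m]; [exact: (Hq (0, 0)%N).2|exact: (Hq (m.+1, phi m)).2].
have eU (s e : R) : s < 1 -> 0 < e -> \forall j \near \oo, forall z, normz z <= s -> cabs (f (phi j) z - F z) <= e.
  move=> s1 e0; near=> j => z zs.
  have je : j.+1%:R^-1 <= Num.min e (1 - s).
    rewrite -[leRHS]invrK lef_pV2 ?posrE// ?invr_gt0 ?lt_min ?e0 ?subr_gt0//.
    apply: le_trans (_ : j%:R <= _); last by rewrite ler_nat.
    by near: j; exact: nbhs_infty_ger.
  move: je; rewrite le_min => /andP[je js].
  apply: le_trans (phiU j z _) je; apply: le_trans zs _.
  by rewrite lerBrDr addrC -lerBrDr.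
exists phi; split; first exact: homo_ltn ltn_trans phiS.
have iF : inA p F.
  split=> //; apply: le_lt_trans (ltry M); apply: (@Apint_fatou (fun j => f (phi j))) => // z Bz e e0.
  by have := eU (normz z) e Bz e0; apply: filterS => j; apply.
exists F; split; first exact: iF; split.
  have [inF EF] := inAN iF.
  split=> [j|].
    split; first by apply: (@holoD _ _ (f (phi j)) (fun z => - F z)) => //; exact: inF.1.
    apply: le_lt_trans (ApintD (inf (phi j)) inF) _.
    by rewrite EF lte_mul_pinfty ?lee_fin ?powR_ge0// lte_add_pinfty ?iF.2// (inf (phi j)).2.
  exists (2 `^ p * (M + fine (Apint p F))) => j; apply: le_trans (ApintD (inf (phi j)) inF) _.
  rewrite EF EFinM lee_wpmul2l ?lee_fin ?powR_ge0// EFinD fineK ?leeD2r ?hM//.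
  by rewrite ge0_fin_numE ?Apint_ge0// iF.2.
move=> K cK KB e e0; have [s /andP[s0 s1] Ks] := compact_normz_lt1 cK KB.
have e2 : 0 < e / 2 by rewrite divr_gt0.
have := eU s (e / 2) s1 e2; apply: filterS => j H z /Ks /H; lra.
Unshelve. all: by end_near. Qed.

End Montel.

(** * Hardy inequality *)

Section OneDimensional.
Variable R : realType.
Local Notation mu := (@lebesgue_measure R).
Local Notation mR := (measurableTypeR R).

Lemma derivable_contI (f : R -> R) (a b : R) : (forall x : R, a <= x <= b -> derivable f x 1) -> contI f a b.
Proof. by move=> H; apply: derivable_within_continuous => x; rewrite in_itv/=; exact: H. Qed.

Lemma ri_derive (F F' : R -> R) (a b : R) : a < b -> (forall x : R, a <= x <= b -> is_derive x 1 F (F' x)) ->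
  contI F' a b -> ri F' a b = F b - F a.
Proof.
move=> ab dF cF; have cv x : a <= x <= b -> F y @[y --> x] --> F x.
  move=> xab; have [d _] := dF x xab.
  by apply: differentiable_continuous; apply/derivable1_diffP.
rewrite /ri /Rintegral (@continuous_FTC2 _ F' F)//.
  split=> [x||]; rewrite ?in_itv/=.
  - by move=> /andP[ax xb]; have [] := dF x; rewrite ?(ltW ax) ?(ltW xb).
  - by apply: cvg_at_right_filter; apply: cv; rewrite lexx ltW.
  - by apply: cvg_at_left_filter; apply: cv; rewrite lexx ltW.
move=> x; rewrite in_itv/= => /andP[ax xb]; rewrite derive1E.
by have [] := dF x; rewrite ?(ltW ax) ?(ltW xb).
Qed.

Lemma integral_le_ri (k : R -> R) (g : R -> \bar R) (a b : R) : contI k a b ->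
  (forall x, (0 <= g x)%E) -> (forall x, ~~ (a <= x <= b) -> g x = 0%E) ->
  (forall x, a <= x <= b -> (g x <= (k x)%:E)%E) -> (\int[mu]_x g x <= (ri k a b)%:E)%E.
Proof.
move=> ck g0 gN gk; rewrite /ri /Rintegral fineK; last first.
  by apply: integrable_fin_num => //; exact: contI_integrable.
rewrite [leRHS]integral_mkcond; apply: le_integral_nneg => // x.
rewrite patchE; case: ifPn => [/set_mem/=|/negP nx]; first by rewrite in_itv/= => /gk.
by rewrite gN//; apply/negP => h; apply: nx; rewrite inE/= in_itv/=.
Qed.

(** Used with 1/c = 4 rho(w)^2: this is where the Hardy inequality gains its two powers of rho. *)
Lemma ri_expR_le (c : R) : 0 < c -> contI (fun t => expR (- (c * (1 - t)))) 2^-1 1 /\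
  ri (fun t => expR (- (c * (1 - t)))) 2^-1 1 <= c^-1.
Proof.
move=> c0; pose L (t : R) := - (c * (1 - t)).
have dL (t : R) : is_derive t (1 : R) L c.
  by rewrite /L; apply: is_derive_eq; rewrite /GRing.scale/= ?mulr0 ?addr0 ?add0r ?sub0r ?mulrN1 ?mulrN ?mulr1 ?opprK.
have dE (t : R) : is_derive t (1 : R) (fun t => expR (L t)) (expR (L t) * c).
  exact: (is_derive1_comp (is_derive_expR _) (dL t)).
have cE : contI (fun t => expR (L t)) 2^-1 1.
  by apply: derivable_contI => x _; have [] := dE x.
split=> //; rewrite -(ler_pM2l c0) -riZ// mulfV ?gt_eqF//.
have -> : ri (fun t => c * expR (L t)) 2^-1 1 = ri (fun t => expR (L t) * c) 2^-1 1.
  by apply: eq_ri => t _; rewrite mulrC.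
rewrite (@ri_derive (fun t => expR (L t)) (fun t => expR (L t) * c) 2^-1 1).
- by rewrite {1}/L subrr mulr0 oppr0 expR0 gerBl expR_ge0.
- lra.
- by have := contIZ (k := c) cE; congr contI; apply/funext => t; exact: mulrC.
Qed.

(* The weight of the Hardy inequality: rho^-2 is up to a constant the derivative
   of psi along the ray, so that this integral is bounded uniformly in [a]. *)
Lemma hardy_kernel_bound (a b : R) : 0 <= a -> a < 1 -> 0 < b ->
  let k t := (1 - t ^+ 2 * a)^-1 ^+ 2 * expR (- (b * ((1 - a)^-1 - (1 - t ^+ 2 * a)^-1))) in
  contI k 2^-1 1 /\ ri k 2^-1 1 <= 2 + 2 / b.
Proof.
move=> a0 a1 b0 k; pose r (t : R) := 1 - t ^+ 2 * a.
have r0 t : 2^-1 <= t <= 1 -> 0 < r t.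
  move=> /andP[t1 t2]; have t21 : t ^+ 2 <= 1 by rewrite expr_le1//; lra.
  have : t ^+ 2 * a <= 1 * a by apply: ler_wpM2r.
  by rewrite /r; lra.
have dr (t : R) : is_derive t (1 : R) r (- (2 * t * a)).
  by rewrite /r; apply: is_derive_eq; rewrite /GRing.scale/= ?expr1; ring.
have dV (t : R) : 2^-1 <= t <= 1 -> is_derive t (1 : R) (fun t => (r t)^-1) (2 * t * a * (r t)^-1 ^+ 2).
  move=> /r0 rt; have := is_deriveV (lt0r_neq0 rt) (dr t).
  by congr is_derive; rewrite /GRing.scale/= exprVn; ring.
have dH (t : R) : 2^-1 <= t <= 1 -> is_derive t (1 : R) (fun t => expR (- (b * ((1 - a)^-1 - (r t)^-1))))
    (expR (- (b * ((1 - a)^-1 - (r t)^-1))) * (b * (2 * t * a * (r t)^-1 ^+ 2))).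
  move=> tI; have dt := dV t tI.
  apply: (is_derive1_comp (is_derive_expR _)).
  by apply: is_derive_eq; rewrite /GRing.scale/= ?mulr0 ?addr0 ?add0r ?sub0r; ring.
have contIM (f g : R -> R) : contI f 2^-1 1 -> contI g 2^-1 1 -> contI (fun t => f t * g t) 2^-1 1.
  by move=> cf cg x; apply: cvgM; [exact: cf|exact: cg].
have cr1 : contI (fun t => (r t)^-1) 2^-1 1 by apply: derivable_contI => t /dV[].
have cr2 : contI (fun t => (r t)^-1 ^+ 2) 2^-1 1 by exact: (contIM _ _ cr1 cr1).
have cH : contI (fun t => expR (- (b * ((1 - a)^-1 - (r t)^-1)))) 2^-1 1.
  by apply: derivable_contI => t /dH[].
have ck : contI k 2^-1 1 by exact: contIM.
split=> //; pose H' t := expR (- (b * ((1 - a)^-1 - (r t)^-1))) * (b * (2 * t * a * (r t)^-1 ^+ 2)).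
have cH' : contI H' 2^-1 1.
  apply: (contIM) => //; apply: contIZ; apply: (contIM) => //; apply: derivable_contI => t _.
  by have [] : is_derive t (1 : R) (fun t : R => 2 * t * a) (2 * a);
    [apply: is_derive_eq; rewrite /GRing.scale/= ?mulr0 ?addr0 ?add0r; ring|].
(* For a >= 1/2 the kernel is dominated by a multiple of the exact derivative [H'], since 4 t a >=
   1. For a < 1/2 it is at most 4, because then [r t] is at least 1/2. *)
have kb t : 2^-1 <= t <= 1 -> k t <= 4 + 2 / b * H' t.
  move=> tI; have rt := r0 t tI; have /andP[t1 t2] := tI.
  have e0 := expR_ge0 (- (b * ((1 - a)^-1 - (r t)^-1))).
  have e1 : expR (- (b * ((1 - a)^-1 - (r t)^-1))) <= 1.
    rewrite expR_le1 lerNl oppr0; apply: mulr_ge0; first exact: ltW.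
    have ar : 1 - a <= r t.
      rewrite /r lerD2l lerN2 -[leRHS]mul1r; apply: ler_wpM2r => //.
      by rewrite expr_le1//; lra.
    by rewrite subr_ge0 lef_pV2 ?posrE// subr_gt0.
  set x := expR _ in e0 e1 *; set y := (r t)^-1 ^+ 2.
  have -> : k t = y * x by [].
  have -> : 2 / b * H' t = 4 * t * a * y * x.
    by rewrite /H' -/x -/y; field; rewrite gt_eqF.
  have y0 : 0 <= y by exact: sqr_ge0.
  have [ha|ha] := leP 2^-1 a.
    apply: le_trans (_ : 4 * t * a * y * x <= _); last by rewrite lerDr.
    apply: ler_wpM2r => //; rewrite -[leLHS]mul1r; apply: ler_wpM2r => //.
    have : 2^-1 * 2^-1 <= t * a by apply: ler_pM; lra.
    lra.
  have y4 : y <= 4.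
    have : r t >= 2^-1.
      have : t ^+ 2 * a <= 1 * a by apply: ler_wpM2r => //; rewrite expr_le1//; lra.
      by rewrite /r; lra.
    move=> h; have h2 : (r t)^-1 <= 2 by rewrite -[leRHS]invrK lef_pV2 ?posrE.
    rewrite (_ : 4 = 2 ^+ 2); last by ring.
    by rewrite /y ler_pXn2r ?nnegrE ?invr_ge0 ?(ltW rt)//.
  apply: le_trans (_ : 4 <= _).
    by apply: le_trans (_ : y * 1 <= _); [apply: ler_wpM2l|rewrite mulr1].
  have t0 : 0 <= t by lra.
  by rewrite lerDl; do 4! (apply: mulr_ge0 => //).
have cH2 : contI (fun t => 2 / b * H' t) 2^-1 1 by exact: contIZ.
apply: le_trans (_ : ri (fun t => 4 + 2 / b * H' t) 2^-1 1 <= _).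
  apply: le_ri => // x; apply: cvgD; [exact: contI_cst|exact: cH2].
rewrite riD//; last exact: contI_cst.
rewrite riZ// ri_cst; last lra.
rewrite (@ri_derive (fun t => expR (- (b * ((1 - a)^-1 - (r t)^-1)))) H' 2^-1 1 _ dH cH'); last lra.
apply: lerD; first lra.
rewrite -[leRHS]mulr1; apply: ler_wpM2l; first by rewrite divr_ge0// ltW.
by rewrite {1}/r expr1n mul1r subrr mulr0 oppr0 expR0 gerBl expR_ge0.
Qed.

End OneDimensional.

Section HardySwap.
Variables (R : realType) (n : nat).
Local Notation C := (R[i]).
Local Notation Cn := ('rV[R[i]]_n).
Local Notation mu := (@lebesgue_measure R).
Local Notation mR := (measurableTypeR R).
Local Notation Mn n := (g_sigma_algebraType (@coord_sets R n)).
Variables H E : Cn -> R.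
Hypotheses (mH : measurable_fun setT (H : Mn n -> mR)) (mE : measurable_fun setT (E : Mn n -> mR)).
Hypotheses (H0 : forall z, 0 <= H z) (E0 : forall z, 0 <= E z).

(* [hG' t] is [hG t] after the substitution w = t z. *)
Definition hG (t : R) z : \bar R := (if 2^-1 <= t <= 1 then H (t%:C%C *: z) * E z else 0)%R%:E.
Definition hG' (t : R) z : \bar R := (if 2^-1 <= t <= 1 then H z * E (t^-1%:C%C *: z) else 0)%R%:E.

Lemma hG_ge0 t z : (0 <= hG t z)%E.
Proof. by rewrite lee_fin; case: ifP => // _; rewrite mulr_ge0. Qed.

Lemma hG'_ge0 t z : (0 <= hG' t z)%E.
Proof. by rewrite lee_fin; case: ifP => // _; rewrite mulr_ge0. Qed.

Lemma measurable_real_scale (a : mR -> mR) : measurable_fun setT a ->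
  measurable_fun setT (fun tz : mR * Mn n => (a tz.1)%:C%C *: (tz.2 : Cn) : Mn n).
Proof.
move=> ma; have m1 : measurable_fun setT (fun tz : mR * Mn n => a tz.1 : mR) by exact: measurableT_comp.
apply: measurable_to_Mn => k.
  under eq_fun do rewrite mxE Re_mulE /= mul0r subr0.
  apply: measurable_funM => //.
  by apply: (measurableT_comp (measurable_Re_coord k)).
under eq_fun do rewrite mxE Im_mulE /= mul0r addr0.
apply: measurable_funM => //.
by apply: (measurableT_comp (measurable_Im_coord k)).
Qed.

Lemma measurable_unit_range : measurable_fun setT (fun tz : mR * Mn n => 2^-1 <= (tz.1 : R) <= 1).
Proof. by apply: measurable_and; apply: measurable_fun_ler. Qed.

Lemma pmeas_hG : pmeas (hG : mR -> Cn -> \bar R).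
Proof.
apply/measurable_EFinP; apply: (@measurable_fun_ifT _ _ (mR * Mn n)%type mR) => //.
  exact: measurable_unit_range.
apply: measurable_funM; last exact: (measurableT_comp mE).
exact: (measurableT_comp mH (measurable_real_scale (@measurable_id _ mR setT))).
Qed.

Lemma pmeas_hG' : pmeas (hG' : mR -> Cn -> \bar R).
Proof.
have -> : hG' = fun t z => (if 2^-1 <= t <= 1 then H z * E ((t `^ (-1))%:C%C *: z) else 0)%R%:E.
  apply/funext => t; apply/funext => z; rewrite /hG'; case: ifPn => // /andP[t1 _].
  by rewrite powR_inv1//; lra.
apply/measurable_EFinP; apply: (@measurable_fun_ifT _ _ (mR * Mn n)%type mR) => //.
  exact: measurable_unit_range.
apply: measurable_funM; first exact: (measurableT_comp mH).
exact: (measurableT_comp mE (measurable_real_scale (@measurable_powR R (-1)))).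
Qed.

Lemma vmeas_int_hG : vmeas (fun z => (\int[mu]_t hG t z)%E).
Proof.
exact: (measurable_fun_fubini_tonelli_G (m1 := mu) (fun x : mR * Mn n => hG x.1 x.2) pmeas_hG (fun x => hG_ge0 _ _)).
Qed.

(** Tonelli moves the integral in t outside; for fixed t in [1/2, 1] the substitution w = t z has
    Jacobian t^(-2n) <= 4^n. *)
Lemma hardy_swap : (vint (fun z => \int[mu]_t hG t z) <= (4 ^+ n)%:E * vint (fun z => \int[mu]_t hG' t z))%E.
Proof.
rewrite -(vint_swap pmeas_hG hG_ge0) -(vint_swap pmeas_hG' hG'_ge0).
rewrite -(ge0_integralZl mu measurableT (vint_pmeas pmeas_hG' hG'_ge0) (fun t _ => vint_ge0 (hG'_ge0 t))); last first.
  by rewrite lee_fin exprn_ge0.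
apply: le_integral_nneg => t; first exact: vint_ge0 (hG_ge0 t).
have [tI|tN] := boolP (2^-1 <= t <= 1); last first.
  apply: le_trans (_ : (vint (hG' t) <= _)%E).
    apply: le_vint => z; first exact: hG_ge0.
    by rewrite /hG /hG' (negbTE tN).
  apply: lee_pemull; first exact: vint_ge0 (hG'_ge0 t).
  by rewrite lee_fin exprn_ege1// (ler_nat _ 1 4).
have /andP[t1 t2] := tI; have t0 : 0 < t by lra.
have tC : t%:C%C != 0 :> C by rewrite -cabs_gt0 cabsE_real normr_gt0 gt_eqF.
rewrite (vint_scale tC (pmeas_vmeas t pmeas_hG') (hG'_ge0 t)).
have -> : (fun z => hG' t (t%:C%C *: z)) = hG t.
  apply/funext => z; rewrite /hG /hG' tI scalerA -rmorphM mulVf ?gt_eqF// rmorph1.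
  by rewrite scale1r.
rewrite muleA -EFinM cabsE_real gtr0_norm// -[leLHS]mul1e.
apply: lee_wpmul2r; first exact: vint_ge0 (hG_ge0 t).
rewrite lee_fin exprM -exprMn; apply: exprn_ege1.
have : 2^-1 * 2^-1 <= t * t by apply: ler_pM; lra.
by rewrite expr2; lra.
Qed.

End HardySwap.

Section Hardy.
Variables (R : realType) (n : nat) (p : R).
Hypothesis p1 : 1 <= p.
Local Notation C := (R[i]).
Local Notation Cn := ('rV[R[i]]_n).
Local Notation mu := (@lebesgue_measure R).
Local Notation mR := (measurableTypeR R).
Local Notation Mn n := (g_sigma_algebraType (@coord_sets R n)).
Implicit Types (z w : Cn) (f g : Cn -> C^o).

Definition carleson_weight g z : R := cabs (Rder g z) `^ p * (1 - normz z ^+ 2) `^ (2 * p).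

(** Together with [hardyE] it factors the weighted integrand into a function of tz and a function of
    z, each taking one half of the exponent; only such a product can be transported by w = t z. *)
Definition hardyH g f z : R :=
  if normz z < 1 then cabs (f z * Rder g z) `^ p * rho z `^ (2 * p - 2) * expR (- psi z / 2) else 0.

Definition hardyE z : R := if normz z < 1 then expR (- psi z / 2) else 0.

Lemma hardyH_ge0 g f z : 0 <= hardyH g f z.
Proof. by rewrite /hardyH; case: ifP => // _; rewrite !mulr_ge0 ?powR_ge0 ?expR_ge0. Qed.

Lemma hardyE_ge0 z : 0 <= hardyE z.
Proof. by rewrite /hardyE; case: ifP => // _; rewrite expR_ge0. Qed.

Lemma measurable_hardyE : measurable_fun setT (hardyE : Mn n -> mR).
Proof.
rewrite (_ : hardyE = fun z => if normz z < 1 then expR (- (if normz z < 1 then psi z else 0) * 2^-1) else 0); last first.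
  by apply/funext => z; rewrite /hardyE; case: ifP.
apply: (@measurable_fun_ifT _ _ (Mn n) mR) => //.
  by apply: measurable_fun_ltr => //; exact: measurable_normz.
apply: (measurableT_comp (@measurable_expR R)); apply: measurable_funM => //.
by apply: measurable_funN; exact: measurable_psi.
Qed.

Lemma measurable_hardyH g f : holo g -> holo f -> measurable_fun setT (hardyH g f : Mn n -> mR).
Proof.
move=> hg hf.
have hfg : holo (fun z => f z * Rder g z : C^o) by apply: holoM => //; exact: holo_Rder.
rewrite (_ : hardyH g f = fun z => if normz z < 1 then
  (if normz z < 1 then cabs (f z * Rder g z) else 0) `^ p * rho z `^ (2 * p - 2) * hardyE z else 0); last first.
  by apply/funext => z; rewrite /hardyH /hardyE; case: ifP.
apply: (@measurable_fun_ifT _ _ (Mn n) mR) => //.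
  by apply: measurable_fun_ltr => //; exact: measurable_normz.
apply: measurable_funM; last exact: measurable_hardyE.
apply: measurable_funM; apply: (measurableT_comp (measurable_powR _)); last exact: measurable_rho.
exact: measurable_holo hfg.
Qed.

Lemma measurable_carleson_weight g : holo g ->
  measurable_fun setT ((fun z => if normz z < 1 then carleson_weight g z else 0) : Mn n -> mR).
Proof.
move=> hg; rewrite (_ : (fun z => _) = fun z => if normz z < 1 then
  (if normz z < 1 then cabs (Rder g z) else 0) `^ p * rho z `^ (2 * p) else 0); last first.
  by apply/funext => z; case: ifP.
apply: (@measurable_fun_ifT _ _ (Mn n) mR) => //.
  by apply: measurable_fun_ltr => //; exact: measurable_normz.
apply: measurable_funM; apply: (measurableT_comp (measurable_powR _)); last exact: measurable_rho.
exact: measurable_holo (holo_Rder hg).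
Qed.

Lemma carleson_weight_ge0 g z : 0 <= carleson_weight g z.
Proof. by rewrite mulr_ge0 ?powR_ge0. Qed.

Lemma rho_scale z (t : R) : rho (t%:C%C *: z) = 1 - t ^+ 2 * normz z ^+ 2.
Proof. by rewrite /rho normzZ cabsE_real exprMn real_normK ?num_real. Qed.

(** The constant of [power_of_linear_bounds] for A = 2 + 4p, which is the bound 2 + 2/b of
    [hardy_kernel_bound] at b = 1/(2p). *)
Definition hardyK := 2 * (2 * (2 + 4 * p)) `^ (p - 1).

Lemma hardyK_gt0 : 0 < hardyK.
Proof. by rewrite mulr_gt0 ?powR_gt0 ?mulr_gt0//; have := p1; lra. Qed.

Lemma powR_kernel (r x l : R) : 0 < r -> 0 < l ->
  (l * (r^-1 ^+ 2 * expR x)) `^ (1 - p) = l `^ (1 - p) * (r `^ (2 * p - 2) * expR (x * (1 - p))).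
Proof.
move=> r0 l0; rewrite powRM; [|exact: ltW|by rewrite mulr_ge0 ?expR_ge0 ?sqr_ge0].
rewrite powRM ?sqr_ge0 ?expR_ge0// -expRM; congr (_ * (_ * _)).
rewrite -powR_inv1 ?(ltW r0)// -powR_mulrn ?powR_ge0// -!powRrM.
by congr (_ `^ _); ring.
Qed.

(** [le_young_split] at the level l k(t), with k the kernel for b = 1/(2p). The first term
    integrates to at most (2+4p) l. The second contains k^(1-p), that is rho^(2p-2) times an
    exponential whose rate (p-1)/(2p) is at most 1/2. *)
Lemma hardy_pointwise g f z : holo g -> holo f -> Bn z ->
  (((ri (fun t => cabs (f (t%:C%C *: z) * Rder g (t%:C%C *: z))) 2^-1 1) `^ p)%:E <=
   (hardyK * expR (psi z))%:E * \int[mu]_t hG (hardyH g f) hardyE t z)%E.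
Proof.
move=> hg hf Bz; set I := ri _ _ _; set Y := (\int[mu]_t _)%E.
have p0 : 0 < p by exact: lt_le_trans p1.
have Y0 : (0 <= Y)%E by apply: integral_ge0 => t _; apply: hG_ge0; [exact: hardyH_ge0|exact: hardyE_ge0].
have K0 := hardyK_gt0.
have [Yy|] := eqVneq Y +oo%E.
  by rewrite Yy gt0_muley ?leey// lte_fin mulr_gt0// expR_gt0.
move=> Yoo; have Yf : Y \is a fin_num by rewrite ge0_fin_numE// ltey.
pose phi t := cabs (f (t%:C%C *: z) * Rder g (t%:C%C *: z)).
have cphi : contI phi 2^-1 1.
  apply: (ccI_cabs (F := fun t => f (t%:C%C *: z) * Rder g (t%:C%C *: z))).
  apply: (@ccI_ray _ _ (fun w => f w * Rder g w : C^o)) => //.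
  by apply: holoM => //; exact: holo_Rder.
have a0 : 0 <= normz z ^+ 2 by exact: sqr_ge0.
have a1 : normz z ^+ 2 < 1 by rewrite -subr_gt0; exact: rho_gt0 Bz.
have b0 : 0 < (2 * p)^-1 by rewrite invr_gt0 mulr_gt0.
have [] := hardy_kernel_bound a0 a1 b0; set k := (X in contI X _ _) => ck rk.
have rk' : ri k 2^-1 1 <= 2 + 4 * p.
  apply: le_trans rk _; rewrite invrK; lra.
rewrite -(fineK Yf) -EFinM lee_fin -mulrA.
have I0 : 0 <= I.
  rewrite -[leLHS](mulr0 (1 - 2^-1)) -ri_cst; last lra.
  by apply: le_ri => // [|t _]; [exact: contI_cst|exact: cabs_ge0].
apply: power_of_linear_bounds => //; first lra.
  by rewrite mulr_ge0 ?expR_ge0 ?fine_ge0.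
(* [hp] is the positive part of [h]: the comparison with an extended integral is for nonnegative
   functions, while phi - l k may change sign. *)
move=> l l0; pose h t := phi t + - l * k t; pose hp t := 2^-1 * (h t + `|h t|).
have cZ (m : R) (u : R -> R) : contI u 2^-1 1 -> contI (fun t => m * u t) 2^-1 1 by exact: contIZ.
have cD (u v : R -> R) : contI u 2^-1 1 -> contI v 2^-1 1 -> contI (fun t => u t + v t) 2^-1 1.
  by move=> cu cv x; apply: cvgD; [exact: cu|exact: cv].
have ch : contI h 2^-1 1 := cD _ _ cphi (cZ (- l) k ck).
have chp : contI hp 2^-1 1 := cZ _ _ (cD _ _ ch (contI_norm ch)).
have hp0 t : 0 <= hp t.
  by apply: mulr_ge0; rewrite ?invr_ge0//; have := ler_norm (- h t); rewrite normrN; lra.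
have hhp t : h t <= hp t by rewrite /hp; have := ler_norm (h t); lra.
have Ih : I - l * ri k 2^-1 1 <= ri hp 2^-1 1.
  have -> : I - l * ri k 2^-1 1 = ri h 2^-1 1.
    by rewrite (riD cphi (cZ (- l) k ck)) (riZ (- l) ck) mulNr.
  exact: le_ri ch chp (fun t _ => hhp t).
suff Jh : ri hp 2^-1 1 <= l `^ (1 - p) * (expR (psi z) * fine Y).
  have : l * ri k 2^-1 1 <= l * (2 + 4 * p) by rewrite ler_pM2l.
  lra.
pose c := l `^ (1 - p) * expR (psi z); have c0 : 0 <= c by rewrite mulr_ge0 ?powR_ge0 ?expR_ge0.
suff JE : ((ri hp 2^-1 1)%:E <= c%:E * Y)%E.
  by move: JE; rewrite -{1}(fineK Yf) -EFinM lee_fin /c -mulrA.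
have mG : measurable_fun setT (fun t : mR => hG (hardyH g f) hardyE t z).
  exact: (measurableT_comp (pmeas_hG (measurable_hardyH hg hf) measurable_hardyE) (pair2_measurable (z : Mn n))).
have EZ : (\int[mu]_t (c%:E * hG (hardyH g f) hardyE t z) = c%:E * Y)%E.
  apply: (ge0_integralZl mu measurableT mG) => //.
  by move=> t _; apply: hG_ge0; [exact: hardyH_ge0|exact: hardyE_ge0].
rewrite -EZ.
apply: ri_le_integral => // t.
  by apply: mule_ge0; rewrite ?lee_fin//; apply: hG_ge0; [exact: hardyH_ge0|exact: hardyE_ge0].
move=> tI; rewrite /hG tI -EFinM lee_fin.
have /andP[t1 t2] := tI; have Bt : Bn (t%:C%C *: z) by apply: Bn_scale => //; rewrite cabsE_real ger0_norm//; lra.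
suff hR : h t <= c * (hardyH g f (t%:C%C *: z) * hardyE z).
  have R0 : 0 <= c * (hardyH g f (t%:C%C *: z) * hardyE z).
    by apply: mulr_ge0 => //; apply: mulr_ge0; [exact: hardyH_ge0|exact: hardyE_ge0].
  by rewrite /hp; case: (ler0P (h t)); lra.
have rt := rho_gt0 Bt; have Ek : k t = (rho (t%:C%C *: z))^-1 ^+ 2 * expR (- ((2 * p)^-1 * (psi z - psi (t%:C%C *: z)))).
  by rewrite !psiE rho_scale.
have kt0 : 0 < k t by rewrite Ek mulr_gt0 ?expR_gt0// exprn_gt0// invr_gt0.
have := le_young_split p1 (cabs_ge0 (f (t%:C%C *: z) * Rder g (t%:C%C *: z))) (mulr_gt0 l0 kt0).
rewrite {2}Ek powR_kernel// -/(phi t) => Yg.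
rewrite /hardyH /hardyE !ifT//.
have pp : psi (t%:C%C *: z) <= psi z.
  apply: le_psi => //; rewrite normzZ cabsE_real ger0_norm; last lra.
  by rewrite -[leRHS]mul1r; apply: ler_wpM2r => //; exact: normz_ge0.
apply: le_trans (_ : phi t `^ p * (l `^ (1 - p) * (rho (t%:C%C *: z) `^ (2 * p - 2) *
    expR (- ((2 * p)^-1 * (psi z - psi (t%:C%C *: z))) * (1 - p)))) <= _).
  by rewrite /h mulNr; lra.
have -> : c * (phi t `^ p * rho (t%:C%C *: z) `^ (2 * p - 2) * expR (- psi (t%:C%C *: z) / 2) * expR (- psi z / 2)) =
  phi t `^ p * (l `^ (1 - p) * (rho (t%:C%C *: z) `^ (2 * p - 2) *
    expR ((psi z - psi (t%:C%C *: z)) / 2))).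
  have -> : (psi z - psi (t%:C%C *: z)) / 2 = psi z + - psi (t%:C%C *: z) / 2 + - psi z / 2 by field.
  by rewrite !expRD /c; ring.
do 3! (apply: ler_wpM2l; first exact: powR_ge0).
rewrite ler_expR (_ : - _ * _ = (psi z - psi (t%:C%C *: z)) * ((p - 1) / (2 * p))); last by ring.
apply: ler_wpM2l; first by rewrite subr_ge0.
by rewrite ler_pdivrMr ?mulr_gt0//; lra.
Qed.

(** psi(w/t) - psi(w) is at least |w|^2 (1-t)/rho(w)^2, which gives the decay when |w|^2 >= 1/2.
    Otherwise 1/rho(w) <= 2, the claimed decay exponent is at most 1/2, and [expR 2^-1] absorbs it.
    Once w/t leaves the ball the left side is 0. *)
Lemma hardy_tail w (t : R) : Bn w -> 2^-1 <= t <= 1 ->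
  hardyE (t^-1%:C%C *: w) <= hardyE w * expR 2^-1 * expR (- ((4 * rho w ^+ 2)^-1 * (1 - t))).
Proof.
move=> Bw /andP[t1 t2]; have t0 : 0 < t by lra.
rewrite {1}/hardyE; case: ifPn => [Bt|_]; last by rewrite !mulr_ge0 ?expR_ge0 ?hardyE_ge0.
rewrite /hardyE ifT// -!expRD ler_expR.
have r0 := rho_gt0 Bw; have r'0 := rho_gt0 Bt.
have E := rho_scale w t^-1; set r' := rho (t^-1%:C%C *: w) in r'0 E.
have -> : psi (t^-1%:C%C *: w) = r'^-1 by [].
have -> : psi w = (rho w)^-1 by [].
set r := rho w in r0 *; pose b := normz w ^+ 2; have rE : r = 1 - b by [].
have b0 : 0 <= b by exact: sqr_ge0.
have tV : 2 - t <= t^-1 ^+ 2.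
  rewrite exprVn -[leRHS]mul1r ler_pdivlMr ?exprn_gt0//.
  have : 0 <= (1 - t) * (1 - t) * t by rewrite !mulr_ge0//; lra.
  have : 0 <= (1 - t) * (2 * t - 1) by rewrite mulr_ge0//; lra.
  rewrite expr2; lra.
have dr : b * (1 - t) <= r - r'.
  have : b * (1 - t) <= b * (t^-1 ^+ 2 - 1) by apply: ler_wpM2l => //; lra.
  by rewrite E rE -/b; lra.
have rr' : r' <= r by have : 0 <= b * (1 - t) by [apply: mulr_ge0 => //; lra]; lra.
have q0 : 0 < r^-1 by rewrite invr_gt0.
have qq' : r^-1 <= r'^-1 by rewrite lef_pV2 ?posrE.
have dq : r^-1 ^+ 2 * (b * (1 - t)) <= r'^-1 - r^-1.
  have -> : r'^-1 - r^-1 = (r^-1 * r'^-1) * (r - r') by field; rewrite !gt_eqF.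
  apply: ler_pM => //; [exact: sqr_ge0|by apply: mulr_ge0 => //; lra|].
  by rewrite expr2 ler_pM2l.
have -> : (4 * r ^+ 2)^-1 * (1 - t) = r^-1 ^+ 2 * (1 - t) / 4 by field; rewrite gt_eqF.
have [b2|b2] := leP 2^-1 b.
  have : 0 <= (b - 2^-1) * (r^-1 ^+ 2 * (1 - t)).
    by apply: mulr_ge0; [lra|apply: mulr_ge0; [exact: sqr_ge0|lra]].
  lra.
have q2 : r^-1 <= 2 by rewrite -[leRHS]invrK lef_pV2 ?posrE// rE; lra.
have : r^-1 ^+ 2 * (1 - t) <= (2 * 2) * 2^-1.
  apply: ler_pM; [exact: sqr_ge0|lra| |lra].
  by rewrite expr2; apply: ler_pM => //; exact: ltW.
lra.
Qed.

(** The tail integrates to at most 4 rho(w)^2, which turns rho^(2p-2) into rho^(2p), and the two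
    half exponentials recombine to exp(-psi(w)). *)
Lemma hardy_inner g f w : holo g -> holo f ->
  (\int[mu]_t hG' (hardyH g f) hardyE t w <=
   (4 * expR 2^-1)%:E * winteg p (carleson_weight g) f w)%E.
Proof.
move=> hg hf; have [Bw|nB] := pselect (Bn w); last first.
  have H0 : hardyH g f w = 0 by rewrite /hardyH ifN//; exact/negP.
  rewrite integral0_eq => [|t _]; last by rewrite /hG' H0 mul0r; case: ifP.
  apply: mule_ge0; first by rewrite lee_fin mulr_ge0// expR_ge0.
  by apply: winteg_ge0 => z _; exact: carleson_weight_ge0.
have r0 := rho_gt0 Bw; have c0 : 0 < (4 * rho w ^+ 2)^-1 by rewrite invr_gt0 mulr_gt0// exprn_gt0.
have [cE rE] := ri_expR_le c0; pose A := hardyH g f w * (hardyE w * expR 2^-1).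
have A0 : 0 <= A by rewrite !mulr_ge0 ?hardyH_ge0 ?hardyE_ge0 ?expR_ge0.
apply: le_trans (integral_le_ri (k := fun t => A * expR (- ((4 * rho w ^+ 2)^-1 * (1 - t)))) (a := 2^-1) (b := 1) _ _ _ _) _.
- exact: contIZ.
- by move=> t; apply: hG'_ge0; [exact: hardyH_ge0|exact: hardyE_ge0].
- by move=> t tN; rewrite /hG' (negbTE tN).
- move=> t tI; rewrite /hG' tI lee_fin -mulrA; apply: ler_wpM2l; first exact: hardyH_ge0.
  exact: hardy_tail.
rewrite riZ// /winteg ifT// -EFinM lee_fin; apply: le_trans (ler_wpM2l A0 rE) _.
rewrite invrK /A /hardyH /hardyE !ifT// cabsM powRM ?cabs_ge0// /carleson_weight -/(rho w).
have -> : rho w `^ (2 * p) = rho w `^ (2 * p - 2) * rho w ^+ 2.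
  rewrite -powR_mulrn ?(ltW r0)// -powRD; last by rewrite (gt_eqF r0) implybT.
  by congr (_ `^ _); ring.
have -> : expR (- psi w) = expR (- psi w / 2) * expR (- psi w / 2) by rewrite -expRD; congr expR; field.
by rewrite le_eqVlt; apply/orP; left; apply/eqP; ring.
Qed.

(** The segment from 0 to z stays in the same closed ball, so bounds of f and of the derivatives of
    g on that ball suffice. *)
Lemma Vop_bound g (s : R) : holo g -> s < 1 -> exists2 A : R, 0 <= A & forall f (S : R), holo f ->
  (forall z, normz z <= s -> cabs (f z) <= S) -> forall z, normz z <= s -> cabs (Vop g f z) <= 2 * (A * S).
Proof.
move=> hg s1; have /choice[M hM] (j : 'I_n) := holo_bounded_cball (holo_dgrad j hg) s1.
exists (\sum_j `|M j|); first by rewrite sumr_ge0.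
move=> f S hf fS z nz; have Bz : Bn z by exact: le_lt_trans s1.
apply: cabs_VopB => // t /andP[t0 t1]; apply: le_trans (cabs_sum _) _.
have nt : normz (t%:C%C *: z) <= s.
  rewrite normzZ cabsE_real ger0_norm//; apply: le_trans nz.
  by rewrite -[leRHS]mul1r; apply: ler_wpM2r => //; exact: normz_ge0.
rewrite mulr_suml; apply: ler_sum => j _; rewrite !cabsM mulrA mulrC.
apply: ler_pM; rewrite ?mulr_ge0 ?cabs_ge0//; first by apply: le_trans (hM j _ nt) (ler_norm _).
rewrite -[leRHS]mul1r; apply: ler_pM; rewrite ?cabs_ge0 ?fS//.
by apply: le_trans (cabs_normz _ _) (le_trans nz (ltW s1)).
Qed.

Lemma hardy g : holo g -> exists2 K : R, 0 <= K & forall f (S : R), holo f ->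
  (forall z, normz z <= 2^-1 -> cabs (f z) <= S) ->
  (Apint p (Vop g f) <= (K * S `^ p)%:E + K%:E * wint p (carleson_weight g) f)%E.
Proof.
move=> hg; have h21 : 2^-1 < 1 :> R by lra.
have [A A0 VB] := Vop_bound hg h21.
have p0 : 0 <= p by exact: le_trans p1.
(* [K1] belongs to the inner half of the ray, with [4 ^+ n] for the mass of the ball. In [K2] the 4
   in the base is the 2 of complex integrals times 1/t <= 2, [4 ^+ n] comes from [hardy_swap] and
   the last factor from [hardy_inner]. *)
pose K1 := (2 * (2 * A)) `^ p * 4 ^+ n; pose K2 := (2 * 4) `^ p * hardyK * 4 ^+ n * (4 * expR 2^-1).
have K10 : 0 <= K1 by rewrite mulr_ge0 ?powR_ge0 ?exprn_ge0.
have K20 : 0 <= K2 by rewrite !mulr_ge0 ?powR_ge0 ?exprn_ge0 ?expR_ge0 ?(ltW hardyK_gt0).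
exists (K1 + K2); first exact: addr_ge0.
move=> f S hf fS; have S0 : 0 <= S by apply: le_trans (fS 0 _); rewrite ?cabs_ge0// normz0 invr_ge0.
have V2 z : Bn z -> cabs (Vop g f (2^-1%:C%C *: z)) <= 2 * (A * S).
  move=> Bz; apply: VB => //; rewrite normzZ cabsE_real ger0_norm ?invr_ge0// -[leRHS]mulr1.
  by apply: ler_wpM2l; rewrite ?invr_ge0//; exact: ltW.
pose Y z := (\int[mu]_t hG (hardyH g f) hardyE t z)%E.
have Y0 z : (0 <= Y z)%E by apply: integral_ge0 => t _; apply: hG_ge0; [exact: hardyH_ge0|exact: hardyE_ge0].
have mY : vmeas Y := vmeas_int_hG (measurable_hardyH hg hf) measurable_hardyE (hardyH_ge0 g f) hardyE_ge0.
pose X := winteg p (fun=> 1) (fun _ : Cn => 1 : C^o).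
have X0 z : (0 <= X z)%E by exact: winteg_ge0.
have mX : vmeas X by apply: vmeas_winteg; [exact: holo_cst|exact: measurable_ball1].
pose c1 := (2 * (2 * (A * S))) `^ p; pose c2 := (2 * 4) `^ p * hardyK.
have c10 : 0 <= c1 by exact: powR_ge0.
have c20 : 0 <= c2 by rewrite mulr_ge0 ?powR_ge0 ?(ltW hardyK_gt0).
have pt z : (winteg p (fun=> 1%R) (Vop g f) z <= c1%:E * X z + c2%:E * Y z)%E.
  rewrite /winteg /X; case: ifPn => Bz; last first.
    by rewrite adde_ge0// mule_ge0 ?lee_fin// /winteg (negbTE Bz).
  set I := ri (fun t => cabs (f (t%:C%C *: z) * Rder g (t%:C%C *: z))) 2^-1 1.
  have cf : ccI (fun t => f (t%:C%C *: z) * Rder g (t%:C%C *: z)) 2^-1 1.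
    apply: (@ccI_ray _ _ (fun w => f w * Rder g w : C^o)) => //.
    by apply: holoM => //; exact: holo_Rder.
  have I0 : 0 <= I.
    rewrite -[leLHS](mulr0 (1 - 2^-1)) -ri_cst; last lra.
    by apply: le_ri => [||t _]; [exact: contI_cst|exact: ccI_cabs|exact: cabs_ge0].
  have cG : ccI (Gker g f ^~ z) 2^-1 1 by apply: ccI_sub (ccI_Gker hg hf Bz); rewrite ?invr_ge0.
  have Vb : cabs (Vop g f z) <= 2 * (A * S) + 4 * I.
    rewrite (Vop_half hg hf Bz); apply: le_trans (cabsD _ _) _; apply: lerD; first exact: V2.
    apply: le_trans (cabs_ci_le cG) _; rewrite (_ : 4 * I = 2 * (2 * I)); last by ring.
    rewrite ler_pM2l// -riZ; last exact: ccI_cabs.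
    apply: le_ri => [||t /andP[t1 t2]]; [exact: ccI_cabs|by apply: contIZ; exact: ccI_cabs|].
    have t0 : 0 < t by lra.
    rewrite Gker_eq ?gt_eqF// cabsM cabsV cabsE_real gtr0_norm// mulrC.
    apply: ler_wpM2r; first exact: cabs_ge0.
    by rewrite -[leRHS]invrK lef_pV2 ?posrE ?invr_gt0.
  have Vp : cabs (Vop g f z) `^ p <= c1 + (2 * 4) `^ p * I `^ p.
    apply: le_trans (_ : (2 * (A * S) + 4 * I) `^ p <= _).
      by apply: ge0_ler_powR; rewrite ?nnegrE ?cabs_ge0 ?addr_ge0 ?mulr_ge0.
    apply: le_trans (ler_powRD p1 _ _) _; rewrite ?mulr_ge0//.
    rewrite mulrDr -!powRM ?mulr_ge0// lerD2l.
    by rewrite mulrA.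
  have hp := hardy_pointwise hg hf Bz; rewrite -/I -/(Y z) in hp.
  have e0 := expR_ge0 (- psi z).
  rewrite (_ : winteg _ _ _ z = (expR (- psi z))%:E); last first.
    by rewrite /winteg Bz cabs1 powR1 mul1r mulr1.
  apply: le_trans (_ : ((c1 * expR (- psi z))%:E + ((2 * 4) `^ p * expR (- psi z))%:E * (I `^ p)%:E <= _)%E).
    rewrite -EFinM -EFinD lee_fin mulr1; apply: le_trans (ler_wpM2r e0 Vp) _.
    by rewrite le_eqVlt; apply/orP; left; apply/eqP; ring.
  apply: leeD; first by rewrite -EFinM.
  apply: le_trans (lee_wpmul2l _ hp) _; first by rewrite lee_fin mulr_ge0 ?powR_ge0.
  rewrite muleA -EFinM.
  have -> // : (2 * 4) `^ p * expR (- psi z) * (hardyK * expR (psi z)) = c2.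
  have eN : expR (- psi z) * expR (psi z) = 1 by rewrite -expRD addNr expR0.
  by rewrite mulrACA eN mulr1.
apply: le_trans (_ : (c1%:E * vint X + c2%:E * vint Y <= _)%E).
  rewrite -(vintZ mX X0 c10) -(vintZ mY Y0 c20) -vintD.
  - by apply: le_vint => z; [exact: winteg_ge0|exact: pt].
  - exact: emeasurable_funM.
  - exact: emeasurable_funM.
  - by move=> z; rewrite mule_ge0.
  - by move=> z; rewrite mule_ge0.
have W0 z : (0 <= winteg p (carleson_weight g) f z)%E.
  by apply: winteg_ge0 => v _; exact: carleson_weight_ge0.
have mW : vmeas (winteg p (carleson_weight g) f) by apply: vmeas_winteg => //; exact: measurable_carleson_weight.
have wW : (0 <= wint p (carleson_weight g) f)%E by exact: vint_ge0.
apply: leeD.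
  have Xb : (vint X <= (4 ^+ n)%:E)%E := Apint_cst1 n p.
  apply: (@le_trans _ _ (c1%:E * (4 ^+ n)%:E)%E); first by apply: lee_wpmul2l; rewrite ?lee_fin.
  rewrite -EFinM lee_fin; apply: le_trans (_ : K1 * S `^ p <= _).
    by rewrite /c1 /K1 mulrA (mulrA _ A S) mulrA powRM ?mulr_ge0// mulrAC.
  by apply: ler_wpM2r; [exact: powR_ge0|rewrite lerDl].
have Yb : (vint Y <= (4 ^+ n * (4 * expR 2^-1))%:E * wint p (carleson_weight g) f)%E.
  have := hardy_swap (measurable_hardyH hg hf) measurable_hardyE (hardyH_ge0 g f) hardyE_ge0.
  move=> /le_trans; apply; rewrite EFinM -muleA; apply: lee_wpmul2l; first by rewrite lee_fin exprn_ge0.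
  rewrite wintE -vintZ// ?mulr_ge0 ?expR_ge0//; apply: le_vint => z; last exact: hardy_inner.
  by apply: integral_ge0 => t _; apply: hG'_ge0; [exact: hardyH_ge0|exact: hardyE_ge0].
apply: le_trans (lee_wpmul2l _ Yb) _; first by rewrite lee_fin.
rewrite muleA -EFinM; apply: lee_wpmul2r => //; rewrite lee_fin.
have -> : c2 * (4 ^+ n * (4 * expR 2^-1)) = K2 by rewrite /c2 /K2; ring.
by rewrite lerDr.
Qed.

End Hardy.

(** * From decay of the radial derivative to the Carleson condition and compactness *)

Section CarlesonCompact.
Variables (R : realType) (n : nat) (p : R).
Hypothesis p1 : 1 <= p.
Local Notation C := (R[i]).
Local Notation Cn := ('rV[R[i]]_n).
Implicit Types (z w : Cn) (f g : Cn -> C^o).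

Lemma cvge0P (u : nat -> \bar R) : (forall j, (0 <= u j)%E) ->
  (u @ \oo --> 0%E) <-> (forall e : R, 0 < e -> \forall j \near \oo, (u j <= e%:E)%E).
Proof.
move=> u0; split=> [cu e e0|H].
  have e0' : (0%:E < e%:E)%E by rewrite lte_fin.
  have : nbhs (0%E : \bar R) [set y | (y < e%:E)%E] by apply: open_nbhs_nbhs; split => //; exact: open_ereal_lt_ereal.
  by move=> /cu[N _ HN]; exists N => // j /HN /= /ltW.
apply/fine_cvgP; split.
  have := H 1 ltr01; apply: filterS => j h.
  by rewrite ge0_fin_numE// (le_lt_trans h)// ltry.
apply/cvgrPdist_le => e e0; have := H e e0; apply: filterS => j h /=.
rewrite sub0r normrN ger0_norm ?fine_ge0// -lee_fin fineK// ge0_fin_numE//.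
by rewrite (le_lt_trans h)// ltry.
Qed.

Lemma powR_le_self (x : R) : 0 <= x <= 1 -> x `^ p <= x.
Proof.
move=> /andP[x0 x1]; have [->|xn0] := eqVneq x 0.
  by rewrite powR0// gt_eqF// (lt_le_trans ltr01).
by rewrite -[leRHS]powRr1//; apply: ger_powR => //; rewrite x1 lt_def xn0 x0.
Qed.

Lemma wint_scale (w : Cn -> R) f (c : C) : holo f -> (forall z, Bn z -> 0 <= w z) ->
  measurable_fun setT ((fun z => if normz z < 1 then w z else 0) : g_sigma_algebraType (@coord_sets R n) -> measurableTypeR R) ->
  wint p w (fun z => (c * f z)%R : C^o) = ((cabs c `^ p)%:E * wint p w f)%E.
Proof.
move=> hf w0 mw; rewrite !wintE -(vintZ (vmeas_winteg p hf mw) (winteg_ge0 p f w0)) ?powR_ge0//.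
apply: eq_vint => z; rewrite /winteg; case: ifP => _; last by rewrite mule0.
by rewrite -EFinM cabsM powRM ?cabs_ge0// !mulrA.
Qed.

Lemma ucc0_cball (f : nat -> Cn -> C^o) (s e : R) : ucc0 f -> s < 1 -> 0 < e ->
  \forall j \near \oo, forall z, normz z <= s -> cabs (f j z) < e.
Proof.
move=> uf s1 e0; apply: (uf _ (@compact_cball R n s)) => // z zs.
exact: le_lt_trans s1.
Qed.

(** The vanishing condition speaks only of limits. Tested on f/(j+1), which is bounded and tends to
    0 locally uniformly, it makes one of these integrals at most 1, and homogeneity returns to f. *)
Lemma carleson_finite g f : holo g -> vanishing_carleson p (carleson_weight p g) -> inA p f ->
  (wint p (carleson_weight p g) f < +oo)%E.
Proof.
move=> hg vc [hf lf]; pose fj j z : C^o := (j.+1%:R^-1)%:C%C * f z.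
have hj j : holo (fj j) by apply: holoM => //; exact: holo_cst.
have cj j : cabs (j.+1%:R^-1)%:C%C = j.+1%:R^-1 :> R by rewrite cabsE_real ger0_norm// invr_ge0.
have Aj j : (Apint p (fj j) <= Apint p f)%E.
  apply: le_Apint => // z _; rewrite cabsM cj -[leRHS]mul1r.
  by apply: ler_wpM2r; [exact: cabs_ge0|rewrite invf_le1// ler1n].
have fb : Abounded p fj.
  split=> [j|]; first by split; [exact: hj|exact: le_lt_trans (Aj j) lf].
  by exists (fine (Apint p f)) => j; rewrite fineK ?ge0_fin_numE ?Apint_ge0.
have fu : ucc0 fj.
  move=> K cK KB e e0; have [s /andP[s0 s1] Ks] := compact_normz_lt1 cK KB.
  have [M hM] := holo_bounded_cball hf s1; have M0 : 0 <= M by apply: le_trans (hM 0 _); rewrite ?cabs_ge0// normz0.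
  near=> j => z /Ks /hM fM; rewrite cabsM cj mulrC ltr_pdivrMr//.
  apply: le_lt_trans fM _; rewrite mulrC -ltr_pdivrMr//.
  apply: le_lt_trans (_ : j%:R < _); last by rewrite ltr_nat.
  by near: j; exact: nbhs_infty_ger.
have w0 z : Bn z -> 0 <= carleson_weight p g z by move=> _; exact: carleson_weight_ge0.
have mw := measurable_carleson_weight p hg.
have := vc fj fb fu; move/cvge0P => /(_ (fun j => vint_ge0 (winteg_ge0 p (fj j) w0))) /(_ 1 ltr01).
case=> N _ /(_ N (leqnn N)) /=.
have Ef : f = fun z => (N.+1%:R)%:C%C * fj N z : C^o.
  by apply/funext => z; rewrite /fj mulrA -rmorphM mulfV// rmorph1 mul1r.
rewrite Ef (wint_scale _ (hj N) w0 mw) => h1.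
apply: le_lt_trans (_ : ((cabs (N.+1%:R)%:C%C `^ p)%:E * 1%:E < _)%E); last by rewrite -EFinM ltry.
by apply: lee_wpmul2l => //; rewrite lee_fin powR_ge0.
Unshelve. all: by end_near. Qed.

(** The limit F of a convergent subsequence supplies the limit V_g F of the images. The Hardy
    inequality applied to f_j - F has two terms, one small by uniform convergence on the half ball,
    the other by the Carleson condition. *)
Lemma carleson_compact g : holo g -> vanishing_carleson p (carleson_weight p g) -> compact_op p (Vop g).
Proof.
move=> hg vc f fb; have [inf [M hM]] := fb.
have w0 z : Bn z -> 0 <= carleson_weight p g z by move=> _; exact: carleson_weight_ge0.
have [K K0 HK] := hardy p1 hg.
have VA h : inA p h -> inA p (Vop g h).
  move=> hA; have [hh _] := hA; split; first exact: holo_Vop.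
  have [S hS] := @holo_bounded_cball _ _ h 2^-1 hh (ltac:(lra)).
  apply: le_lt_trans (HK h S hh hS) _; rewrite lte_add_pinfty ?ltry//.
  by apply: lte_mul_pinfty; rewrite ?lee_fin//; exact: carleson_finite.
split=> [j|]; first exact: VA.
have [phi [hphi [F [FA [kb ku]]]]] := montel p1 fb.
exists phi; split => //; exists (Vop g F); split; first exact: VA.
pose k j z : C^o := f (phi j) z - F z.
have hF := FA.1; have hk j : holo (k j) := (kb.1 j).1.
have E j : (Apint p (fun z => (Vop g (f (phi j)) z - Vop g F z)%R) <= Apint p (Vop g (k j)))%E.
  by apply: le_Apint => // z Bz; rewrite /k VopB//; exact: (inf _).1.
apply/cvge0P => [j|e e0]; first exact: Apint_ge0.
(* The cap at 1 gives d^p <= d, so both terms of the Hardy bound can be controlled by K d. *)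
pose d := Num.min 1 (e / 2 / (K + 1)).
have K10 : 0 < K + 1 by lra.
have d0 : 0 < d by rewrite lt_min ltr01 !divr_gt0.
have dp : d `^ p <= d by apply: powR_le_self; rewrite (ltW d0) ge_min lexx.
have Kd : K * d <= e / 2.
  apply: le_trans (_ : (K + 1) * d <= _); first by apply: ler_wpM2r; [exact: ltW|lra].
  by rewrite mulrC -ler_pdivlMr// ge_min lexx orbT.
have n1 := @ucc0_cball k 2^-1 d ku (ltac:(lra)) d0.
have n2 := (cvge0P (fun j => vint_ge0 (winteg_ge0 p (k j) w0))).1 (vc k kb ku) d d0.
near=> j; apply: le_trans (E j) _.
apply: le_trans (HK (k j) d (hk j) _) _.
  move=> z zs; apply: ltW; move: z zs.
  by near: j; exact: n1.
apply: (@le_trans _ _ ((K * d)%:E + K%:E * d%:E)%E).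
  apply: leeD; first by rewrite lee_fin ler_wpM2l.
  by apply: lee_wpmul2l; [rewrite lee_fin|near: j; exact: n2].
by rewrite -EFinM -EFinD lee_fin; lra.
Unshelve. all: by end_near. Qed.

(** The weight is the p-th power of |Rg| (1-|z|^2)^2. Beyond radius r it is at most d^p and is
    paired with the bounded norms; inside, f_j is below y and the weight is bounded, so a multiple
    of the mass of the ball remains. *)
Lemma little_oh_carleson g : holo g ->
  (forall eps : R, 0 < eps -> exists r : R, r < 1 /\
     forall z, r < normz z < 1 -> cabs (Rder g z) * (1 - normz z ^+ 2) ^+ 2 < eps) ->
  vanishing_carleson p (carleson_weight p g).
Proof.
move=> hg Hc f fb fu; have [inf [M hM]] := fb; have hR := holo_Rder hg.
have p0 : 0 <= p by exact: le_trans p1.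
have w0 z : Bn z -> 0 <= carleson_weight p g z by move=> _; exact: carleson_weight_ge0.
have wE z : Bn z -> carleson_weight p g z = (cabs (Rder g z) * rho z ^+ 2) `^ p.
  move=> Bz; rewrite powRM ?cabs_ge0 ?sqr_ge0// /carleson_weight -/(rho z).
  by rewrite -powR_mulrn ?(ltW (rho_gt0 Bz))// -powRrM.
apply/cvge0P => [j|e e0]; first exact: vint_ge0 (winteg_ge0 p (f j) w0).
have M1 : 0 < `|M| + 1 by rewrite ltr_wpDl.
(* As d <= 1 one has d^p <= d, so the outer part is at most e/2; y is chosen likewise for the inner
   part. *)
pose d := Num.min 1 (e / 2 / (`|M| + 1)).
have d0 : 0 < d by rewrite lt_min ltr01 !divr_gt0.
have dM : d `^ p * `|M| <= e / 2.
  have h1 : d `^ p <= d by apply: powR_le_self; rewrite (ltW d0) ge_min lexx.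
  have h2 : d * (`|M| + 1) <= e / 2 by rewrite -ler_pdivlMr// ge_min lexx orbT.
  apply: le_trans h2; apply: ler_pM => //; first exact: powR_ge0.
  by rewrite lerDl.
have [r [r1 Hr]] := Hc d d0; have [B hB] := holo_bounded_cball hR r1.
pose B1 := `|B| `^ p * 4 ^+ n + 1; have B10 : 0 < B1 by rewrite ltr_wpDl// mulr_ge0 ?powR_ge0 ?exprn_ge0.
pose y := Num.min 1 (e / 2 / B1); have y0 : 0 < y by rewrite lt_min ltr01 !divr_gt0.
have yB : y `^ p * `|B| `^ p * 4 ^+ n <= e / 2.
  have h1 : y `^ p <= y by apply: powR_le_self; rewrite (ltW y0) ge_min lexx.
  have h2 : y * B1 <= e / 2 by rewrite -ler_pdivlMr// ge_min lexx orbT.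
  apply: le_trans h2; rewrite -mulrA; have B0 : 0 <= `|B| `^ p * 4 ^+ n by rewrite mulr_ge0 ?powR_ge0 ?exprn_ge0.
  by apply: ler_pM => //; [exact: powR_ge0|rewrite lerDl].
have n1 := ucc0_cball fu r1 y0.
near=> j; have fy z : normz z <= r -> cabs (f j z) < y by move: z; near: j; exact: n1.
have hf := (inf j).1.
pose X := winteg p (fun=> 1) (fun _ : Cn => 1 : C^o).
have X0 z : (0 <= X z)%E by exact: winteg_ge0.
have mX : vmeas X by apply: vmeas_winteg; [exact: holo_cst|exact: measurable_ball1].
pose Z := winteg p (fun=> 1) (f j).
have Z0 z : (0 <= Z z)%E by exact: winteg_ge0.
have mZ : vmeas Z by apply: vmeas_winteg => //; exact: measurable_ball1.
have c0 : 0 <= y `^ p * `|B| `^ p by rewrite mulr_ge0 ?powR_ge0.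
apply: (@le_trans _ _ ((d `^ p)%:E * vint Z + (y `^ p * `|B| `^ p)%:E * vint X)%E).
  rewrite -(vintZ mZ Z0 (powR_ge0 _ _)) -(vintZ mX X0 c0) -vintD.
  - apply: le_vint => z; first exact: winteg_ge0.
    rewrite /Z /X /winteg; case: ifPn => Bz; last by rewrite !mule0 adde0.
    rewrite -!EFinM -EFinD lee_fin cabs1 powR1 !mulr1 mul1r.
    have [zr|zr] := leP (normz z) r.
      apply: ler_wpDl; first by rewrite !mulr_ge0 ?powR_ge0 ?expR_ge0.
      rewrite mulrAC; apply: ler_wpM2r; first exact: expR_ge0.
      apply: ler_pM; rewrite ?powR_ge0 ?w0//.
        by apply: ge0_ler_powR; rewrite ?nnegrE ?cabs_ge0 ?(ltW y0) ?(ltW (fy z zr)).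
      have hle : cabs (Rder g z) * rho z ^+ 2 <= `|B|.
        rewrite -[leRHS]mulr1; apply: ler_pM; rewrite ?cabs_ge0 ?sqr_ge0//.
          by apply: le_trans (hB z zr) (ler_norm _).
        by rewrite expr_le1 ?rho_le1// ltW// rho_gt0.
      rewrite wE//; apply: ge0_ler_powR => //; rewrite nnegrE//.
      by apply: mulr_ge0; [exact: cabs_ge0|exact: sqr_ge0].
    apply: ler_wpDr; first by rewrite !mulr_ge0 ?powR_ge0 ?expR_ge0.
    rewrite mulrC; apply: ler_wpM2r; first by rewrite mulr_ge0 ?powR_ge0 ?expR_ge0.
    rewrite wE//; apply: ge0_ler_powR; rewrite ?nnegrE ?(ltW d0)//.
      by apply: mulr_ge0; [exact: cabs_ge0|exact: sqr_ge0].
    by apply: ltW; apply: Hr; rewrite zr.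
  - exact: emeasurable_funM.
  - exact: emeasurable_funM.
  - by move=> z; rewrite mule_ge0 ?lee_fin ?powR_ge0.
  - by move=> z; rewrite mule_ge0 ?lee_fin.
have ZM : (vint Z <= `|M|%:E)%E by apply: le_trans (hM j) _; rewrite lee_fin ler_norm.
have Xb : (vint X <= (4 ^+ n)%:E)%E := Apint_cst1 n p.
apply: (@le_trans _ _ ((d `^ p)%:E * `|M|%:E + (y `^ p * `|B| `^ p)%:E * (4 ^+ n)%:E)%E).
  by apply: leeD; apply: lee_wpmul2l; rewrite ?lee_fin ?powR_ge0.
by rewrite -!EFinM -EFinD lee_fin; lra.
Unshelve. all: by end_near. Qed.

End CarlesonCompact.

(** * Extremal functions *)

Section FourPoint.
Variable R : realType.
Local Notation C := (R[i]).
Implicit Types (h u : C -> C).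

Lemma cdiff_unit_scale u (c z l : C) : cabs c = 1 -> cdiff u (c * z) l -> cdiff (fun w => u (c * w)) z (c * l).
Proof.
move=> c1 du e e0; have [d d0 H] := du e e0; exists d => // w wz.
have N : cabs (c * w - c * z) = cabs (w - z) by rewrite -mulrBr cabsM c1 mul1r.
by have := H (c * w); rewrite N -mulrBr => /(_ wz); rewrite mulrA [l * c]mulrC.
Qed.

(* The sum of a holomorphic function over the vertices of a small square agrees
   with its central value up to third order, since 1 + i - 1 - i and the sum of
   the squares both vanish: a substitute for the mean value property on circles. *)
Lemma four_point h (h' h'' : C -> C) z0 (r M : R) : 0 < r ->
  (forall z, cabs (z - z0) < r -> cdiff h z (h' z) /\ cdiff h' z (h'' z)) ->
  (forall z, cabs (z - z0) < r -> cabs (h' z) <= M) ->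
  exists K : R, forall s : R, 0 < s <= r / 4 ->
  cabs ((h (z0 + s%:C%C) + h (z0 + Complex 0 1 * s%:C%C)) + (h (z0 + - 1 * s%:C%C) + h (z0 + - Complex 0 1 * s%:C%C)) - (h z0 + h z0 + (h z0 + h z0))) <= K * s ^+ 3.
Proof.
move=> r0 dh hM; exists (16 * (64 * (128 * M / r) / (r / 4))) => s /andP[s0 sr]; pose I : C := Complex 0 1.
have II : I * I = -1 by apply: complex_eqP; rewrite ?Re_mulE ?Im_mulE ?ReN ?ImN /=; ring.
have cI : cabs I = 1 by rewrite cabs_imag normr1.
have In (c t : C) : cabs c = 1 -> cabs t <= s -> cabs (z0 + c * t - z0) <= r / 4.
  by move=> c1 ts; rewrite addrAC subrr add0r cabsM c1 mul1r; exact: le_trans sr.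
have r4 : r / 4 < r by lra.
have dE (c t : C) : cabs c = 1 -> cabs t <= s -> cdiff (fun t => h (z0 + c * t)) t (c * h' (z0 + c * t)).
  move=> c1 ts; apply: (@cdiff_unit_scale (fun w => h (z0 + w))) => //.
  by apply: cdiff_shift; apply: (dh _ _).1; apply: le_lt_trans r4; exact: In.
pose D t := (h (z0 + 1 * t) + h (z0 + I * t)) + (h (z0 + - 1 * t) + h (z0 + - I * t)).
pose D' t := (1 * h' (z0 + 1 * t) + I * h' (z0 + I * t)) + (- 1 * h' (z0 + - 1 * t) + - I * h' (z0 + - I * t)).
have c1 : cabs (1 : C) = 1 := cabs1 R.
have cN1 : cabs (- 1 : C) = 1 by rewrite cabsN.
have cNI : cabs (- I) = 1 by rewrite cabsN.
have dD (t : C) : cabs t <= s -> cdiff D t (D' t).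
  by move=> ts; apply: cdiffD; apply: cdiffD; apply: dE.
pose K := 2 * (64 * (128 * M / r) / (r / 4)).
have T (c t : C) : cabs c = 1 -> cabs t <= s ->
    cabs (h' (z0 + c * t) - h' z0 - h'' z0 * (c * t)) <= K * cabs t ^+ 2.
  move=> cc ts; have := @holo_taylor _ h' h'' z0 r M r0 (fun z zr => (dh z zr).2) hM (z0 + c * t) (In c t cc ts).
  by rewrite [z0 + c * t - z0]addrAC subrr add0r cabsM cc mul1r.
have K0 : 0 <= K * s ^+ 2.
  have := T 1 s%:C%C c1; rewrite cabsE_real gtr0_norm// => /(_ (lexx _)); apply: le_trans.
  exact: cabs_ge0.
have bD' (t : C) : cabs t <= s -> cabs (D' t) <= 4 * (K * s ^+ 2).
  move=> ts; pose e c := h' (z0 + c * t) - h' z0 - h'' z0 * (c * t).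
  have -> : D' t = (1 * e 1 + I * e I) + (- 1 * e (- 1) + - I * e (- I)).
    have E (a b c d x y q j : C) : j * j = -1 -> (1 * a + j * b) + (- 1 * c + - j * d) =
       (1 * (a - x - y * (1 * q)) + j * (b - x - y * (j * q))) + (- 1 * (c - x - y * (- 1 * q)) + - j * (d - x - y * (- j * q))).
      move=> jj; have E2 : (1 * (a - x - y * (1 * q)) + j * (b - x - y * (j * q))) + (- 1 * (c - x - y * (- 1 * q)) + - j * (d - x - y * (- j * q)))
         = (1 * a + j * b) + (- 1 * c + - j * d) - 2 * y * q * (1 + j * j) by ring.
      by rewrite E2 jj subrr mulr0 subr0.
    exact: E.
  have b c : cabs c = 1 -> cabs (c * e c) <= K * s ^+ 2.
    move=> cc; rewrite cabsM cc mul1r; apply: le_trans (T c t cc ts) _.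
    have := T c s%:C%C cc; rewrite cabsE_real gtr0_norm// => /(_ (lexx _)) h0.
    have Kp : 0 <= K.
      by move: K0; rewrite pmulr_lge0// exprn_gt0.
    by apply: ler_wpM2l => //; rewrite ler_pXn2r ?nnegrE ?cabs_ge0 ?(ltW s0).
  have := b 1 c1; have := b I cI; have := b (- 1) cN1; have := b (- I) cNI.
  have := cabsD (1 * e 1 + I * e I) (- 1 * e (- 1) + - I * e (- I)).
  have := cabsD (1 * e 1) (I * e I); have := cabsD (- 1 * e (- 1)) (- I * e (- I)).
  lra.
have ts (t : R) : 0 <= t <= 1 -> cabs (0 + t%:C%C * s%:C%C) <= s.
  move=> /andP[t0 t1]; rewrite add0r cabsM !cabsE_real !ger0_norm ?(ltW s0)//.
  by rewrite -[leRHS]mul1r ler_pM2r.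
have := @cdiff_mvt _ D D' 0 s%:C%C (4 * (K * s ^+ 2)) (fun t tI => dD _ (ts t tI)) (fun t tI => bD' _ (ts t tI)).
rewrite add0r cabsE_real gtr0_norm// /D !mulr0 !addr0 mul1r.
by move=> /le_trans; apply; rewrite /K le_eqVlt; apply/orP; left; apply/eqP; field; rewrite gt_eqF.
Qed.

End FourPoint.

(** * A maximum principle with an arbitrarily small loss *)

Section MaximumPrinciple.
Variable R : realType.
Local Notation C := (R[i]).

Lemma max_on_cball n (q : 'rV[C]_n -> R) (s : R) : 0 <= s ->
  (forall z, normz z <= s -> {for z, continuous (q : @CnN R n -> R)}) ->
  exists c, normz c <= s /\ forall z, normz z <= s -> q z <= q c.
Proof.
move=> s0 cq; have A0 : [set z : @CnN R n | normz z <= s] !=set0 by exists 0; rewrite /= normz0.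
have [|c] := @compact_EVT_max (@CnN R n) R q [set z | normz z <= s] A0 (@compact_cball R n s).
  by apply: continuous_in_subspaceT => z /set_mem; exact: cq.
by move=> /set_mem cs H; exists c; split => // z zs; apply: H; rewrite inE.
Qed.

Lemma nrm1_continuous n (q : 'rV[C]_n -> R) (z : 'rV[C]_n) :
  (forall e : R, 0 < e -> exists2 d : R, 0 < d & forall w, nrm1 (w - z) < d -> `|q w - q z| <= e) ->
  {for z, continuous (q : @CnN R n -> R)}.
Proof.
move=> H A /nbhs_ballP[e /= e0 eA]; have e2 : 0 < e / 2 by rewrite divr_gt0.
have [d d0 Hd] := H _ e2; change (nbhs (z : CnN n) (q @^-1` A)).
apply/nbhs_nrm1P; exists d => // w /Hd h; apply: eA; rewrite /ball/= distrC.
by apply: le_lt_trans h _; lra.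
Qed.

Lemma parallelogram n (z w : 'rV[C]_n) :
  normz (z + w) ^+ 2 + normz (z - w) ^+ 2 = 2 * (normz z ^+ 2 + normz w ^+ 2).
Proof.
rewrite !sqr_normz -!big_split/= mulr_sumr; apply: eq_bigr => j _.
by rewrite !mxE !sqr_cabs !ReD !ImD !ReN !ImN; ring.
Qed.

(** The linear arithmetic that ends [max_principle]. The X are the squared moduli at the four
    vertices, the E the values of the quadratic penalty, the y the first-order terms. Summation
    gives 2(A+B) + 4T <= 0, whereas A + B >= -T. *)
Lemma square_mean_contradiction (y1 y2 y3 y4 A B h X1 X2 X3 X4 E1 E2 E3 E4 Ec T D : R) :
  h + 2 * y1 <= X1 -> h + 2 * y2 <= X2 -> h + 2 * y3 <= X3 -> h + 2 * y4 <= X4 ->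
  - D <= A -> - D <= B -> X1 + E1 <= h + Ec -> X2 + E2 <= h + Ec -> X3 + E3 <= h + Ec -> X4 + E4 <= h + Ec ->
  E1 + E3 = 2 * Ec + 2 * T -> E2 + E4 = 2 * Ec + 2 * T -> D <= T / 2 ->
  y1 + y2 + (y3 + y4) = A + B -> 0 < T -> False.
Proof.
have st (y X E : R) : h + 2 * y <= X -> X + E <= h + Ec -> 2 * y + E <= Ec by lra.
move=> /st l1 /st l2 /st l3 /st l4 DA DB /l1 q1 /l2 q2 /l3 q3 /l4 q4; clear l1 l2 l3 l4 st; lra.
Qed.

(** The function q = |H|^2 + eta |z|^2 has no interior maximum c: over the vertices of a small
    square about c the penalty gains eta t^2 on average, while |H|^2 loses only third-order terms by
    [four_point]. So q is maximal on the sphere, where removing the penalty costs at most eta. *)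
Lemma max_principle n (H : 'rV[C]_n.+1 -> C^o) z (s eta : R) : holo H -> s < 1 -> normz z <= s -> 0 < eta ->
  exists a, normz a = s /\ cabs (H z) ^+ 2 <= cabs (H a) ^+ 2 + eta.
Proof.
move=> hH s1 zs e0; have s0 : 0 <= s := le_trans (normz_ge0 z) zs.
pose q w := cabs (H w) * cabs (H w) + eta * (normz w * normz w).
have [|c [cs cM]] := @max_on_cball n.+1 q s s0.
  move=> w ws; have Bw : Bn w by exact: le_lt_trans s1.
  have cH : {for w, continuous ((fun w => cabs (H w)) : @CnN R n.+1 -> R)}.
    apply: nrm1_continuous => e e1; have [d d0 Hd] := fdiff_cont (holo_fdiff hH Bw) e1.
    by exists d => // v /Hd; apply: le_trans; exact: cabs_dist.
  have cN : {for w, continuous (@normz R n.+1 : @CnN R n.+1 -> R)}.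
    apply: nrm1_continuous => e e1; exists e => // v /ltW; apply: le_trans.
    rewrite ler_norml; apply/andP; split.
      by have := normzD (w - v) v; rewrite subrK; have := normz_nrm1 (w - v); rewrite -nrm1N opprB; lra.
    by have := normzD (v - w) w; rewrite subrK; have := normz_nrm1 (v - w); lra.
  have cE : {for w, continuous ((fun=> eta) : @CnN R n.+1 -> R)} by exact: cst_continuous.
  have cHH := @continuousM R (@CnN R n.+1) _ _ w cH cH.
  have cNN := @continuousM R (@CnN R n.+1) _ _ w cN cN.
  exact: (@continuousD R R^o (@CnN R n.+1) _ _ w cHH (@continuousM R (@CnN R n.+1) _ _ w cE cNN)).
have [cE|cN] := eqVneq (normz c) s.
  exists c; split => //; have := cM z zs; rewrite /q -!expr2.
  have : 0 <= eta * normz z ^+ 2 by rewrite mulr_ge0 ?sqr_ge0// ltW.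
  have : eta * normz c ^+ 2 <= eta * 1.
    by rewrite ler_pM2l// expr_le1 ?normz_ge0// cE ltW.
  lra.
exfalso; have cs' : normz c < s by rewrite lt_neqAle cN.
pose v : 'rV[C]_n.+1 := delta_mx 0 0; pose r := s - normz c; have r0 : 0 < r by rewrite subr_gt0.
have v1 : normz v <= 1 by apply: le_trans (normz_nrm1 _) _; rewrite nrm1_delta.
have nv (w : C) : cabs w <= r -> normz (c + w *: v) <= s.
  move=> wr; apply: le_trans (normzD _ _) _; rewrite normzZ.
  have : cabs w * normz v <= r * 1 by apply: ler_pM; rewrite ?cabs_ge0 ?normz_ge0.
  by rewrite /r; lra.
(* First and second derivatives of H in the direction v; [H1] is again holomorphic, as [four_point]
   demands of the derivative. *)
pose H1 w : C^o := \sum_k v 0 k * dgrad H w k; pose H2 w : C := \sum_k v 0 k * dgrad H1 w k.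
have hH1 : holo H1.
  apply: (@holo_sum _ _ _ _ (fun k w => v 0 k * dgrad H w k : C^o)) => k.
  by apply: holoM; [exact: holo_cst|exact: holo_dgrad].
have [M hM] := holo_bounded_cball hH1 s1.
have dd (w : C) : cabs (w - 0) < r -> cdiff (fun l => H (c + l *: v)) w (H1 (c + w *: v)) /\
    cdiff (fun l => H1 (c + l *: v)) w (H2 (c + w *: v)).
  rewrite subr0 => /ltW wr; have Bw : Bn (c + w *: v) by exact: le_lt_trans (nv w wr) s1.
  by split; apply: fdiff_line; exact: holo_fdiff.
have bb (w : C) : cabs (w - 0) < r -> cabs (H1 (c + w *: v)) <= M.
  by rewrite subr0 => /ltW wr; apply: hM; exact: nv.
pose hl (l : C) : C := H (c + l *: v).
have [K FP] := @four_point R hl (fun l => H1 (c + l *: v)) (fun l => H2 (c + l *: v)) 0 r M r0 dd bb.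
have Q (w : C) : cabs w <= r -> cabs (hl w) ^+ 2 + eta * normz (c + w *: v) ^+ 2 <= cabs (hl 0) ^+ 2 + eta * normz c ^+ 2.
  by move=> /nv /cM; rewrite /q /hl -!expr2 scale0r addr0.
clearbody hl; set h0 := hl 0 in FP Q.
have m0 : 0 < cabs h0 * `|K| + 1 by rewrite ltr_wpDl// mulr_ge0 ?cabs_ge0.
(* Chosen so that |h0| times the cubic error is at most half the gain eta t^2 of the penalty. *)
pose t := Num.min (r / 4) (eta / (cabs h0 * `|K| + 1) / 2).
have t0 : 0 < t by rewrite lt_min !divr_gt0.
have tr : t <= r / 4 by rewrite ge_min lexx.
have te : t * (cabs h0 * `|K| + 1) <= eta / 2 by rewrite -ler_pdivlMr// mulrAC ge_min lexx orbT.
have tI : 0 < t <= r / 4 by rewrite t0.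
have := FP t tI; rewrite !add0r.
set x1 := hl t%:C%C; set x2 := hl (Complex 0 1 * t%:C%C).
set x3 := hl (- 1 * t%:C%C); set x4 := hl (- Complex 0 1 * t%:C%C).
set Dl : C := (X in cabs X) => FPt.
clearbody t; have ct : cabs t%:C%C <= r by rewrite cabsE_real gtr0_norm//; lra.
have ctI : cabs (Complex 0 1 * t%:C%C) <= r by rewrite cabsM cabs_imag normr1 mul1r.
have q1 := Q _ ct; have q2 := Q _ ctI; rewrite -/x1 in q1; rewrite -/x2 in q2.
have q3 : cabs x3 ^+ 2 + eta * normz (c - t%:C%C *: v) ^+ 2 <= cabs h0 ^+ 2 + eta * normz c ^+ 2.
  by have := Q (- 1 * t%:C%C); rewrite {1}mulN1r cabsN => /(_ ct); rewrite -/x3 mulN1r scaleNr.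
have q4 : cabs x4 ^+ 2 + eta * normz (c - (Complex 0 1 * t%:C%C) *: v) ^+ 2 <= cabs h0 ^+ 2 + eta * normz c ^+ 2.
  by have := Q (- Complex 0 1 * t%:C%C); rewrite {1}mulNr cabsN => /(_ ctI); rewrite -/x4 mulNr scaleNr.
have p1 := parallelogram c (t%:C%C *: v); have p2 := parallelogram c ((Complex 0 1 * t%:C%C) *: v).
have nv1 : normz v ^+ 2 = 1.
  rewrite sqr_normz (bigD1 0)//= big1 => [|j j0]; rewrite mxE.
    by rewrite !eqxx cabs1 expr1n addr0.
  by rewrite eqxx (negbTE j0) cabs0 expr0n.
rewrite normzZ exprMn nv1 mulr1 cabsE_real gtr0_norm// in p1.
rewrite normzZ exprMn nv1 mulr1 cabsM cabs_imag normr1 mul1r cabsE_real gtr0_norm// in p2.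
clearbody x1 x2 x3 x4 h0.
(* The squared modulus is convex and lies above its tangent plane at [h0]; the linear terms then add
   up to the four-point sum. *)
have lb (x : C) : cabs h0 ^+ 2 + 2 * (complex.Re h0 * (complex.Re x - complex.Re h0) + complex.Im h0 * (complex.Im x - complex.Im h0)) <= cabs x ^+ 2.
  have E (a b c1 c2 : R) : a ^+ 2 + b ^+ 2 + 2 * (a * (c1 - a) + b * (c2 - b)) <= c1 ^+ 2 + c2 ^+ 2.
    rewrite -subr_ge0 (_ : _ - _ = (c1 - a) ^+ 2 + (c2 - b) ^+ 2); last by ring.
    by rewrite addr_ge0// sqr_ge0.
  by rewrite !sqr_cabs; exact: E.
have l1 := lb x1; have l2 := lb x2; have l3 := lb x3; have l4 := lb x4.
have RD : complex.Re Dl = complex.Re x1 + complex.Re x2 + (complex.Re x3 + complex.Re x4) - 4 * complex.Re h0.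
  by rewrite /Dl !(ReD, ReN); ring.
have ID : complex.Im Dl = complex.Im x1 + complex.Im x2 + (complex.Im x3 + complex.Im x4) - 4 * complex.Im h0.
  by rewrite /Dl !(ImD, ImN); ring.
have bR : `|complex.Re h0 * complex.Re Dl| <= cabs h0 * cabs Dl.
  by rewrite normrM; apply: ler_pM; rewrite ?normr_ge0 ?ler_Re_cabs.
have bI : `|complex.Im h0 * complex.Im Dl| <= cabs h0 * cabs Dl.
  by rewrite normrM; apply: ler_pM; rewrite ?normr_ge0 ?ler_Im_cabs.
rewrite RD ler_norml in bR; rewrite ID ler_norml in bI.
have /andP[bR1 _] := bR; have /andP[bI1 _] := bI.
have t20 : 0 < t ^+ 2 by rewrite exprn_gt0.
have Db : cabs h0 * cabs Dl <= t ^+ 2 * (eta / 2).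
  apply: le_trans (_ : cabs h0 * (`|K| * t ^+ 3) <= _).
    apply: ler_wpM2l; first exact: cabs_ge0.
    apply: le_trans FPt _; apply: ler_wpM2r; first by rewrite exprn_ge0// ltW.
    exact: ler_norm.
  have -> : cabs h0 * (`|K| * t ^+ 3) = t ^+ 2 * (t * (cabs h0 * `|K|)) by ring.
  rewrite ler_pM2l//; apply: le_trans te; rewrite ler_pM2l//; by rewrite lerDl.
have : 0 < eta * t ^+ 2 by rewrite mulr_gt0.
have P1 : eta * normz (c + t%:C%C *: v) ^+ 2 + eta * normz (c - t%:C%C *: v) ^+ 2 = 2 * (eta * normz c ^+ 2) + 2 * (eta * t ^+ 2).
  by rewrite -mulrDr p1; ring.
have P2 : eta * normz (c + (Complex 0 1 * t%:C%C) *: v) ^+ 2 + eta * normz (c - (Complex 0 1 * t%:C%C) *: v) ^+ 2 = 2 * (eta * normz c ^+ 2) + 2 * (eta * t ^+ 2).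
  by rewrite -mulrDr p2; ring.
have key (a b a1 a2 a3 a4 b1 b2 b3 b4 : R) : (a * (a1 - a) + b * (b1 - b)) + (a * (a2 - a) + b * (b2 - b)) +
    ((a * (a3 - a) + b * (b3 - b)) + (a * (a4 - a) + b * (b4 - b))) =
    a * (a1 + a2 + (a3 + a4) - 4 * a) + b * (b1 + b2 + (b3 + b4) - 4 * b) by ring.
have := key (complex.Re h0) (complex.Im h0) (complex.Re x1) (complex.Re x2) (complex.Re x3) (complex.Re x4) (complex.Im x1) (complex.Im x2) (complex.Im x3) (complex.Im x4).
move: l1 l2 l3 l4 bR1 bI1 q1 q2 q3 q4 P1 P2 Db.
rewrite (_ : t ^+ 2 * (eta / 2) = eta * t ^+ 2 / 2); last by field.
exact: square_mean_contradiction.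
Qed.

(** The principle in one variable for v -> H(v u), which keeps the new point on the complex line of
    u. It then differs from a point of the ray of u only by a unimodular factor, which [ext_dilate]
    can undo. *)
Lemma max_principle_disc n (H : 'rV[C]_n -> C^o) u (l0 : C) (s eta : R) : holo H -> normz u <= 1 ->
  s < 1 -> cabs l0 <= s -> 0 < eta ->
  exists l : C, cabs l = s /\ cabs (H (l0 *: u)) ^+ 2 <= cabs (H (l *: u)) ^+ 2 + eta.
Proof.
move=> hH u1 s1 ls e0; pose hh (v : 'rV[C]_1) : C^o := H (v 0 0 *: u).
have n1 (v : 'rV[C]_1) : normz v = cabs (v 0 0).
  apply/eqP; rewrite -(@eqrXn2 _ 2)// ?cabs_ge0 ?normz_ge0//.
  by rewrite sqr_normz big_ord_recl big_ord0 addr0.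
have hhh : holo hh.
  apply: holo_of_fdiff => v Bv; have Bvu : Bn (v 0 0 *: u).
    rewrite /Bn/= normzZ; apply: le_lt_trans Bv; rewrite n1 -[leRHS]mulr1.
    by apply: ler_wpM2l => //; exact: cabs_ge0.
  exists (fun _ => \sum_k u 0 k * dgrad H (v 0 0 *: u) k) => e e1.
  have k0 : 0 < nrm1 u + 1 by rewrite ltr_wpDl// nrm1_ge0.
  have [|d d0 Hd] := holo_fdiff hH Bvu (e := e / (nrm1 u + 1)); first by rewrite divr_gt0.
  exists (d / (nrm1 u + 1)); first by rewrite divr_gt0.
  move=> w wv; have N : nrm1 (w 0 0 *: u - v 0 0 *: u) <= nrm1 (w - v) * (nrm1 u + 1).
    rewrite -scalerBl nrm1Z; apply: ler_pM; rewrite ?cabs_ge0 ?nrm1_ge0//; last by rewrite lerDl.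
    by have := cabs_nrm1 (w - v) 0; rewrite !mxE.
  have wd : nrm1 (w - v) * (nrm1 u + 1) < d by rewrite -ltr_pdivlMr.
  have h := Hd _ (le_lt_trans N wd).
  rewrite big_ord_recl big_ord0 addr0 mulr_sumr.
  rewrite (eq_bigr (fun k => (w 0 0 *: u - v 0 0 *: u) 0 k * dgrad H (v 0 0 *: u) k)).
    apply: le_trans h _; rewrite mulrAC ler_pdivrMr// -mulrA ler_pM2l//.
  by move=> k _; rewrite -scalerBl !mxE mulrA.
have [|a [an aH]] := max_principle (z := (const_mx l0 : 'rV[C]_1)) hhh s1 _ e0.
  by rewrite n1 mxE.
by exists (a 0 0); rewrite -n1; split => //; rewrite /hh mxE in aH.
Qed.

End MaximumPrinciple.

(** * Norms of point evaluations and their growth along rays *)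

Section ExtremalFunction.
Variables (R : realType) (n : nat) (p : R).
Hypothesis p1 : 1 <= p.
Local Notation C := (R[i]).
Local Notation Cn := ('rV[R[i]]_n).
Implicit Types (z w a u : Cn) (f g : Cn -> C^o).

(* The norm of the evaluation at [a] on A^p_psi. *)
Definition ext a : R := sup [set x | exists f, [/\ holo f, (Apint p f <= 1%:E)%E & x = cabs (f a)]].

(** [Ap_eval] bounds the p-th power; no root is taken, because x <= max(1, x^p). *)
Lemma ext_growth : exists2 K : R, 1 <= K & forall f a, holo f -> (Apint p f <= 1%:E)%E -> Bn a ->
  cabs (f a) <= K * expR ((2 * n + 2)%:R * psi a).
Proof.
have [C1 C11 HC] := Ap_eval n p1; exists (2 * C1); first lra.
move=> f a hf f1 Ba; set E := expR _; have E1 : 1 <= E.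
  by rewrite -expR0 ler_expR mulr_ge0// (le_trans ler01)// psi_ge1.
have h : (cabs (f a)) `^ p <= C1 * E.
  rewrite -lee_fin; apply: le_trans (HC f a hf Ba) _; rewrite -[leRHS]mule1.
  by apply: lee_wpmul2l => //; rewrite lee_fin mulr_ge0 ?expR_ge0//; lra.
have CE : 1 <= C1 * E by rewrite -[leLHS]mulr1; apply: ler_pM.
have [c1|c1] := leP (cabs (f a)) 1; first by apply: le_trans c1 _; lra.
apply: le_trans (_ : cabs (f a) `^ p <= _); last lra.
by rewrite -[leLHS]powRr1 ?cabs_ge0//; apply: ler_powR => //; exact: ltW.
Qed.

Lemma Apint_small_cst : (Apint p (fun _ : Cn => ((4 ^+ n)^-1)%:C%C : C^o) <= 1%:E)%E.
Proof.
have c0 : 0 <= (4 ^+ n)^-1 :> R by rewrite invr_ge0 exprn_ge0.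
have c1 : (4 ^+ n)^-1 <= 1 :> R by rewrite invf_le1 ?exprn_gt0// exprn_ege1//; lra.
have E : (fun _ : Cn => ((4 ^+ n)^-1)%:C%C : C^o) = fun _ => ((4 ^+ n)^-1)%:C%C * 1.
  by apply/funext => z; rewrite mulr1.
rewrite E (Apint_scale p ((4 ^+ n)^-1)%:C%C (@holo_cst R n 1)) cabsE_real ger0_norm//.
apply: (@le_trans _ _ (((4 ^+ n)^-1)%:E * (4 ^+ n)%:E)%E).
  apply: lee_pmul; [by rewrite lee_fin powR_ge0|exact: Apint_ge0| |exact: Apint_cst1].
  by rewrite lee_fin powR_le_self// c0.
by rewrite -EFinM mulVf// expf_neq0.
Qed.

Lemma ext_has_sup a : Bn a -> has_sup [set x | exists f, [/\ holo f, (Apint p f <= 1%:E)%E & x = cabs (f a)]].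
Proof.
move=> Ba; split.
  exists (cabs (((4 ^+ n)^-1)%:C%C : C)), (fun _ => ((4 ^+ n)^-1)%:C%C).
  by split; [exact: holo_cst|exact: Apint_small_cst|].
have [K K1 HK] := ext_growth; exists (K * expR ((2 * n + 2)%:R * psi a)) => _ [f [hf f1 ->]].
exact: HK.
Qed.

Lemma ext_ub f a : holo f -> (Apint p f <= 1%:E)%E -> Bn a -> cabs (f a) <= ext a.
Proof.
by move=> hf f1 Ba; apply: ub_le_sup; [have [] := ext_has_sup Ba|exists f].
Qed.

Lemma ext_ge a : Bn a -> (4 ^+ n)^-1 <= ext a.
Proof.
move=> Ba; have := ext_ub (@holo_cst R n ((4 ^+ n)^-1)%:C%C) Apint_small_cst Ba.
by rewrite cabsE_real ger0_norm// invr_ge0 exprn_ge0.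
Qed.

Lemma ext_gt0 a : Bn a -> 0 < ext a.
Proof. by move=> Ba; apply: lt_le_trans (ext_ge Ba); rewrite invr_gt0 exprn_gt0. Qed.

Lemma ext_scale f a (t : R) : 0 < t -> holo f -> (Apint p f <= (t `^ p)%:E)%E -> Bn a ->
  cabs (f a) <= t * ext a.
Proof.
move=> t0 hf ft Ba; pose h z : C^o := (t^-1)%:C%C * f z.
have hh : holo h by apply: holoM => //; exact: holo_cst.
have h1 : (Apint p h <= 1%:E)%E.
  rewrite (Apint_scale p (t^-1)%:C%C hf) cabsE_real ger0_norm ?invr_ge0 ?(ltW t0)//.
  apply: (@le_trans _ _ ((t^-1 `^ p)%:E * (t `^ p)%:E)%E).
    by apply: lee_wpmul2l => //; rewrite lee_fin powR_ge0.
  by rewrite -EFinM -powRM ?invr_ge0 ?(ltW t0)// mulVf ?gt_eqF// powR1.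
have := ext_ub hh h1 Ba.
by rewrite cabsM cabsE_real ger0_norm ?invr_ge0 ?(ltW t0)// mulrC ler_pdivrMr// mulrC.
Qed.

Lemma ext_near a : Bn a -> exists f, [/\ holo f, (Apint p f <= 1%:E)%E & ext a / 2 <= cabs (f a)].
Proof.
move=> Ba; have e0 : 0 < ext a / 2 by rewrite divr_gt0// ext_gt0.
have [_ [f [hf f1 ->]]] := sup_adherent e0 (ext_has_sup Ba).
by rewrite -/(ext a) => h; exists f; split => //; lra.
Qed.

(** f(l z) competes at a with p-th power norm at most 4^n, and 4^n <= (4^n)^p. Applied to a
    unimodular l and to its inverse this makes [ext] comparable on circles; applied to |l| < 1 it
    serves as a weak monotonicity. *)
Lemma ext_dilate a (l : C) : Bn a -> 2^-1 <= cabs l <= 1 -> ext (l *: a) <= 4 ^+ n * ext a.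
Proof.
move=> Ba lI; have /andP[l2 l1] := lI; have Bl := Bn_scale l1 Ba.
apply: ge_sup; first by have [] := ext_has_sup Bl.
move=> _ [f [hf f1 ->]].
apply: (@ext_scale (fun z => f (l *: z) : C^o)); [by rewrite exprn_gt0|exact: holo_scale| |by []].
apply: le_trans (Apint_dilate p hf lI) _; apply: (@le_trans _ _ ((4 ^+ n)%:E * 1%:E)%E).
  by apply: lee_wpmul2l => //; rewrite lee_fin exprn_ge0.
rewrite -EFinM lee_fin mulr1 -[leLHS]powRr1 ?exprn_ge0//; apply: ler_powR => //.
by rewrite exprn_ege1//; lra.
Qed.

(** The radius of the sphere psi = y. As the inverse of 0 is 0 by default, [lev 0] is 1, which is
    why positivity of y is required below. *)
Definition lev (y : nat) : R := Num.sqrt (1 - y%:R^-1).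

Lemma sqr_lev y : (0 < y)%N -> lev y ^+ 2 = 1 - y%:R^-1.
Proof. by move=> y0; rewrite sqr_sqrtr// subr_ge0 invf_le1 ?ltr0n// ler1n. Qed.

Lemma lev_ge0 y : 0 <= lev y.
Proof. exact: sqrtr_ge0. Qed.

Lemma lev_lt1 y : (0 < y)%N -> lev y < 1.
Proof.
move=> y0; rewrite -(@ltr_pXn2r _ 2)// ?nnegrE ?lev_ge0// sqr_lev// expr1n.
by rewrite gtrBl invr_gt0 ltr0n.
Qed.

Lemma psi_lev u y : (0 < y)%N -> normz u = lev y -> psi u = y%:R.
Proof. by move=> y0 uy; rewrite psiE /rho uy sqr_lev// opprB addrC subrK invrK. Qed.

(* Otherwise [ext] would grow faster along the ray than its a priori bound allows. *)
Lemma good_level : exists (A : R) (m0 : nat), 0 < A /\ forall m u, (m0 <= m)%N -> normz u = 1 ->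
  exists y, [/\ (m <= y < 2 * m)%N & ext ((lev y.+1)%:C%C *: u) <= A * ext ((lev y)%:C%C *: u)].
Proof.
(* If every step from m to 2m multiplied [ext] by more than A, the growth A^m = exp(2km) exp(m)
   would exceed the a priori bound K exp(2km) by more than the factor 4^n lost in [ext_ge]; [m0] is
   such that exp(m) > K 4^n. *)
have [K K1 HK] := ext_growth; pose k : R := (2 * n + 2)%:R; pose A := expR (2 * k + 1).
exists A, (Num.truncn (K * 4 ^+ n)).+1; split; first exact: expR_gt0.
move=> m u mm u1; apply: contrapT => H.
have m1 : (0 < m)%N by exact: leq_trans mm.
have By y : (0 < y)%N -> Bn ((lev y)%:C%C *: u).
  by move=> y0; rewrite /Bn/= normzZ u1 mulr1 cabsE_real ger0_norm ?lev_ge0// lev_lt1.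
have G j : (j <= m)%N -> A ^+ j * (4 ^+ n)^-1 <= ext ((lev (m + j))%:C%C *: u).
  elim: j => [|j IH] jm; first by rewrite mul1r; apply: ext_ge; apply: By; rewrite addn0.
  have jm' : (j <= m)%N by exact: ltnW.
  rewrite exprS -mulrA; apply: le_trans (_ : A * ext ((lev (m + j))%:C%C *: u) <= _).
    by rewrite ler_pM2l ?expR_gt0// IH.
  rewrite leNgt; apply/negP => h; apply: H; exists (m + j)%N; split.
    by rewrite leq_addr mul2n -addnn ltn_add2l.
  by rewrite -addnS ltW.
have := G m (leqnn m); rewrite leNgt => /negP; apply.
have B2 : Bn ((lev (m + m))%:C%C *: u) by apply: By; rewrite addn_gt0 m1.
apply: le_lt_trans (_ : K * expR (k * (m + m)%:R) < _).
  apply: ge_sup; first by have [] := ext_has_sup B2.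
  move=> _ [f [hf f1 ->]]; have := HK f _ hf f1 B2.
  rewrite (@psi_lev _ (m + m)%N) ?addn_gt0 ?m1//.
  by rewrite normzZ u1 mulr1 cabsE_real ger0_norm// lev_ge0.
have -> : A ^+ m = expR (k * (m + m)%:R) * expR m%:R.
  rewrite -expRD /A -expRM_natl; congr expR; rewrite natrD; ring.
rewrite mulrC -mulrA ltr_pM2l ?expR_gt0// ltr_pdivlMr ?exprn_gt0//.
apply: lt_le_trans (_ : m%:R <= _); last by apply: le_trans (expR_ge1Dx _); rewrite lerDr.
apply: lt_le_trans (_ : (Num.truncn (K * 4 ^+ n)).+1%:R <= _); last by rewrite ler_nat.
by have /andP[_] := @truncn_itv _ (K * 4 ^+ n) (ltac:(by rewrite mulr_ge0 ?exprn_ge0//; lra)).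
Qed.

End ExtremalFunction.

(** * From compactness to decay of the radial derivative *)

Section CompactLittleOh.
Variables (R : realType) (n : nat) (p : R).
Hypothesis p1 : 1 <= p.
Local Notation C := (R[i]).
Local Notation Cn := ('rV[R[i]]_n).
Implicit Types (z w a u : Cn) (f g : Cn -> C^o).
Local Notation ext := (ext p).
Local Notation lev := (lev R).

(** On level y one has rho(a) = 1/y, so the fourth clause bounds |Rg(a)| rho(a)^2 from below. The
    fifth compares [ext] at a with its value one level further out on the same ray; k forces the
    levels to infinity. *)
Definition peak g (L eps : R) (k : nat) (a : Cn) (y : nat) := [/\ (k <= y)%N, (2 <= y)%N, normz a = lev y,
  eps <= cabs (Rder g a) / y%:R ^+ 2 & ext ((lev y.+1 / lev y)%:C%C *: a) <= L * ext a].

Lemma lev_gt0 y : (2 <= y)%N -> 0 < lev y.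
Proof.
move=> y2; rewrite sqrtr_gt0 subr_gt0 invf_lt1 ?ltr1n// ltr0n; exact: ltnW.
Qed.

Lemma lev_normz z y : (0 < y)%N -> psi z <= y%:R -> Bn z -> normz z <= lev y.
Proof.
move=> y0 h Bz; have r0 := rho_gt0 Bz; have : y%:R^-1 <= rho z.
  by rewrite -[leRHS]invrK lef_pV2 ?posrE ?invr_gt0 ?ltr0n.
move=> h2; rewrite -(@ler_pXn2r _ 2)// ?nnegrE ?normz_ge0 ?lev_ge0// sqr_lev//.
by move: h2; rewrite /rho; lra.
Qed.

Lemma half_le_of_sqr (x y : R) : 0 <= x -> 0 <= y -> x ^+ 2 <= y ^+ 2 + x ^+ 2 / 2 -> x / 2 <= y.
Proof.
move=> x0 y0 h; rewrite leNgt; apply/negP => yx.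
have : y * y <= x / 2 * (x / 2) by apply: ler_pM => //; exact: ltW.
have x1 : 0 < x by lra.
have : 0 < x * x by rewrite mulr_gt0.
move: h; rewrite !expr2; lra.
Qed.

(** A bad point z is moved out to a level y with psi(z) < y <= 4 psi(z). The maximum principle keeps
    half of |Rg(z)| and rho^2 loses at most a factor 16, whence 32. The two factors 4^n in the
    comparison constant rotate the new point onto the ray of z and back. *)
Lemma exists_peak g (eps : R) : holo g -> 0 < eps ->
  (forall r : R, r < 1 -> exists z, r < normz z < 1 /\ eps <= cabs (Rder g z) * rho z ^+ 2) ->
  exists2 L : R, 0 < L & forall k, exists a y, peak g L (eps / 32) k a y.
Proof.
move=> hg e0 Hz; have [A [m0 [A0 GL]]] := good_level n p1.
have n40 : 0 < 4 ^+ n :> R by rewrite exprn_gt0.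
exists (4 ^+ n * (A * 4 ^+ n)); first by rewrite !mulr_gt0.
have h21 : 2^-1 <= 1 :> R by lra.
move=> k; pose q := (k + m0 + 2)%N; have q0 : (0 < q)%N by rewrite /q addn2.
have [z [/andP[qz z1] ez]] := Hz (lev q) (lev_lt1 R q0); have Bz : Bn z by [].
have nz0 : 0 < normz z by apply: le_lt_trans qz; exact: lev_ge0.
have qpsi : q%:R <= psi z.
  rewrite leNgt; apply/negP => h; have := lev_normz q0 (ltW h) Bz; rewrite leNgt qz//.
(* psi(z) < m <= 2 psi(z), so every level in [m, 2m[ lies beyond z and is at most 4 psi(z). *)
have psi1 := psi_ge1 Bz; pose m := (Num.truncn (psi z)).+1.
have /andP[m1 m2] := @truncn_itv _ (psi z) (ltac:(lra)).
have qm : (q <= m)%N by rewrite -(ler_nat R); apply: le_trans qpsi (ltW m2).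
have mpsi : m%:R <= 2 * psi z by rewrite /m -natr1; lra.
have m3 : psi z < m%:R := m2; clearbody m.
pose u := (normz z)^-1%:C%C *: z.
have u1 : normz u = 1 by rewrite normzZ cabsE_real ger0_norm ?invr_ge0 ?normz_ge0// mulVf// gt_eqF.
have [|y [/andP[my ym] ext1]] := GL m u _ u1.
  by apply: leq_trans qm; rewrite /q addnAC leq_addl.
have qy : (q <= y)%N by exact: leq_trans my.
have y2 : (2 <= y)%N by apply: leq_trans qy; rewrite /q addn2.
have y0 : (0 < y)%N by exact: leq_trans y2.
have zl : normz z <= lev y.
  by apply: lev_normz => //; apply: le_trans (ltW m3) _; rewrite ler_nat.
have ne0 : cabs (normz z)%:C%C <= lev y by rewrite cabsE_real ger0_norm// normz_ge0.
have zu : (normz z)%:C%C *: u = z.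
  by rewrite scalerA -rmorphM mulfV ?gt_eqF// rmorph1 scale1r.
have R0 : 0 < cabs (Rder g z).
  have h : 0 < cabs (Rder g z) * rho z ^+ 2 by exact: lt_le_trans ez.
  by move: h; rewrite pmulr_lgt0// exprn_gt0// rho_gt0.
(* The loss allowed in the maximum principle is half of |Rg(z)|^2, which [half_le_of_sqr]
   absorbs. *)
have e1 : 0 < cabs (Rder g z) ^+ 2 / 2 by rewrite divr_gt0// exprn_gt0.
have [|l [ly lH]] := max_principle_disc (holo_Rder hg) (_ : normz u <= 1) (lev_lt1 R y0) ne0 e1.
  by rewrite u1.
rewrite zu in lH; have y'0 := lev_gt0 y2; have y10 := lev_ge0 R y.+1.
have By x : (0 < x)%N -> Bn ((lev x)%:C%C *: u).
  by move=> x0; rewrite /Bn/= normzZ u1 mulr1 cabsE_real ger0_norm ?lev_ge0// lev_lt1.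
have Ba : Bn (l *: u) by rewrite /Bn/= normzZ u1 mulr1 ly lev_lt1.
have Rl : cabs (Rder g z) / 2 <= cabs (Rder g (l *: u)).
  by apply: half_le_of_sqr lH; exact: cabs_ge0.
have cl : cabs (l / (lev y)%:C%C) = 1.
  by rewrite cabsM cabsV cabsE_real ger0_norm ?(ltW y'0)// ly mulfV// gt_eqF.
have lC : (lev y)%:C%C != 0 :> C by rewrite -cabs_gt0 cabsE_real normr_gt0 gt_eqF.
have l0 : l != 0 by rewrite -cabs_gt0 ly.
exists (l *: u), y; split; [|exact: y2| | |].
- by apply: leq_trans qy; rewrite /q -addnA leq_addr.
- by rewrite normzZ u1 mulr1.
- have yp : y%:R <= 4 * psi z.
    apply: le_trans (_ : (2 * m)%:R <= _); first by rewrite ler_nat ltnW.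
    rewrite natrM (_ : 4 * psi z = 2 * (2 * psi z)); last by ring.
    by apply: ler_wpM2l.
  have yr : 0 < y%:R :> R by rewrite ltr0n.
  have pz : 0 < psi z by exact: lt_le_trans psi1.
  rewrite (ler_pdivlMr _ _ (exprn_gt0 2 yr)); apply: le_trans Rl.
  apply: le_trans (_ : eps / 32 * (4 * psi z) ^+ 2 <= _).
    apply: ler_wpM2l; first by apply: divr_ge0; [exact: ltW|].
    apply: lerXn2r; [exact: ltW|by apply: mulr_ge0; [|exact: ltW]|exact: yp].
  have rE : rho z ^+ 2 * psi z ^+ 2 = 1 by rewrite -exprMn psiE mulfV ?expr1n// gt_eqF// rho_gt0.
  have ep : eps * psi z ^+ 2 <= cabs (Rder g z).
    rewrite -[leRHS]mulr1 -rE mulrA; apply: ler_wpM2r => //; exact: sqr_ge0.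
  rewrite (_ : eps / 32 * (4 * psi z) ^+ 2 = eps * psi z ^+ 2 / 2); last by field.
  by apply: ler_wpM2r; rewrite ?invr_ge0.
- rewrite scalerA rmorphM fmorphV/=.
  have -> : (lev y.+1)%:C%C / (lev y)%:C%C * l = (l / (lev y)%:C%C) * (lev y.+1)%:C%C by ring.
  rewrite -scalerA; apply: le_trans (ext_dilate p1 (By _ _) _) _ => //.
    by rewrite cl lexx andbT.
  rewrite -mulrA ler_pM2l//; apply: le_trans ext1 _; rewrite -mulrA ler_pM2l//.
  have -> : (lev y)%:C%C *: u = (l / (lev y)%:C%C)^-1 *: (l *: u).
    have Ef (c v : C) : c != 0 -> v != 0 -> (v / c)^-1 * v = c by move=> c0 v0; rewrite invfM invrK mulrAC mulVf// mul1r.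
    by rewrite [RHS]scalerA Ef.
  by apply: ext_dilate => //; rewrite cabsV cl invr1 lexx andbT.
Qed.

Lemma bernoulli_le (x : R) m : 0 <= x <= 1 -> 1 - m%:R * x <= (1 - x) ^+ m.
Proof.
move=> /andP[x0 x1]; elim: m => [|m IH]; first by rewrite mul0r subr0 expr0.
rewrite exprS; apply: le_trans (_ : (1 - x) * (1 - m%:R * x) <= _); last by apply: ler_wpM2l => //; lra.
have : 0 <= m%:R * (x * x) :> R by rewrite !mulr_ge0.
by rewrite -natr1; lra.
Qed.

(* The factor peaking at [a] makes the near-extremal functions tend to zero locally
   uniformly while it stays bounded below at [a]. *)
Definition peakfun f (a : Cn) (y : nat) z : C^o := f z * ((normz a)^-1%:C%C * ip z a) ^+ y./2.

Lemma holo_peakfun f a y : holo f -> holo (peakfun f a y).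
Proof.
move=> hf; apply: holoM => //; apply: (@holoX _ _ (fun z => (normz a)^-1%:C%C * ip z a : C^o)).
by apply: holoM; [exact: holo_cst|exact: holo_ip].
Qed.

Lemma cabs_peak_factor a z : cabs ((normz a)^-1%:C%C * ip z a) <= normz z.
Proof.
rewrite cabsM cabsE_real ger0_norm ?invr_ge0 ?normz_ge0//.
have [a0|a0] := eqVneq (normz a) 0; first by rewrite a0 invr0 mul0r normz_ge0.
by rewrite mulrC ler_pdivrMr ?lt_def ?a0 ?normz_ge0// cabs_ip.
Qed.

(** At a the factor is |a|^k with k = [y./2]. Since |a| >= |a|^2 = 1 - 1/y, Bernoulli's inequality
    bounds it below by 1 - k/y >= 1/2. *)
Lemma peakfun_at f a y : (2 <= y)%N -> normz a = lev y -> cabs (f a) / 2 <= cabs (peakfun f a y a).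
Proof.
move=> y2 ay; rewrite cabsM cabsX; apply: ler_wpM2l; first exact: cabs_ge0.
have a0 : 0 < normz a by rewrite ay lev_gt0.
rewrite ip_self cabsM !cabsE_real !ger0_norm ?invr_ge0 ?sqr_ge0 ?(ltW a0)//.
rewrite expr2 mulrA mulVf ?gt_eqF// mul1r; have y0 : (0 < y)%N by exact: leq_trans y2.
have a1 : normz a <= 1 by rewrite ay ltW// lev_lt1.
apply: le_trans (_ : (normz a ^+ 2) ^+ y./2 <= _); last first.
  apply: lerXn2r; [exact: sqr_ge0|exact: ltW|].
  by rewrite expr2 -[leRHS]mul1r ler_pM2r.
rewrite ay sqr_lev//; have yr : 0 < y%:R :> R by rewrite ltr0n.
apply: le_trans (bernoulli_le _ _); last by rewrite invr_ge0 ltW// invf_le1// ler1n.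
have : (y./2)%:R * y%:R^-1 <= 2^-1 :> R.
  rewrite ler_pdivrMr// mulrC ler_pdivlMr// -natrM ler_nat muln2 -[leqRHS]odd_double_half leq_addl//.
lra.
Qed.

(** On |z| <= s the f_k are uniformly bounded by [ext_growth], while the peaking factor is at most s
    to a power that tends to infinity with the level. *)
Lemma ucc0_peakfun (f : nat -> Cn -> C^o) (a : nat -> Cn) (y : nat -> nat) :
  (forall k, holo (f k)) -> (forall k, (Apint p (f k) <= 1%:E)%E) -> (forall k, (k <= y k)%N) ->
  ucc0 (fun k => peakfun (f k) (a k) (y k)).
Proof.
move=> hf f1 ky K cK KB e e0; have [s /andP[s0 s1] Ks] := compact_normz_lt1 cK KB.
have [K1 K11 HK] := ext_growth n p1.
pose B := K1 * expR ((2 * n + 2)%:R * (1 - s ^+ 2)^-1).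
have B0 : 0 < B by rewrite mulr_gt0 ?expR_gt0//; lra.
have cs : (fun k => s ^+ k) @ \oo --> 0 by apply: cvg_expr; rewrite ger0_norm.
have [N _ HN] := @cvgr_lt _ _ _ _ _ _ cs _ (divr_gt0 e0 B0).
exists (2 * N)%N => // k /= kN z /Ks zs; rewrite cabsM cabsX.
have Bz : Bn z by exact: le_lt_trans s1.
have fz : cabs (f k z) <= B.
  apply: le_trans (HK _ _ (hf k) (f1 k) Bz) _; apply: ler_wpM2l; first lra.
  rewrite ler_expR; apply: ler_wpM2l => //; rewrite lef_pV2 ?posrE ?rho_gt0//; last by rewrite subr_gt0 expr_lt1.
  by rewrite lerD2l lerN2 ler_pXn2r ?nnegrE ?normz_ge0.
have Ny : (N <= (y k)./2)%N.
  by rewrite -(doubleK N) half_leq// -mul2n; apply: leq_trans kN (ky k).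
apply: le_lt_trans (_ : B * s ^+ (y k)./2 < _).
  apply: ler_pM; rewrite ?cabs_ge0 ?exprn_ge0 ?cabs_ge0//.
  apply: lerXn2r; [exact: cabs_ge0|exact: s0|].
  exact: le_trans (cabs_peak_factor _ _) zs.
by rewrite mulrC -ltr_pdivlMr// HN.
Qed.

Lemma homo_ltn_ge (phi : nat -> nat) : {homo phi : a b / (a < b)%N} -> forall j, (j <= phi j)%N.
Proof. by move=> H; elim=> // j IH; apply: leq_ltn_trans IH (H _ _ _). Qed.

(* Limit points of the images vanish, because point evaluations are continuous. *)
Lemma compact_op_small g (h : nat -> Cn -> C^o) (tau : R) : holo g -> compact_op p (Vop g) ->
  Abounded p h -> ucc0 h -> 0 < tau -> exists k, (Apint p (Vop g (h k)) <= (tau `^ p)%:E)%E.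
Proof.
move=> hg cV hb hu t0; have hh k : holo (h k) := (hb.1 k).1.
have [VA [phi [hphi [l [lA cl]]]]] := cV h hb; have gphi := homo_ltn_ge hphi.
have p0 : 0 < p by exact: lt_le_trans p1.
pose D j z : C^o := (Vop g (h (phi j)) z - l z)%R.
have D0 j : (0 <= Apint p (D j))%E by exact: Apint_ge0.
have cD := (cvge0P D0).1 cl.
have hD j : holo (D j).
  by apply: (@holoD _ _ _ (fun z => - l z)); [exact: holo_Vop|exact: (inAN p1 lA).1.1].
(* V_g h_j(z) tends to 0 since h_j does so uniformly on the ball of radius |z|, and V_g h_j(z) -
   l(z) tends to 0 by [Ap_eval]. *)
have l0 z : Bn z -> l z = 0.
  move=> Bz; apply/eqP; rewrite -cabs_eq0 eq_le cabs_ge0 andbT.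
  apply/ler_addgt0Pr => e e0; rewrite add0r; have e2 : 0 < e / 2 by rewrite divr_gt0.
  have [A A0 VB] := Vop_bound hg Bz.
  have A1 : 0 < 2 * A + 1 by lra.
  have n1 := ucc0_cball hu Bz (divr_gt0 e2 A1).
  have [C1 C11 HC] := Ap_eval n p1; pose E := C1 * expR ((2 * n + 2)%:R * psi z).
  have E0 : 0 < E by rewrite mulr_gt0 ?expR_gt0//; lra.
  have n2 := cD _ (divr_gt0 (powR_gt0 p e2) E0).
  have [N1 _ H1] := n1; have [N2 _ H2] := n2; pose j := (N1 + N2)%N.
  have V1 : cabs (Vop g (h (phi j)) z) <= e / 2.
    apply: le_trans (VB _ (e / 2 / (2 * A + 1)) (hh _) _ z (lexx _)) _.
      by move=> w wz; apply: ltW; apply: (H1 (phi j)) => //=; apply: leq_trans (gphi j); rewrite leq_addr.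
    have -> : 2 * (A * (e / 2 / (2 * A + 1))) = e / 2 * (2 * A) / (2 * A + 1) by ring.
    by rewrite ler_pdivrMr//; apply: ler_wpM2l; [exact: ltW|rewrite lerDl].
  have D1 : cabs (D j z) <= e / 2.
    rewrite leNgt; apply/negP => h1; have : (cabs (D j z)) `^ p <= (e / 2) `^ p.
      rewrite -lee_fin; apply: le_trans (HC (D j) z (hD j) Bz) _; rewrite -/E.
      apply: (@le_trans _ _ (E%:E * ((e / 2) `^ p / E)%:E)%E).
        by apply: lee_wpmul2l; [rewrite lee_fin ltW|apply: H2; rewrite /= leq_addl].
      by rewrite -EFinM lee_fin mulrC divfK// gt_eqF.
    by rewrite leNgt gt0_ltr_powR// ?nnegrE ?cabs_ge0// ltW.
  have -> : l z = Vop g (h (phi j)) z + - D j z.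
    by rewrite opprB addrC subrK.
  by apply: le_trans (cabsD _ _) _; rewrite cabsN; lra.
have [N _ HN] := cD _ (powR_gt0 p t0); exists (phi N).
apply: le_trans (HN N (leqnn N)); apply: le_Apint => [//|z Bz].
by rewrite /D l0// subr0.
Qed.

(** The derivative of l -> V_g h(la) at l = 1 is h(a) Rg(a). For |l - 1| < d the point la is a
    dilate of the point b on level y + 1, so [ext] there is at most 4^n L times [ext a]. The
    constant is 768 = 64 * 4 * 3: Cauchy's estimate, the value at a, and the radius. *)
Lemma peak_bound g (h : Cn -> C^o) a y (L eps tau : R) : holo g -> holo h -> 0 < tau -> 0 < L ->
  (Apint p (Vop g h) <= (tau `^ p)%:E)%E -> peak g L eps 0 a y -> ext a / 4 <= cabs (h a) ->
  eps <= 768 * (tau * (4 ^+ n * L)).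
Proof.
move=> hg hh t0 L0 Vt [_ y2 ay ea La] ha; have hV := holo_Vop hg hh.
have y0 : (0 < y)%N by exact: leq_trans y2.
have l0 := lev_gt0 y2; have l1 : 0 < lev y.+1 by apply: lev_gt0; exact: leqW.
have l11 := lev_lt1 R (ltn0Sn y).
have Ba : Bn a by rewrite /Bn/= ay lev_lt1.
pose b := (lev y.+1 / lev y)%:C%C *: a.
have nb : normz b = lev y.+1.
  by rewrite normzZ ay cabsE_real ger0_norm ?divfK ?gt_eqF// divr_ge0 ?ltW.
have Bb : Bn b by rewrite /Bn/= nb.
have yr : 2 <= y%:R :> R by rewrite ler_nat.
pose x : R := y%:R^-1; have x0 : 0 < x by rewrite invr_gt0; lra.
have x2 : x <= 2^-1 by rewrite lef_pV2 ?posrE//; lra.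
(* x is [rho a]; a relative displacement d = x^2/3 cannot carry a past the level y + 1. *)
pose d := x ^+ 2 / 3; have d0 : 0 < d by rewrite divr_gt0// exprn_gt0.
have xx : x ^+ 2 <= 2^-1 * 2^-1 by rewrite expr2; apply: ler_pM => //; exact: ltW.
have d1 : d <= 12^-1 by rewrite /d; lra.
have q0 : lev y ^+ 2 = 1 - x by rewrite sqr_lev.
have q1 : lev y.+1 ^+ 2 = (1 + x)^-1.
  rewrite sqr_lev// -natr1 /x; field; rewrite !gt_eqF//; lra.
(* Squared, with the squares of the radii 1 - x and 1/(1+x), this is (1+d)^2 (1 - 3d) <= 1. *)
have up : (1 + d) * lev y <= lev y.+1.
  rewrite -(@ler_pXn2r _ 2)// ?nnegrE ?mulr_ge0 ?lev_ge0//; last lra.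
  rewrite exprMn q0 q1 -[leRHS]mul1r ler_pdivlMr; last lra.
  have -> : (1 + d) ^+ 2 * (1 - x) * (1 + x) = (1 + d) ^+ 2 * (1 - x ^+ 2) by ring.
  have -> : x ^+ 2 = 3 * d by rewrite /d; field.
  have : 0 <= d * d by rewrite mulr_ge0 ?ltW.
  have : 0 <= d * d * d by rewrite !mulr_ge0 ?ltW.
  rewrite sqrrD expr1n mul1r expr2; lra.
(* Keeps the dilation factor from b at least 1/2, the range of [ext_dilate]. *)
have lo : 2^-1 <= (1 - d) * lev y.
  rewrite -(@ler_pXn2r _ 2)// ?nnegrE ?mulr_ge0 ?lev_ge0 ?invr_ge0//; last lra.
  rewrite exprMn q0; apply: le_trans (_ : (11 / 12) ^+ 2 * 2^-1 <= _); first by rewrite !expr2; lra.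
  apply: ler_pM; [exact: sqr_ge0|by rewrite invr_ge0| |lra].
  by apply: lerXn2r; rewrite ?nnegrE; lra.
pose M := tau * (4 ^+ n * (L * ext a)).
have inb (l : C) : cabs (l - 1) < d -> Bn (l *: a) /\ cabs (Vop g h (l *: a)) <= M.
  move=> ld; have c1 : cabs l <= 1 + d.
    by have := cabsD (l - 1) 1; rewrite subrK cabs1; lra.
  have c2 : 1 - d <= cabs l.
    by have := cabsD (1 - l) l; rewrite subrK cabs1 cabsB; lra.
  have bE : l *: a = (l * (lev y / lev y.+1)%:C%C) *: b.
    rewrite /b scalerA -mulrA -rmorphM.
    have -> : lev y / lev y.+1 * (lev y.+1 / lev y) = 1 by field; rewrite !gt_eqF.
    by rewrite rmorph1 mulr1.
  have cE : cabs (l * (lev y / lev y.+1)%:C%C) = cabs l * lev y / lev y.+1.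
    by rewrite cabsM cabsE_real ger0_norm ?mulrA// divr_ge0 ?ltW.
  have lI : 2^-1 <= cabs (l * (lev y / lev y.+1)%:C%C) <= 1.
    rewrite cE ler_pdivrMr// mul1r; apply/andP; split; last first.
      by apply: le_trans up; rewrite ler_pM2r.
    rewrite ler_pdivlMr//; apply: le_trans (_ : 2^-1 * 1 <= _); first by rewrite ler_pM2l// ltW.
    by rewrite mulr1; apply: le_trans lo _; rewrite ler_pM2r.
  have Bl : Bn (l *: a) by rewrite bE; apply: Bn_scale => //; case/andP: lI.
  split=> //; apply: le_trans (ext_scale p1 t0 hV Vt Bl) _; rewrite ler_pM2l//.
  by rewrite bE; apply: le_trans (ext_dilate p1 Bb lI) _; rewrite ler_pM2l// exprn_gt0.
pose V' (l : C) := \sum_k a 0 k * dgrad (Vop g h) (0 + l *: a) k.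
have dV (l : C) : cabs (l - 1) < d -> cdiff (fun l => Vop g h (0 + l *: a)) l (V' l).
  by move=> /inb[Bl _]; apply: fdiff_line; rewrite add0r; exact: holo_fdiff.
have bV (l : C) : cabs (l - 1) < d -> cabs (Vop g h (0 + l *: a)) <= M.
  by move=> /inb[_ h1]; rewrite add0r.
have := cauchy_deriv d0 dV bV (z := 1); rewrite subrr cabs0 => /(_ (ltW (divr_gt0 d0 (ltr0n _ 2)))).
have -> : V' 1 = h a * Rder g a by rewrite -(Rder_Vop hg hh Ba) RderE /V' add0r scale1r.
rewrite cabsM => CB; have N0 := ext_gt0 p1 Ba.
have : ext a / 4 * cabs (Rder g a) <= 64 * M / d by apply: le_trans CB; apply: ler_wpM2r => //; exact: cabs_ge0.
have eE : eps * (ext a * d) <= ext a * cabs (Rder g a) * (x ^+ 2 * d).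
  have -> : ext a * cabs (Rder g a) * (x ^+ 2 * d) = cabs (Rder g a) / y%:R ^+ 2 * (ext a * d) by rewrite /x exprVn; ring.
  by rewrite ler_pM2r// mulr_gt0.
rewrite ler_pdivlMr// => h1.
have : eps * (ext a * d) <= 768 * (tau * (4 ^+ n * L)) * (ext a * d).
  apply: le_trans eE _.
  have -> : 768 * (tau * (4 ^+ n * L)) * (ext a * d) = 4 * x ^+ 2 * (64 * M) by rewrite /M /d; field.
  have -> : ext a * cabs (Rder g a) * (x ^+ 2 * d) = 4 * x ^+ 2 * (ext a / 4 * cabs (Rder g a) * d) by field.
  by rewrite ler_pM2l// mulr_gt0// exprn_gt0.
by rewrite ler_pM2r// mulr_gt0.
Qed.

Lemma compact_little_oh g : holo g -> compact_op p (Vop g) ->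
  forall eps : R, 0 < eps -> exists r : R, r < 1 /\
    forall z, r < normz z < 1 -> cabs (Rder g z) * (1 - normz z ^+ 2) ^+ 2 < eps.
Proof.
move=> hg cV eps e0; apply: contrapT => H.
have Hz (r : R) : r < 1 -> exists z, r < normz z < 1 /\ eps <= cabs (Rder g z) * rho z ^+ 2.
  move=> r1; apply: contrapT => H2; apply: H; exists r; split => // z zr.
  by rewrite ltNge; apply/negP => h; apply: H2; exists z.
have [L L0 HP] := exists_peak hg e0 Hz.
have [ay Hay] := choice (fun k => let: ex_intro a (ex_intro y P) := HP k in ex_intro (fun ay => peak g L (eps / 32) k ay.1 ay.2) (a, y) P).
have Ba k : Bn (ay k).1.
  by have [_ y2 a1 _ _] := Hay k; rewrite /Bn/= a1 lev_lt1//; exact: leq_trans y2.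
have [f Hf] := choice (fun k => ext_near p1 (Ba k)).
have hf k : holo (f k) by have [] := Hf k.
have f1 k : (Apint p (f k) <= 1%:E)%E by have [] := Hf k.
pose h k := peakfun (f k) (ay k).1 (ay k).2.
have hh k : holo (h k) by exact: holo_peakfun.
have h1 k : (Apint p (h k) <= 1%:E)%E.
  apply: le_trans (f1 k); apply: le_Apint => [|z Bz]; first exact: p1.
  rewrite cabsM cabsX -[leRHS]mulr1; apply: ler_wpM2l; first exact: cabs_ge0.
  by apply: exprn_ile1; [exact: cabs_ge0|apply: le_trans (cabs_peak_factor _ _) (ltW Bz)].
have hb : Abounded p h.
  split=> [k|]; first by split => //; apply: le_lt_trans (h1 k) (ltry _).
  by exists 1.
have hu : ucc0 h by apply: ucc0_peakfun => // k; have [] := Hay k.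
have nL : 0 < 4 ^+ n * L by rewrite mulr_gt0// exprn_gt0.
have K0 : 0 < 768 :> R by rewrite ltr0n.
(* Makes the bound of [peak_bound] equal to eps/64, below the eps/32 that the peaks guarantee. *)
pose tau := eps / 64 / 768 / (4 ^+ n * L).
have t0 : 0 < tau.
  apply: divr_gt0; last exact: nL.
  by apply: divr_gt0; last exact: K0; apply: divr_gt0; [exact: e0|rewrite ltr0n].
have [k Vk] := compact_op_small hg cV hb hu t0.
have [ky y2 a1 ek Lk] := Hay k.
have P : peak g L (eps / 32) 0 (ay k).1 (ay k).2 by [].
have := peak_bound hg (hh k) t0 L0 Vk P.
have -> : 768 * (tau * (4 ^+ n * L)) = eps / 64.
  have Et (x y v : R) : x != 0 -> y != 0 -> x * (v / x / y * y) = v.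
    by move=> x0 y0; rewrite divfK// mulrCA mulfV// mulr1.
  by rewrite /tau Et ?gt_eqF.
suff ha : ext (ay k).1 / 4 <= cabs (h k (ay k).1) by move=> /(_ ha); lra.
have [_ _ fk] := Hf k; apply: le_trans (peakfun_at _ y2 a1).
lra.
Qed.

End CompactLittleOh.

Theorem theorem4p4 (R : realType) (n : nat) (p : R) (g : 'rV[R[i]]_n -> (R[i])^o) :
  (0 < n)%N -> 1 <= p -> holo g ->
  (compact_op p (Vop g) <->
   vanishing_carleson p
     (fun z => cabs (Rder g z) `^ p * (1 - normz z ^+ 2) `^ (2 * p))) /\
  (vanishing_carleson p
     (fun z => cabs (Rder g z) `^ p * (1 - normz z ^+ 2) `^ (2 * p)) <->
   (forall eps : R, 0 < eps -> exists r : R, r < 1 /\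
      forall z, r < normz z < 1 -> cabs (Rder g z) * (1 - normz z ^+ 2) ^+ 2 < eps)).
Proof.
move=> _ p1 hg; split; split.
- by move=> cV; apply: (little_oh_carleson p1 hg); exact: compact_little_oh cV.
- exact: carleson_compact.
- by move=> vc; apply: compact_little_oh; [exact: p1|exact: hg|exact: carleson_compact].
- exact: little_oh_carleson.
Qed.
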